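(* Let $k$ be a $\sigma$-field, let $\mathcal G$ be an algebraic group over $k$ and $G\leq\mathcal G$ a $\sigma$-closed subgroup. For $i\geq0$ let $d_i=\dim(G[i])$ denote the dimension of the $i$-th order Zariski closure of $G$ in $\mathcal G$. Then there exist integers $d,e\geq0$ such that $$d_i=d(i+1)+e\quad\text{for all sufficiently large } i.$$ The integer $d$ only depends on $G$ and not on the choice of $\mathcal G$ and the $\sigma$-closed embedding $G\hookrightarrow\mathcal G$. If $d=0$, the integer $e$ only depends on $G$ and not on the choice of $\mathcal G$ and the $\sigma$-closed embedding $G\hookrightarrow\mathcal G$.
   Context: All rings are commutative and unital. A $\sigma$-ring is a ring with a ring endomorphism $\sigma$; a $\sigma$-field is a $\sigma$-ring that is a field. A $k$-$\sigma$-algebra is a $\sigma$-ring $R$ with a morphism of $\sigma$-rings $k\to R$; morphisms are $k$-algebra morphisms commuting with $\sigma$. It is finitely $\sigma$-generated if there is a finite $B\subseteq R$ such that $B,\sigma(B),\sigma^2(B),\dots$ generate $R$ as a $k$-algebra. A $\sigma$-ideal is an ideal $\mathfrak a$ with $\sigma(\mathfrak a)\subseteq\mathfrak a$. A $\sigma$-algebraic group over $k$ is a functor $G$ from $k$-$\sigma$-algebras to groups representable by a finitely $\sigma$-generated $k$-$\sigma$-algebra $k\{G\}$. A $\sigma$-closed subgroup $H\leq G$ is a subfunctor of the form $H(R)=\{\psi\in\mathrm{Hom}(k\{G\},R)\mid\mathbb I(H)\subseteq\ker\psi\}$ for a $\sigma$-ideal $\mathbb I(H)\subseteq k\{G\}$,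 with $H(R)$ a subgroup of $G(R)$ for all $R$; it is itself a $\sigma$-algebraic group with $k\{H\}=k\{G\}/\mathbb I(H)$. A morphism $G\to G'$ of $\sigma$-algebraic groups is a $\sigma$-closed embedding if the dual map $k\{G'\}\to k\{G\}$ is surjective, in which case $G$ is identified with a $\sigma$-closed subgroup of $G'$. An algebraic group $\mathcal G$ over $k$ is an affine group scheme of finite type over $k$ (not necessarily reduced). Put $\mathcal G[i]=\mathcal G\times{}^{\sigma}\mathcal G\times\cdots\times{}^{\sigma^i}\!\mathcal G$, where ${}^{\sigma^j}$ denotes base change along $\sigma^j\colon k\to k$. The functor $R\mapsto\mathcal G(R)$ on $k$-$\sigma$-algebras (forgetting $\sigma$ on $R$) is a $\sigma$-algebraic group, again denoted $\mathcal G$, with $k\{\mathcal G\}=\bigcup_i k[\mathcal G[i]]$ (inclusions dual to the projections onto the first factors; $\sigma$ sends $(r_0\otimes\lambda_0)\otimes\cdots\otimes(r_i\otimes\lambda_i)$, where $r_j\otimes\lambda_j\in k[\mathcal G]\otimes_{k,\sigma^j}k$, to $(1\otimes1)\otimes(r_0\otimes\sigma(\lambda_0))\otimes\cdots\otimes(r_i\otimes\sigma(\lambda_i))$). For a $\sigma$-closed subgroup $G\le\mathcal G$, its $i$-th order Zariski closure $G[i]\leq\mathcal G[i]$ is the closed subgroup defined by $\mathbb I(G)\cap k[\mathcal G[i]]$. That $d$ (resp. $e$) only depends on $G$ means: if $G\hookrightarrow\mathcal G'$ is another $\sigma$-closed embedding into an algebraic group over $k$, with corresponding integers $d',e'$,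 then $d=d'$ (resp. $e=e'$). *)

(* Defs.v *)
From HB Require Import structures.
From mathcomp Require Import all_boot all_algebra.
From mathcomp Require Import boolp.

Set Implicit Arguments.
Unset Strict Implicit.
Unset Printing Implicit Defensive.

Import GRing.Theory.
Local Open Scope ring_scope.
Local Open Scope quotient_scope.

(** The zero ring is a commutative ring, but MathComp's [comAlgType] and
    [{ideal_quot _}] exclude it; hence [comPzRingType] throughout, and a
    quotient construction for such rings. *)

Record ring_congr (T : choiceType) := RingCongr {
  rc_eq : T -> T -> Prop;
  rc_zero : T; rc_opp : T -> T; rc_add : T -> T -> T;
  rc_one : T; rc_mul : T -> T -> T;
  rc_refl : forall x, rc_eq x x;
  rc_sym : forall x y, rc_eq x y -> rc_eq y x;
  rc_trans : forall x y z, rc_eq x y -> rc_eq y z -> rc_eq x z;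
  rc_oppE : forall x x', rc_eq x x' -> rc_eq (rc_opp x) (rc_opp x');
  rc_addE : forall x x' y y', rc_eq x x' -> rc_eq y y' ->
    rc_eq (rc_add x y) (rc_add x' y');
  rc_mulE : forall x x' y y', rc_eq x x' -> rc_eq y y' ->
    rc_eq (rc_mul x y) (rc_mul x' y');
  rc_addA : forall x y z, rc_eq (rc_add x (rc_add y z)) (rc_add (rc_add x y) z);
  rc_addC : forall x y, rc_eq (rc_add x y) (rc_add y x);
  rc_add0 : forall x, rc_eq (rc_add rc_zero x) x;
  rc_addN : forall x, rc_eq (rc_add (rc_opp x) x) rc_zero;
  rc_mulA : forall x y z, rc_eq (rc_mul x (rc_mul y z)) (rc_mul (rc_mul x y) z);
  rc_mulC : forall x y, rc_eq (rc_mul x y) (rc_mul y x);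
  rc_mul1 : forall x, rc_eq (rc_mul rc_one x) x;
  rc_mulDl : forall x y z,
    rc_eq (rc_mul (rc_add x y) z) (rc_add (rc_mul x z) (rc_mul y z))
}.

Section RingQuot.
Variables (T : choiceType) (C : ring_congr T).

Definition rc_rel : rel T := fun x y => `[< rc_eq C x y >].

Lemma rc_rel_refl : reflexive rc_rel.
Proof. by move=> x; apply/asboolP/rc_refl. Qed.
Lemma rc_rel_sym : symmetric rc_rel.
Proof. by move=> x y; apply/asboolP/asboolP; exact: rc_sym. Qed.
Lemma rc_rel_trans : transitive rc_rel.
Proof.
by move=> y x z /asboolP xy /asboolP yz; apply/asboolP/(rc_trans xy yz).
Qed.

Canonical rc_equiv := EquivRel rc_rel rc_rel_refl rc_rel_sym rc_rel_trans.

Definition ring_quot := {eq_quot rc_equiv}.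
HB.instance Definition _ := Choice.on ring_quot.

Definition rq_pi (x : T) : ring_quot := \pi x.
Definition rq_repr (x : ring_quot) : T := repr x.

Lemma rq_reprK x : rq_pi (rq_repr x) = x.
Proof. exact: reprK. Qed.

Lemma rq_piP x y : (rq_pi x = rq_pi y) <-> rc_eq C x y.
Proof.
split=> [/eqmodP/asboolP//|xy]; apply/eqmodP; exact/asboolP.
Qed.

Lemma rq_repr_pi x : rc_eq C (rq_repr (rq_pi x)) x.
Proof. by apply/rq_piP; rewrite rq_reprK. Qed.

Definition rq_zero := rq_pi (rc_zero C).
Definition rq_opp x := rq_pi (rc_opp C (rq_repr x)).
Definition rq_add x y := rq_pi (rc_add C (rq_repr x) (rq_repr y)).
Definition rq_one := rq_pi (rc_one C).
Definition rq_mul x y := rq_pi (rc_mul C (rq_repr x) (rq_repr y)).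

Lemma rq_piN x : rq_pi (rc_opp C x) = rq_opp (rq_pi x).
Proof. by apply/rq_piP/rc_oppE/rc_sym/rq_repr_pi. Qed.
Lemma rq_piD x y : rq_pi (rc_add C x y) = rq_add (rq_pi x) (rq_pi y).
Proof. by apply/rq_piP/rc_addE; apply/rc_sym/rq_repr_pi. Qed.
Lemma rq_piM x y : rq_pi (rc_mul C x y) = rq_mul (rq_pi x) (rq_pi y).
Proof. by apply/rq_piP/rc_mulE; apply/rc_sym/rq_repr_pi. Qed.

Lemma rq_ind (P : ring_quot -> Prop) : (forall x, P (rq_pi x)) -> forall x, P x.
Proof. by move=> h x; rewrite -[x]rq_reprK. Qed.

Lemma rq_addA : associative rq_add.
Proof.
elim/rq_ind=> x; elim/rq_ind=> y; elim/rq_ind=> z.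
by rewrite -!rq_piD; apply/rq_piP/rc_addA.
Qed.
Lemma rq_addC : commutative rq_add.
Proof.
by elim/rq_ind=> x; elim/rq_ind=> y; rewrite -!rq_piD; apply/rq_piP/rc_addC.
Qed.
Lemma rq_add0 : left_id rq_zero rq_add.
Proof. by elim/rq_ind=> x; rewrite -!rq_piD; apply/rq_piP/rc_add0. Qed.
Lemma rq_addN : left_inverse rq_zero rq_opp rq_add.
Proof. by elim/rq_ind=> x; rewrite -rq_piN -!rq_piD; apply/rq_piP/rc_addN. Qed.
Lemma rq_mulA : associative rq_mul.
Proof.
elim/rq_ind=> x; elim/rq_ind=> y; elim/rq_ind=> z.
by rewrite -!rq_piM; apply/rq_piP/rc_mulA.
Qed.
Lemma rq_mulC : commutative rq_mul.
Proof.
by elim/rq_ind=> x; elim/rq_ind=> y; rewrite -!rq_piM; apply/rq_piP/rc_mulC.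
Qed.
Lemma rq_mul1 : left_id rq_one rq_mul.
Proof. by elim/rq_ind=> x; rewrite -!rq_piM; apply/rq_piP/rc_mul1. Qed.
Lemma rq_mulDl : left_distributive rq_mul rq_add.
Proof.
elim/rq_ind=> x; elim/rq_ind=> y; elim/rq_ind=> z.
by rewrite -!(rq_piM, rq_piD); apply/rq_piP/rc_mulDl.
Qed.

HB.instance Definition _ :=
  GRing.isZmodule.Build ring_quot rq_addA rq_addC rq_add0 rq_addN.
HB.instance Definition _ :=
  GRing.Zmodule_isComPzRing.Build ring_quot rq_mulA rq_mulC rq_mul1 rq_mulDl.

Lemma rq_pi0 : rq_pi (rc_zero C) = 0. Proof. by []. Qed.
Lemma rq_pi1 : rq_pi (rc_one C) = 1. Proof. by []. Qed.
Lemma rq_piDE x y : rq_pi (rc_add C x y) = rq_pi x + rq_pi y.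
Proof. exact: rq_piD. Qed.
Lemma rq_piME x y : rq_pi (rc_mul C x y) = rq_pi x * rq_pi y.
Proof. exact: rq_piM. Qed.

Record rq_hom (S : comPzRingType) (h : T -> S) : Prop := RqHom {
  rqh_eq : forall x y, rc_eq C x y -> h x = h y;
  rqh_add : forall x y, h (rc_add C x y) = h x + h y;
  rqh_one : h (rc_one C) = 1;
  rqh_mul : forall x y, h (rc_mul C x y) = h x * h y
}.

Definition rq_lift (S : comPzRingType) (h : T -> S) of rq_hom h :
  ring_quot -> S := fun x => h (rq_repr x).

Section Lift.
Variables (S : comPzRingType) (h : T -> S) (hh : rq_hom h).

Lemma rq_liftE x : rq_lift hh (rq_pi x) = h x.
Proof. exact/(rqh_eq hh)/rq_repr_pi. Qed.

Lemma rq_lift_is_zmod_morphism : zmod_morphism (rq_lift hh).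
Proof.
have hD : {morph rq_lift hh : x y / x + y}.
  elim/rq_ind=> x; elim/rq_ind=> y.
  by rewrite -rq_piDE !rq_liftE; exact: rqh_add.
move=> x y; have := hD (x - y) y; rewrite subrK => ->.
by rewrite addrK.
Qed.
Lemma rq_lift_is_monoid_morphism : monoid_morphism (rq_lift hh).
Proof.
split; first by rewrite -rq_pi1 rq_liftE (rqh_one hh).
elim/rq_ind=> x; elim/rq_ind=> y.
by rewrite -rq_piME !rq_liftE; exact: rqh_mul.
Qed.

HB.instance Definition _ :=
  GRing.isZmodMorphism.Build _ _ (rq_lift hh) rq_lift_is_zmod_morphism.
HB.instance Definition _ :=
  GRing.isMonoidMorphism.Build _ _ (rq_lift hh) rq_lift_is_monoid_morphism.
End Lift.

End RingQuot.

Record is_ideal (A : comPzRingType) (I : A -> Prop) : Prop := IsIdeal {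
  ideal0 : I 0;
  idealD : forall x y, I x -> I y -> I (x + y);
  idealM : forall a x, I x -> I (a * x)
}.

Record is_prime_ideal (A : comPzRingType) (P : A -> Prop) : Prop := IsPrime {
  prime_ideal : is_ideal P;
  prime_proper : ~ P 1;
  prime_mul : forall x y, P (x * y) -> P x \/ P y
}.

Definition has_prime_chain (A : comPzRingType) (n : nat) : Prop :=
  exists P : nat -> A -> Prop,
    (forall i, (i <= n)%N -> is_prime_ideal (P i)) /\
    (forall i, (i < n)%N ->
       (forall x, P i x -> P i.+1 x) /\ exists2 x, P i.+1 x & ~ P i x).

(** The Krull dimension of A is finite and equal to n; the zero ring, which has
    no prime ideals, has no dimension in this sense. *)
Definition krull_dim (A : comPzRingType) (n : nat) : Prop :=
  has_prime_chain A n /\ forall m, has_prime_chain A m -> (m <= n)%N.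

Section IdealQuot.
Variables (A : comPzRingType) (I : A -> Prop) (idI : is_ideal I).

Lemma idealN x : I x -> I (- x).
Proof. by move=> Ix; rewrite -mulN1r; exact: idealM. Qed.
Lemma idealB x y : I x -> I y -> I (x - y).
Proof. by move=> Ix Iy; apply: idealD => //; exact: idealN. Qed.

Lemma ideal_eq x y : x = y -> I (x - y).
Proof. by move=> ->; rewrite subrr; exact: ideal0. Qed.

Definition ideal_congr : ring_congr A.
Proof.
apply: (@RingCongr A (fun x y => I (x - y)) 0 -%R +%R 1 *%R).
- by move=> x; exact: ideal_eq.
- by move=> x y /idealN; rewrite opprB.
- by move=> x y z xy yz; have := idealD idI xy yz; rewrite addrA subrK.
- by move=> x y /idealN; rewrite opprB opprK addrC.
- move=> x x' y y' xx yy; have := idealD idI xx yy.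
  by rewrite addrACA -opprD.
- move=> x x' y y' xx yy.
  have := idealD idI (idealM idI y xx) (idealM idI x' yy).
  by rewrite !mulrBr (mulrC y x') addrA subrK (mulrC y x).
- by move=> x y z; apply: ideal_eq; rewrite addrA.
- by move=> x y; apply: ideal_eq; rewrite addrC.
- by move=> x; apply: ideal_eq; rewrite add0r.
- by move=> x; apply: ideal_eq; rewrite addNr.
- by move=> x y z; apply: ideal_eq; rewrite mulrA.
- by move=> x y; apply: ideal_eq; rewrite mulrC.
- by move=> x; apply: ideal_eq; rewrite mul1r.
- by move=> x y z; apply: ideal_eq; rewrite mulrDl.
Defined.

Definition ideal_quot : comPzRingType := ring_quot ideal_congr.
Definition ideal_pi : A -> ideal_quot := @rq_pi _ ideal_congr.

Lemma ideal_pi_is_zmod_morphism : zmod_morphism ideal_pi.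
Proof.
have hD : {morph ideal_pi : x y / x + y}.
  by move=> x y; exact: (@rq_piDE _ ideal_congr).
move=> x y; have := hD (x - y) y; rewrite subrK => ->.
by rewrite addrK.
Qed.
Lemma ideal_pi_is_monoid_morphism : monoid_morphism ideal_pi.
Proof. by split=> // x y; exact: (@rq_piME _ ideal_congr). Qed.
HB.instance Definition _ :=
  GRing.isZmodMorphism.Build _ _ ideal_pi ideal_pi_is_zmod_morphism.
HB.instance Definition _ :=
  GRing.isMonoidMorphism.Build _ _ ideal_pi ideal_pi_is_monoid_morphism.

Lemma ideal_pi_eq0 x : ideal_pi x = 0 <-> I x.
Proof.
rewrite -(rmorph0 ideal_pi); split=> [/rq_piP /=|Ix]; first by rewrite subr0.
by apply/rq_piP => /=; rewrite subr0.
Qed.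

Lemma ideal_pi_surj y : exists x, ideal_pi x = y.
Proof. by exists (rq_repr y); exact: rq_reprK. Qed.

Lemma ideal_lift_proof (S : comPzRingType) (f : {rmorphism A -> S}) :
  (forall x, I x -> f x = 0) -> rq_hom ideal_congr f.
Proof.
move=> fI; split; last first.
- by move=> x y; exact: rmorphM.
- exact: rmorph1.
- by move=> x y; exact: rmorphD.
by move=> x y /fI /eqP; rewrite rmorphB subr_eq0 => /eqP.
Qed.

Definition ideal_lift (S : comPzRingType) (f : {rmorphism A -> S})
    (fI : forall x, I x -> f x = 0) : {rmorphism ideal_quot -> S} :=
  rq_lift (ideal_lift_proof fI).

Lemma ideal_liftE S f fI x : @ideal_lift S f fI (ideal_pi x) = f x.
Proof. exact: rq_liftE. Qed.

End IdealQuot.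

Section Tensor.
Variables (K A B : comPzRingType) (f : {rmorphism K -> A}) (g : {rmorphism K -> B}).

Record balanced (M : zmodType) (b : A -> B -> M) : Prop := Balanced {
  balDl : forall x y z, b (x + y) z = b x z + b y z;
  balDr : forall x y z, b x (y + z) = b x y + b x z;
  balK : forall x c y, b (x * f c) y = b x (g c * y)
}.

Lemma bal0l (M : zmodType) (b : A -> B -> M) : balanced b -> forall y, b 0 y = 0.
Proof. by move=> bb y; apply: (addrI (b 0 y)); rewrite -(balDl bb) !addr0. Qed.

(** A sequence of pairs stands for the corresponding sum of pure tensors. *)
Definition tsum (M : zmodType) (b : A -> B -> M) (s : seq (A * B)) : M :=
  \sum_(p <- s) b p.1 p.2.

(** Two formal sums define the same element of the tensor product if and only
    if no balanced biadditive map separates them. *)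
Definition teq (s t : seq (A * B)) : Prop :=
  forall (M : zmodType) (b : A -> B -> M), balanced b -> tsum b s = tsum b t.

Definition topp (s : seq (A * B)) := [seq (- p.1, p.2) | p <- s].
Definition tmul (s t : seq (A * B)) :=
  [seq (p.1 * q.1, p.2 * q.2) | p <- s, q <- t].

Lemma tsum_cat (M : zmodType) (b : A -> B -> M) s t :
  tsum b (s ++ t) = tsum b s + tsum b t.
Proof. by rewrite /tsum big_cat. Qed.

Lemma tsum_opp (M : zmodType) (b : A -> B -> M) s : balanced b ->
  tsum b (topp s) = - tsum b s.
Proof.
move=> bb; rewrite /tsum big_map -sumrN; apply: eq_bigr => p _ /=.
by apply/eqP; rewrite -addr_eq0 -(balDl bb) addNr (bal0l bb).
Qed.

Lemma tsum_mul (M : zmodType) (b : A -> B -> M) s t :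
  tsum b (tmul s t) =
  tsum (fun x y => tsum (fun x' y' => b (x * x') (y * y')) t) s.
Proof. by rewrite /tsum /tmul big_allpairs_dep. Qed.

Lemma balanced_mul (M : zmodType) (b : A -> B -> M) t : balanced b ->
  balanced (fun x y => tsum (fun x' y' => b (x * x') (y * y')) t).
Proof.
move=> bb; split=> *; rewrite /tsum -?big_split; apply: eq_bigr => q _ /=.
- by rewrite mulrDl (balDl bb).
- by rewrite mulrDl (balDr bb).
- by rewrite -mulrA [f _ * _]mulrC mulrA (balK bb) mulrA.
Qed.

Lemma tmulC s t : teq (tmul s t) (tmul t s).
Proof.
move=> M b bb; rewrite !tsum_mul /tsum exchange_big; apply: eq_bigr => q _.
by apply: eq_bigr => p _; rewrite (mulrC p.1) (mulrC p.2).
Qed.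

Lemma tmulE s s' t t' : teq s s' -> teq t t' -> teq (tmul s t) (tmul s' t').
Proof.
have teqM u u' v : teq u u' -> teq (tmul u v) (tmul u' v).
  by move=> uu M b bb; rewrite !tsum_mul; exact/uu/balanced_mul.
move=> ss tt M b bb; rewrite (teqM _ _ _ ss) // (tmulC s' t) //.
by rewrite (teqM _ _ _ tt) // tmulC.
Qed.

Definition tensor_congr : ring_congr (seq (A * B)).
Proof.
apply: (@RingCongr _ teq [::] topp cat [:: (1, 1)] tmul).
- by [].
- by move=> x y xy M b bb; rewrite xy.
- by move=> x y z xy yz M b bb; rewrite xy // yz.
- by move=> x y xy M b bb; rewrite !tsum_opp // xy.
- by move=> x x' y y' xx yy M b bb; rewrite !tsum_cat xx // yy.
- exact: tmulE.
- by move=> x y z M b bb; rewrite catA.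
- by move=> x y M b bb; rewrite !tsum_cat addrC.
- by move=> x M b bb.
- by move=> x M b bb; rewrite tsum_cat tsum_opp // addNr /tsum big_nil.
- move=> x y z M b bb; rewrite !tsum_mul; apply: eq_bigr => p _ /=.
  rewrite tsum_mul; apply: eq_bigr => q _ /=.
  by apply: eq_bigr => r _ /=; rewrite !mulrA.
- exact: tmulC.
- move=> x M b bb; rewrite tsum_mul /tsum big_seq1; apply: eq_bigr => p _ /=.
  by rewrite !mul1r.
- by move=> x y z M b bb; rewrite tsum_cat !tsum_mul tsum_cat.
Defined.

Definition tensor : comPzRingType := ring_quot tensor_congr.

Definition tpure (a : A) (b : B) : tensor := @rq_pi _ tensor_congr [:: (a, b)].
Definition tinl (a : A) : tensor := tpure a 1.
Definition tinr (b : B) : tensor := tpure 1 b.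

Lemma tpureM a a' b b' : tpure (a * a') (b * b') = tpure a b * tpure a' b'.
Proof. by rewrite /tpure -rq_piME. Qed.
Lemma tpureDl a a' b : tpure (a + a') b = tpure a b + tpure a' b.
Proof.
rewrite /tpure -rq_piDE; apply/rq_piP => M h hh.
by rewrite /tsum big_seq1 /= big_cons big_seq1 (balDl hh).
Qed.
Lemma tpureDr a b b' : tpure a (b + b') = tpure a b + tpure a b'.
Proof.
rewrite /tpure -rq_piDE; apply/rq_piP => M h hh.
by rewrite /tsum big_seq1 /= big_cons big_seq1 (balDr hh).
Qed.
Lemma tpureE a b : tpure a b = tinl a * tinr b.
Proof. by rewrite -tpureM mulr1 mul1r. Qed.

Lemma tinl_is_zmod_morphism : zmod_morphism tinl.
Proof.
move=> x y; have := tpureDl (x - y) y 1; rewrite subrK -/(tinl x) /tinl => ->.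
by rewrite addrK.
Qed.
Lemma tinl_is_monoid_morphism : monoid_morphism tinl.
Proof. by split=> // x y; rewrite /tinl -[in LHS](mulr1 1) tpureM. Qed.
Lemma tinr_is_zmod_morphism : zmod_morphism tinr.
Proof.
move=> x y; have := tpureDr 1 (x - y) y; rewrite subrK /tinr => ->.
by rewrite addrK.
Qed.
Lemma tinr_is_monoid_morphism : monoid_morphism tinr.
Proof. by split=> // x y; rewrite /tinr -[in LHS](mulr1 1) tpureM. Qed.

HB.instance Definition _ :=
  GRing.isZmodMorphism.Build _ _ tinl tinl_is_zmod_morphism.
HB.instance Definition _ :=
  GRing.isMonoidMorphism.Build _ _ tinl tinl_is_monoid_morphism.
HB.instance Definition _ :=
  GRing.isZmodMorphism.Build _ _ tinr tinr_is_zmod_morphism.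
HB.instance Definition _ :=
  GRing.isMonoidMorphism.Build _ _ tinr tinr_is_monoid_morphism.

Lemma tinlr c : tinl (f c) = tinr (g c).
Proof.
apply/rq_piP => M h hh; rewrite /tsum !big_seq1 /=.
by rewrite -[f c]mul1r (balK hh) mulr1.
Qed.

Lemma tensor_ind (P : tensor -> Prop) : P 0 ->
  (forall x y, P x -> P y -> P (x + y)) -> (forall a b, P (tpure a b)) ->
  forall x, P x.
Proof.
move=> P0 PD Pp; elim/rq_ind; elim=> [|[a b] s IH] //.
have -> : @rq_pi _ tensor_congr ((a, b) :: s)
        = tpure a b + @rq_pi _ tensor_congr s by rewrite /tpure -rq_piDE.
exact: PD.
Qed.

Lemma tensor_ext (S : comPzRingType) (u v : {rmorphism tensor -> S}) :
  (forall a, u (tinl a) = v (tinl a)) -> (forall b, u (tinr b) = v (tinr b)) ->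
  u =1 v.
Proof.
move=> ul ur; elim/tensor_ind => [|x y hx hy|a b]; first by rewrite !rmorph0.
  by rewrite !rmorphD hx hy.
by rewrite tpureE !rmorphM ul ur.
Qed.

Section TensorLift.
Variables (S : comPzRingType) (u : {rmorphism A -> S}) (v : {rmorphism B -> S}).
Hypothesis uv : forall c, u (f c) = v (g c).

Lemma tensor_lift_proof : rq_hom tensor_congr (tsum (fun a b => u a * v b)).
Proof.
split.
- move=> x y xy; apply: xy; split=> [x1 x2 y1|x1 y1 y2|x1 c y1].
  + by rewrite rmorphD mulrDl.
  + by rewrite rmorphD mulrDr.
  + by rewrite !rmorphM uv mulrA.
- by move=> x y; exact: tsum_cat.
- by rewrite /tsum big_seq1 !rmorph1 mulr1.
- move=> x y /=; rewrite tsum_mul /tsum mulr_suml; apply: eq_bigr => p _.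
  by rewrite mulr_sumr; apply: eq_bigr => q _; rewrite !rmorphM mulrACA.
Qed.

Definition tensor_lift : {rmorphism tensor -> S} := rq_lift tensor_lift_proof.

Lemma tensor_lift_pure a b : tensor_lift (tpure a b) = u a * v b.
Proof. by rewrite [LHS]rq_liftE /tsum big_seq1. Qed.
Lemma tensor_liftl a : tensor_lift (tinl a) = u a.
Proof. by rewrite tensor_lift_pure rmorph1 mulr1. Qed.
Lemma tensor_liftr b : tensor_lift (tinr b) = v b.
Proof. by rewrite tensor_lift_pure rmorph1 mul1r. Qed.
End TensorLift.

End Tensor.

(** Direct limit of a sequence of rings.  Its elements are sequences that are
    eventually coherent with the transition maps, two of them being identified
    when they eventually agree.  When the transition maps are injective this is
    the union of the [A_ i]. *)

Fixpoint colim_push (A_ : nat -> comPzRingType)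
    (t_ : forall i, {rmorphism A_ i -> A_ i.+1}) (i : nat) (x : A_ 0) : A_ i :=
  if i is j.+1 then t_ j (colim_push t_ j x) else x.

(** The sequence that is 0 below n, and the image of x from n on. *)
Fixpoint colim_extend (n : nat) : forall (A_ : nat -> comPzRingType)
    (t_ : forall i, {rmorphism A_ i -> A_ i.+1}), A_ n -> forall i, A_ i :=
  match n with
  | 0 => fun A_ t_ x i => colim_push t_ i x
  | m.+1 => fun A_ t_ x i =>
      match i with
      | 0 => 0
      | j.+1 => colim_extend (A_ := fun l => A_ l.+1) (fun l => t_ l.+1) x j
      end
  end.

Section Colim.
Variables (A_ : nat -> comPzRingType) (t_ : forall i, {rmorphism A_ i -> A_ i.+1}).

Definition coherent_from (N : nat) (s : forall i, A_ i) : Prop :=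
  forall i, (N <= i)%N -> s i.+1 = t_ i (s i).

Definition colim_seq : Type :=
  {s : forall i, A_ i | exists N, coherent_from N s}.
HB.instance Definition _ := gen_eqMixin colim_seq.
HB.instance Definition _ := gen_choiceMixin colim_seq.

Definition colim_eq (s s' : colim_seq) : Prop :=
  exists N, forall i, (N <= i)%N -> sval s i = sval s' i.

Program Definition colim0 : colim_seq := exist _ (fun i => 0) _.
Next Obligation. by exists 0 => i _; rewrite rmorph0. Qed.
Program Definition colim1 : colim_seq := exist _ (fun i => 1) _.
Next Obligation. by exists 0 => i _; rewrite rmorph1. Qed.
Program Definition colim_opp (s : colim_seq) : colim_seq :=
  exist _ (fun i => - sval s i) _.
Next Obligation.
by case: s => s [N sN]; exists N => i Ni /=; rewrite sN // rmorphN.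
Qed.
Program Definition colim_add (s s' : colim_seq) : colim_seq :=
  exist _ (fun i => sval s i + sval s' i) _.
Next Obligation.
case: s s' => [s [N sN]] [s' [N' sN']]; exists (maxn N N') => i /=.
by rewrite geq_max => /andP[Ni Ni']; rewrite sN // sN' // rmorphD.
Qed.
Program Definition colim_mul (s s' : colim_seq) : colim_seq :=
  exist _ (fun i => sval s i * sval s' i) _.
Next Obligation.
case: s s' => [s [N sN]] [s' [N' sN']]; exists (maxn N N') => i /=.
by rewrite geq_max => /andP[Ni Ni']; rewrite sN // sN' // rmorphM.
Qed.

Definition colim_congr : ring_congr colim_seq.
Proof.
apply: (@RingCongr _ colim_eq colim0 colim_opp colim_add colim1 colim_mul).
- by move=> x; exists 0.
- by move=> x y [N h]; exists N => i /h.
- move=> x y z [N h] [M h']; exists (maxn N M) => i.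
  by rewrite geq_max => /andP[/h -> /h' ->].
- by move=> x y [N h]; exists N => i /h /= ->.
- move=> x x' y y' [N h] [M h']; exists (maxn N M) => i /=.
  by rewrite geq_max => /andP[/h -> /h' ->].
- move=> x x' y y' [N h] [M h']; exists (maxn N M) => i /=.
  by rewrite geq_max => /andP[/h -> /h' ->].
- by move=> x y z; exists 0 => i _ /=; rewrite addrA.
- by move=> x y; exists 0 => i _ /=; rewrite addrC.
- by move=> x; exists 0 => i _ /=; rewrite add0r.
- by move=> x; exists 0 => i _ /=; rewrite addNr.
- by move=> x y z; exists 0 => i _ /=; rewrite mulrA.
- by move=> x y; exists 0 => i _ /=; rewrite mulrC.
- by move=> x; exists 0 => i _ /=; rewrite mul1r.
- by move=> x y z; exists 0 => i _ /=; rewrite mulrDl.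
Defined.

Definition colim : comPzRingType := ring_quot colim_congr.

End Colim.

Lemma colim_extend_coherent n (A_ : nat -> comPzRingType)
  (t_ : forall i, {rmorphism A_ i -> A_ i.+1}) (x : A_ n) :
  coherent_from t_ n (colim_extend t_ x).
Proof.
elim: n A_ t_ x => [|n IH] A_ t_ x [|i] //= ni.
exact: (IH (fun l => A_ l.+1) (fun l => t_ l.+1)).
Qed.

Lemma colim_extend_diag n (A_ : nat -> comPzRingType)
  (t_ : forall i, {rmorphism A_ i -> A_ i.+1}) (x : A_ n) : colim_extend t_ x n = x.
Proof.
elim: n A_ t_ x => [|n IH] A_ t_ x //=.
exact: (IH (fun l => A_ l.+1) (fun l => t_ l.+1)).
Qed.

Section ColimIn.
Variables (A_ : nat -> comPzRingType) (t_ : forall i, {rmorphism A_ i -> A_ i.+1}).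

Lemma coherent_inj n (s s' : forall i, A_ i) :
  coherent_from t_ n s -> coherent_from t_ n s' -> s n = s' n ->
  forall i, (n <= i)%N -> s i = s' i.
Proof.
move=> sn s'n ss i /subnKC <-; elim: (i - n)%N => [|m IH]; first by rewrite addn0.
by rewrite addnS sn ?leq_addr // s'n ?leq_addr // IH.
Qed.

Definition colim_in (n : nat) (x : A_ n) : colim t_ :=
  @rq_pi _ (colim_congr t_)
    (exist _ (colim_extend t_ x) (ex_intro _ n (colim_extend_coherent t_ x))).

Lemma colim_in_pi n (s : colim_seq t_) : coherent_from t_ n (sval s) ->
  @rq_pi _ (colim_congr t_) s = colim_in (sval s n).
Proof.
move=> sn; apply/rq_piP; exists n => /=; apply: coherent_inj => //.
  exact: colim_extend_coherent.
by rewrite colim_extend_diag.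
Qed.

Lemma colim_in_surj (x : colim t_) : exists n (y : A_ n), x = colim_in y.
Proof.
elim/rq_ind: x => s; have [N sN] := svalP s.
by exists N, (sval s N); exact: colim_in_pi.
Qed.

Lemma colim_in_t n (x : A_ n) : colim_in (t_ n x) = colim_in x.
Proof.
rewrite [RHS](@colim_in_pi n.+1) /=.
  by rewrite (colim_extend_coherent t_ x) // colim_extend_diag.
by move=> i ni; apply: colim_extend_coherent; exact: ltnW.
Qed.

Lemma colim_in_is_zmod_morphism n : zmod_morphism (@colim_in n).
Proof.
have hD : {morph @colim_in n : x y / x + y}.
  move=> x y; rewrite /colim_in -rq_piDE; symmetry.
  rewrite (@colim_in_pi n) /= ?colim_extend_diag // => i ni.
  by rewrite !(colim_extend_coherent t_ _ ni) rmorphD.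
move=> x y; have := hD (x - y) y; rewrite subrK => ->.
by rewrite addrK.
Qed.
Lemma colim_in_is_monoid_morphism n : monoid_morphism (@colim_in n).
Proof.
split=> [|x y].
  by rewrite -rq_pi1 (@colim_in_pi n) //= => i _; rewrite rmorph1.
rewrite /colim_in -rq_piME; symmetry.
rewrite (@colim_in_pi n) /= ?colim_extend_diag // => i ni.
by rewrite !(colim_extend_coherent t_ _ ni) rmorphM.
Qed.
HB.instance Definition _ n :=
  GRing.isZmodMorphism.Build _ _ (@colim_in n) (@colim_in_is_zmod_morphism n).
HB.instance Definition _ n :=
  GRing.isMonoidMorphism.Build _ _ (@colim_in n) (@colim_in_is_monoid_morphism n).

Section ColimLift.
Variables (S : comPzRingType) (c_ : forall i, {rmorphism A_ i -> S}).
Hypothesis ct : forall i x, c_ i.+1 (t_ i x) = c_ i x.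

Definition colim_lift_fun (s : colim_seq t_) : S :=
  let N := sval (cid (svalP s)) in c_ N (sval s N).

Lemma colim_lift_funE n (s : colim_seq t_) : coherent_from t_ n (sval s) ->
  colim_lift_fun s = c_ n (sval s n).
Proof.
rewrite /colim_lift_fun; case: (cid _) => N /= sN sn.
have cst M i : coherent_from t_ M (sval s) -> (M <= i)%N ->
    c_ i (sval s i) = c_ M (sval s M).
  move=> sM /subnKC <-; elim: (i - M)%N => [|m IH]; first by rewrite addn0.
  by rewrite addnS sM ?leq_addr // ct.
by rewrite -(cst _ _ sN (leq_maxl N n)) -(cst _ _ sn (leq_maxr N n)).
Qed.

Lemma colim_lift_proof : rq_hom (colim_congr t_) colim_lift_fun.
Proof.
have coh (s : colim_seq t_) : exists N, forall i, (N <= i)%N ->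
    coherent_from t_ i (sval s).
  by have [N sN] := svalP s; exists N => i Ni j ij; exact/sN/(leq_trans Ni).
split.
- move=> x y [N h]; have [M xM] := coh x; have [L yL] := coh y.
  pose n := maxn N (maxn M L).
  rewrite (@colim_lift_funE n x) ?(@colim_lift_funE n y) ?h ?leq_maxl //.
  + by apply: yL; rewrite /n !leq_max leqnn !orbT.
  + by apply: xM; rewrite /n !leq_max leqnn !orbT.
- move=> x y; have [M xM] := coh x; have [L yL] := coh y.
  have [Z zZ] := coh (rc_add (colim_congr t_) x y).
  pose n := maxn Z (maxn M L).
  rewrite (@colim_lift_funE n x) ?(@colim_lift_funE n y) ?(@colim_lift_funE n (_ x y));
    rewrite ?rmorphD //; [apply: zZ | apply: yL | apply: xM];
    by rewrite /n !leq_max leqnn ?orbT.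
- by rewrite (@colim_lift_funE 0) ?rmorph1 // => i _ /=; rewrite rmorph1.
- move=> x y; have [M xM] := coh x; have [L yL] := coh y.
  have [Z zZ] := coh (rc_mul (colim_congr t_) x y).
  pose n := maxn Z (maxn M L).
  rewrite (@colim_lift_funE n x) ?(@colim_lift_funE n y) ?(@colim_lift_funE n (_ x y));
    rewrite ?rmorphM //; [apply: zZ | apply: yL | apply: xM];
    by rewrite /n !leq_max leqnn ?orbT.
Qed.

Definition colim_lift : {rmorphism colim t_ -> S} := rq_lift colim_lift_proof.

Lemma colim_liftE n (x : A_ n) : colim_lift (colim_in x) = c_ n x.
Proof.
rewrite [LHS]rq_liftE (@colim_lift_funE n) /= ?colim_extend_diag //.
exact: colim_extend_coherent.
Qed.
End ColimLift.

End ColimIn.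

Record algebra (k : fieldType) := Algebra {
  alg_ring :> comPzRingType;
  alg_in : {rmorphism k -> alg_ring}
}.

Record semihom (k : fieldType) (tau : k -> k) (A B : algebra k) := SemiHom {
  semihom_fun :> {rmorphism A -> B};
  semihom_in : forall c, semihom_fun (alg_in A c) = alg_in B (tau c)
}.

Notation khom A B := (semihom idfun A B).

Lemma rmorphism_ext (R S : comPzRingType) (f g : {rmorphism R -> S}) :
  f =1 g -> f = g.
Proof.
case: f g => [f cf] [g cg] fg; have efg : f = g by exact/funext.
subst g; case: cf cg {fg} => [m1 m2] [m1' m2'].
case: m1 m1' => p1 [p1']; case: m2 m2' => p2 [p2'].
by rewrite (Prop_irrelevance p1 p1') (Prop_irrelevance p2 p2').
Qed.

Lemma semihom_ext (k : fieldType) (tau : k -> k) (A B : algebra k)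
  (f g : semihom tau A B) : f =1 g -> f = g.
Proof.
case: f g => f hf [g hg] /= fg; have efg := rmorphism_ext fg; subst g.
by congr SemiHom; exact: Prop_irrelevance.
Qed.

Definition khom_comp (k : fieldType) (A B C : algebra k)
  (g : khom B C) (f : khom A B) : khom A C.
Proof.
apply: (@SemiHom _ _ A C (g \o f : {rmorphism A -> C})) => c /=.
by rewrite !semihom_in.
Defined.

Record is_subalgebra (k : fieldType) (A : algebra k) (S : A -> Prop) : Prop :=
  IsSubalgebra {
    subalg_in : forall c, S (alg_in A c);
    subalgD : forall x y, S x -> S y -> S (x + y);
    subalgM : forall x y, S x -> S y -> S (x * y)
  }.

Definition generates (k : fieldType) (A : algebra k) (B : A -> Prop) : Prop :=
  forall S : A -> Prop, is_subalgebra S -> (forall x, B x -> S x) ->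
  forall x, S x.

Definition finitely_generated (k : fieldType) (A : algebra k) : Prop :=
  exists s : seq A, generates (fun x : A => x \in s).

Record salgebra (k : fieldType) (sigma : {rmorphism k -> k}) := SAlgebra {
  salg_alg :> algebra k;
  salg_sigma : semihom sigma salg_alg salg_alg
}.

Definition finitely_sgenerated (k : fieldType) (sigma : {rmorphism k -> k})
    (A : salgebra sigma) : Prop :=
  exists s : seq A,
    generates (fun x : A => exists j b, b \in s /\ x = iter j (salg_sigma A) b).

Record shom (k : fieldType) (sigma : {rmorphism k -> k}) (A B : salgebra sigma) :=
  SHom {
    shom_hom :> khom A B;
    shom_sigma : forall x, shom_hom (salg_sigma A x) = salg_sigma B (shom_hom x)
  }.

Lemma shom_ext (k : fieldType) (sigma : {rmorphism k -> k}) (A B : salgebra sigma)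
  (f g : shom A B) : f =1 g -> f = g.
Proof.
case: f g => f hf [g hg] /= fg; have efg := semihom_ext fg; subst g.
by congr SHom; exact: Prop_irrelevance.
Qed.

Definition shom_comp (k : fieldType) (sigma : {rmorphism k -> k})
  (A B C : salgebra sigma) (g : shom B C) (f : shom A B) : shom A C.
Proof.
apply: (@SHom _ _ A C (khom_comp g f)) => x /=.
by rewrite !shom_sigma.
Defined.

Record group_on (T : Type) := GroupOn {
  gone : T; ginv : T -> T; gmul : T -> T -> T;
  gmulA : associative gmul;
  gmul1 : left_id gone gmul;
  gmulV : left_inverse gone ginv gmul
}.

(** An affine group scheme of finite type over k, given by its coordinate ring
    and a functorial group structure on the points of the functor it
    represents. *)
Record alggroup (k : fieldType) := AlgGroup {
  coord : algebra k;
  coord_fg : finitely_generated coord;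
  points : forall R : algebra k, group_on (khom coord R);
  points_functorial : forall (R S : algebra k) (h : khom R S)
      (x y : khom coord R),
    khom_comp h (gmul (points R) x y)
    = gmul (points S) (khom_comp h x) (khom_comp h y)
}.

Record sgroup (k : fieldType) (sigma : {rmorphism k -> k}) := SGroup {
  scoord : salgebra sigma;
  scoord_fg : finitely_sgenerated scoord;
  spoints : forall R : salgebra sigma, group_on (shom scoord R);
  spoints_functorial : forall (R S : salgebra sigma) (h : shom R S)
      (x y : shom scoord R),
    shom_comp h (gmul (spoints R) x y)
    = gmul (spoints S) (shom_comp h x) (shom_comp h y)
}.

(** If I is the ideal of a sigma-closed subgroup H of G, then H(R) is the set of
    the x in G(R) with [vanishes_on I x]. *)
Definition vanishes_on (k : fieldType) (sigma : {rmorphism k -> k})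
    (A R : salgebra sigma) (I : A -> Prop) (x : shom A R) : Prop :=
  forall a, I a -> x a = 0.

Record sclosed_subgroup (k : fieldType) (sigma : {rmorphism k -> k})
    (G : sgroup sigma) := SClosed {
  sideal :> scoord G -> Prop;
  sideal_ideal : is_ideal sideal;
  sideal_sigma : forall x, sideal x -> sideal (salg_sigma (scoord G) x);
  sclosed1 : forall R, vanishes_on sideal (gone (spoints G R));
  sclosedV : forall R (x : shom (scoord G) R), vanishes_on sideal x ->
    vanishes_on sideal (ginv (spoints G R) x);
  sclosedM : forall R (x y : shom (scoord G) R), vanishes_on sideal x ->
    vanishes_on sideal y -> vanishes_on sideal (gmul (spoints G R) x y)
}.

(** A sigma-closed embedding G -> G', given by its dual map k{G'} -> k{G}. *)
Record sclosed_embedding (k : fieldType) (sigma : {rmorphism k -> k})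
    (G G' : sgroup sigma) := SEmbedding {
  semb_dual :> shom (scoord G') (scoord G);
  semb_morphism : forall R (x y : shom (scoord G) R),
    shom_comp (gmul (spoints G R) x y) semb_dual
    = gmul (spoints G' R) (shom_comp x semb_dual) (shom_comp y semb_dual);
  semb_surj : forall y, exists x, semb_dual x = y
}.

Section SubGroupOn.
Variables (T U : Type) (gU : group_on U) (i : T -> U).
Hypothesis inj_i : injective i.
Hypothesis i1 : exists t, i t = gone gU.
Hypothesis iV : forall x, exists t, i t = ginv gU (i x).
Hypothesis iM : forall x y, exists t, i t = gmul gU (i x) (i y).

Let sg1 : T := sval (cid i1).
Let sgV x : T := sval (cid (iV x)).
Let sgM x y : T := sval (cid (iM x y)).
Let sg1E : i sg1 = gone gU. Proof. exact: svalP (cid i1). Qed.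
Let sgVE x : i (sgV x) = ginv gU (i x). Proof. exact: svalP (cid (iV x)). Qed.
Let sgME x y : i (sgM x y) = gmul gU (i x) (i y).
Proof. exact: svalP (cid (iM x y)). Qed.

Definition subgroup_on : group_on T.
Proof.
apply: (@GroupOn T sg1 sgV sgM).
- by move=> x y z; apply: inj_i; rewrite !sgME gmulA.
- by move=> x; apply: inj_i; rewrite sgME sg1E gmul1.
- by move=> x; apply: inj_i; rewrite sgME sgVE gmulV sg1E.
Defined.

Lemma subgroup_onM x y : i (gmul subgroup_on x y) = gmul gU (i x) (i y).
Proof. exact: sgME. Qed.
Lemma subgroup_onV x : i (ginv subgroup_on x) = ginv gU (i x).
Proof. exact: sgVE. Qed.
Lemma subgroup_on1 : i (gone subgroup_on) = gone gU.
Proof. exact: sg1E. Qed.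
End SubGroupOn.

Lemma group_on_invE (T : Type) (g : group_on T) (x y : T) :
  gmul g x y = gone g -> x = ginv g y.
Proof.
have idr z : gmul g z (ginv g z) = gone g.
  rewrite -[LHS](gmul1 g) -[X in gmul g X _](gmulV g (ginv g z)) -gmulA.
  by rewrite [X in gmul g _ X]gmulA gmulV gmul1 gmulV.
have mul1 z : gmul g z (gone g) = z by rewrite -(gmulV g z) gmulA idr gmul1.
by move=> xy; rewrite -[x]mul1 -(idr y) gmulA xy gmul1.
Qed.

Lemma group_on_mulI (T : Type) (g : group_on T) (x : T) :
  gmul g x x = x -> x = gone g.
Proof.
by move=> xx; rewrite -(gmulV g x) -[X in gmul g _ X]xx gmulA gmulV gmul1.
Qed.

Section Prolongation.
Variables (k : fieldType) (sigma : {rmorphism k -> k}).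

Fixpoint sigma_pow (j : nat) : {rmorphism k -> k} :=
  if j is j'.+1 then sigma \o sigma_pow j' else idfun.

Section BaseChange.
Variable A : algebra k.

(** The base change of A along sigma^j: the tensor product of A and k over k,
    where k acts on the second factor through sigma^j, made into a k-algebra
    via the second factor. *)
Definition base_change (j : nat) : algebra k :=
  @Algebra k (tensor (alg_in A) (sigma_pow j)) (tinr (alg_in A) (sigma_pow j)).

Definition bc_pure (j : nat) (r : A) (c : k) : base_change j :=
  tpure (alg_in A) (sigma_pow j) r c.

Lemma bc_shift_proof j (c : k) :
  tinl (alg_in A) (sigma_pow j.+1) (alg_in A c)
  = (tinr (alg_in A) (sigma_pow j.+1) \o sigma) (sigma_pow j c).
Proof. exact: tinlr. Qed.

Definition bc_shift (j : nat) : semihom sigma (base_change j) (base_change j.+1).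
Proof.
apply: (@SemiHom _ _ (base_change j) (base_change j.+1)
  (tensor_lift (bc_shift_proof j))) => c.
exact: tensor_liftr.
Defined.

Lemma bc_shift_l j r :
  bc_shift j (tinl (alg_in A) (sigma_pow j) r) = tinl (alg_in A) (sigma_pow j.+1) r.
Proof. exact: tensor_liftl. Qed.

Lemma bc_shiftE j r c : bc_shift j (bc_pure j r c) = bc_pure j.+1 r (sigma c).
Proof. by rewrite [LHS]tensor_lift_pure [RHS]tpureE. Qed.

End BaseChange.

Definition alg_tensor (A B : algebra k) : algebra k :=
  @Algebra k (tensor (alg_in A) (alg_in B))
    (tinl (alg_in A) (alg_in B) \o alg_in A).

Section Coordinates.
Variable A : algebra k.

(** The coordinate ring of the product of the base changes of Spec A along
    sigma^0, ..., sigma^i.  The base change along sigma^0 = id is A itself, up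
    to the isomorphism r |-> r (x) 1.  Only the scheme underlying this product
    is needed, as only dimensions of closed subschemes of it are considered. *)
Fixpoint prol (i : nat) : algebra k :=
  if i is i'.+1 then alg_tensor (prol i') (base_change A i'.+1)
  else base_change A 0.

(** Dual to the projection onto the first factors. *)
Definition prol_incl (i : nat) : {rmorphism prol i -> prol i.+1} :=
  tinl (alg_in (prol i)) (alg_in (base_change A i.+1)).

Definition prol_last (i : nat) : {rmorphism base_change A i.+1 -> prol i.+1} :=
  tinr (alg_in (prol i)) (alg_in (base_change A i.+1)).

Lemma prol_last_in i c : prol_last i (alg_in _ c) = alg_in (prol i.+1) c.
Proof. by rewrite -[LHS]tinlr. Qed.

Lemma prol_shift_proof i (s : semihom sigma (prol i) (prol i.+1)) c :
  (prol_incl i.+1 \o s) (alg_in (prol i) c)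
  = (prol_last i.+1 \o bc_shift A i.+1) (alg_in (base_change A i.+1) c).
Proof.
rewrite -[RHS]/(prol_last i.+1 _) semihom_in prol_last_in.
by rewrite -[LHS]/(prol_incl i.+1 _) semihom_in.
Qed.

(** x_0 (x) ... (x) x_i |-> 1 (x) bc_shift x_0 (x) ... (x) bc_shift x_i *)
Fixpoint prol_shift (i : nat) : semihom sigma (prol i) (prol i.+1).
Proof.
case: i => [|i].
- apply: (@SemiHom _ _ (prol 0) (prol 1) (prol_last 0 \o bc_shift A 0)) => c.
  exact: etrans (congr1 (prol_last 0) (semihom_in (bc_shift A 0) c))
                (prol_last_in 0 (sigma c)).
- apply: (@SemiHom _ _ (prol i.+1) (prol i.+2)
    (tensor_lift (prol_shift_proof (prol_shift i)))) => c.
  by rewrite [LHS]tensor_liftl /= semihom_in.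
Defined.

Lemma prol_shift0E (x : base_change A 0) :
  prol_shift 0 x = prol_last 0 (bc_shift A 0 x).
Proof. by []. Qed.

Lemma prol_shiftE i (x : prol i) (y : base_change A i.+1) :
  prol_shift i.+1 (tpure _ _ x y)
  = tpure _ _ (prol_shift i x) (bc_shift A i.+1 y).
Proof. by rewrite [LHS]tensor_lift_pure [RHS]tpureE. Qed.

Lemma prol_shift_incl i x :
  prol_shift i.+1 (prol_incl i x) = prol_incl i.+1 (prol_shift i x).
Proof. exact: tensor_liftl. Qed.

Lemma prol_shift_last i y :
  prol_shift i.+1 (prol_last i y) = prol_last i.+1 (bc_shift A i.+1 y).
Proof. exact: tensor_liftr. Qed.

(** If A is the coordinate ring of G, this is k{G}, the union of the k[G[i]]. *)
Definition prol_ring : comPzRingType := colim prol_incl.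

Definition prol_in (i : nat) : {rmorphism prol i -> prol_ring} :=
  @colim_in _ prol_incl i.

Definition prol_alg : algebra k :=
  @Algebra k prol_ring (prol_in 0 \o alg_in (prol 0)).

Lemma prol_in_incl i x : prol_in i.+1 (prol_incl i x) = prol_in i x.
Proof. exact: colim_in_t. Qed.

Lemma prol_in_in i c : prol_in i (alg_in (prol i) c) = alg_in prol_alg c.
Proof.
elim: i => [|i IH]; first by [].
rewrite -IH -[RHS]prol_in_incl.
reflexivity.
Qed.

Lemma prol_sigma_proof i x :
  (prol_in i.+2 \o prol_shift i.+1) (prol_incl i x)
  = (prol_in i.+1 \o prol_shift i) x.
Proof. by rewrite /= prol_shift_incl prol_in_incl. Qed.

Definition prol_sigma : semihom sigma prol_alg prol_alg.
Proof.
apply: (@SemiHom _ _ prol_alg prol_alg (colim_lift prol_sigma_proof)) => c.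
rewrite [LHS]colim_liftE.
exact: etrans (congr1 (prol_in 1) (semihom_in (prol_shift 0) c)) (prol_in_in 1 _).
Defined.

Lemma prol_sigmaE i x : prol_sigma (prol_in i x) = prol_in i.+1 (prol_shift i x).
Proof. exact: colim_liftE. Qed.

Definition prol_salg : salgebra sigma := SAlgebra prol_sigma.

(** The inclusion of A = k[G[0]] in k{G} *)
Definition prol_emb : khom A prol_alg.
Proof.
apply: (@SemiHom _ _ A prol_alg
  (prol_in 0 \o tinl (alg_in A) (sigma_pow 0))) => c.
refine (etrans (congr1 (prol_in 0) (tinlr (alg_in A) (sigma_pow 0) c)) _).
reflexivity.
Defined.

Lemma bc_pureE j (r : A) c :
  bc_pure j r c = bc_pure j r 1 * alg_in (base_change A j) c.
Proof. exact: tpureE. Qed.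

Lemma prol_emb_iter0 r c :
  prol_emb r * alg_in prol_alg c = prol_in 0 (bc_pure 0 r c).
Proof.
by rewrite (bc_pureE 0 r c) (rmorphM (prol_in 0)) prol_in_in.
Qed.

Lemma prol_emb_iter1 j (r : A) :
  iter j.+1 prol_sigma (prol_emb r) = prol_in j.+1 (prol_last j (bc_pure j.+1 r 1)).
Proof.
elim: j => [|j IH].
  refine (etrans (@prol_sigmaE 0 (bc_pure 0 r 1)) _).
  rewrite prol_shift0E; congr (prol_in 1 (prol_last 0 _)).
  by rewrite bc_shiftE rmorph1.
rewrite iterS IH prol_sigmaE; congr (prol_in _ _).
by rewrite prol_shift_last bc_shiftE rmorph1.
Qed.

Lemma prol_emb_iterS j r c :
  iter j.+1 prol_sigma (prol_emb r) * alg_in prol_alg c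
  = prol_in j.+1 (prol_last j (bc_pure j.+1 r c)).
Proof.
by rewrite prol_emb_iter1 (bc_pureE j.+1 r c) (rmorphM (prol_last j)) prol_last_in
           (rmorphM (prol_in j.+1)) prol_in_in.
Qed.

Lemma prol_generated (s : A -> Prop) : generates s ->
  generates (fun x : prol_salg => exists j b, s b /\
    x = iter j (salg_sigma prol_salg) (prol_emb b)).
Proof.
move=> gen S [Sin SD SM] sS.
have S0 : S 0 by rewrite -(rmorph0 (alg_in prol_alg)); exact: Sin.
have Siter j r : S (iter j prol_sigma (prol_emb r)).
  move: r; apply: gen => [|b sb]; last by apply: sS; exists j, b.
  split=> [c|x y|x y].
  - have -> : iter j prol_sigma (prol_emb (alg_in A c))
        = alg_in prol_alg (iter j sigma c).
      elim: j => [|j IH]; first exact: semihom_in.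
      by rewrite !iterS IH semihom_in.
    exact: Sin.
  - have -> : iter j prol_sigma (prol_emb (x + y))
        = iter j prol_sigma (prol_emb x) + iter j prol_sigma (prol_emb y).
      by elim: j => [|j IH]; [exact: rmorphD | rewrite !iterS IH rmorphD].
    exact: SD.
  - have -> : iter j prol_sigma (prol_emb (x * y))
        = iter j prol_sigma (prol_emb x) * iter j prol_sigma (prol_emb y).
      by elim: j => [|j IH]; [exact: rmorphM | rewrite !iterS IH rmorphM].
    exact: SM.
have Sall i x : S (prol_in i x).
  elim: i x => [|i IH]; apply: tensor_ind.
  - by rewrite rmorph0.
  - by move=> x y; rewrite rmorphD; exact: SD.
  - by move=> r c; rewrite -[X in S X]prol_emb_iter0; apply: (SM); [exact: (Siter 0) | exact: Sin].
  - by rewrite rmorph0.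
  - by move=> x y; rewrite rmorphD; exact: SD.
  move=> x y; rewrite tpureE rmorphM; apply: (SM); first by rewrite prol_in_incl.
  move: y; apply: tensor_ind => [|u v Su Sv|r c].
  - by rewrite !rmorph0.
  - by rewrite !rmorphD; exact: SD.
  - by rewrite -[X in S X]prol_emb_iterS; apply: (SM); [exact: (Siter i.+1) | exact: Sin].
by move=> x; have [i [y ->]] := colim_in_surj x; exact: Sall.
Qed.

Lemma prol_emb_ext (R : salgebra sigma) (u v : shom prol_salg R) :
  khom_comp u prol_emb = khom_comp v prol_emb -> u = v.
Proof.
move=> uv; have {}uv x : u (prol_emb x) = v (prol_emb x).
  exact (congr1 (fun f : khom A R => f x) uv).
apply: shom_ext => x; move: x.
apply: (@prol_generated (fun=> True)) => [||x [j [b [_ ->]]]].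
- by move=> S _ sS x; exact: sS.
- split=> [c|x y|x y]; first by rewrite !semihom_in.
    by rewrite !rmorphD => -> ->.
  by rewrite !rmorphM => -> ->.
by elim: j => [|j IH]; rewrite ?uv // iterS !shom_sigma IH.
Qed.

Section Extend.
Variables (R : salgebra sigma) (f : khom A R).

Fixpoint sigma_iter (j : nat) : {rmorphism R -> R} :=
  if j is j'.+1 then salg_sigma R \o sigma_iter j' else idfun.

Lemma bc_ext_proof j c :
  (sigma_iter j \o f) (alg_in A c) = alg_in R (sigma_pow j c).
Proof.
elim: j => [|j IH]; first exact: semihom_in.
exact: etrans (congr1 (salg_sigma R) IH) (semihom_in (salg_sigma R) _).
Qed.

Definition bc_ext (j : nat) : khom (base_change A j) R.
Proof.
apply: (@SemiHom _ _ (base_change A j) R (tensor_lift (bc_ext_proof j))) => c.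
exact: tensor_liftr.
Defined.

Lemma bc_extl j r : bc_ext j (tinl (alg_in A) (sigma_pow j) r) = sigma_iter j (f r).
Proof. exact: tensor_liftl. Qed.

Lemma bc_ext_shift j x : bc_ext j.+1 (bc_shift A j x) = salg_sigma R (bc_ext j x).
Proof.
pose u : {rmorphism base_change A j -> R} := bc_ext j.+1 \o bc_shift A j.
pose v : {rmorphism base_change A j -> R} := salg_sigma R \o bc_ext j.
suff : u =1 v by apply.
apply: tensor_ext => [r|c].
  refine (etrans (congr1 (bc_ext j.+1) (bc_shift_l j r)) _).
  by rewrite bc_extl -[RHS]/(salg_sigma R (bc_ext j _)) bc_extl.
refine (etrans (congr1 (bc_ext j.+1) (semihom_in (bc_shift A j) c)) _).
rewrite semihom_in; symmetry.
refine (etrans (congr1 (salg_sigma R) (semihom_in (bc_ext j) c)) _).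
exact: semihom_in.
Qed.

Lemma prol_ext_proof i (c_ : khom (prol i) R) c :
  c_ (alg_in (prol i) c) = bc_ext i.+1 (alg_in (base_change A i.+1) c).
Proof. by rewrite !semihom_in. Qed.

Fixpoint prol_ext (i : nat) : khom (prol i) R.
Proof.
case: i => [|i]; first exact: bc_ext 0.
apply: (@SemiHom _ _ (prol i.+1) R
  (tensor_lift (prol_ext_proof (prol_ext i)))) => c.
by rewrite [LHS]tensor_liftl semihom_in.
Defined.

Lemma prol_ext_incl i x : prol_ext i.+1 (prol_incl i x) = prol_ext i x.
Proof. exact: tensor_liftl. Qed.

Lemma prol_ext_last i y : prol_ext i.+1 (prol_last i y) = bc_ext i.+1 y.
Proof. exact: tensor_liftr. Qed.

Lemma prol_ext_shift i x :
  prol_ext i.+1 (prol_shift i x) = salg_sigma R (prol_ext i x).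
Proof.
elim: i x => [|i IH] x.
  by rewrite prol_shift0E prol_ext_last; exact: bc_ext_shift.
pose u : {rmorphism prol i.+1 -> R} := prol_ext i.+2 \o prol_shift i.+1.
pose v : {rmorphism prol i.+1 -> R} := salg_sigma R \o prol_ext i.+1.
suff : u =1 v by apply.
apply: tensor_ext => [r|c].
  refine (etrans (congr1 (prol_ext i.+2) (prol_shift_incl r)) _).
  rewrite prol_ext_incl IH.
  exact: esym (congr1 (salg_sigma R) (prol_ext_incl r)).
refine (etrans (congr1 (prol_ext i.+2) (prol_shift_last c)) _).
rewrite prol_ext_last bc_ext_shift.
exact: esym (congr1 (salg_sigma R) (prol_ext_last c)).
Qed.

Lemma prol_extend_in c : colim_lift prol_ext_incl (alg_in prol_alg c) = alg_in R c.
Proof. exact: etrans (colim_liftE prol_ext_incl _) (semihom_in (prol_ext 0) c). Qed.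

Definition prol_extend_hom : khom prol_alg R :=
  @SemiHom _ _ prol_alg R (colim_lift prol_ext_incl) prol_extend_in.

Lemma prol_extend_homE i x : prol_extend_hom (prol_in i x) = prol_ext i x.
Proof. exact: colim_liftE. Qed.

Lemma prol_extend_sigma x :
  prol_extend_hom (salg_sigma prol_salg x) = salg_sigma R (prol_extend_hom x).
Proof.
have [i [y ->]] := colim_in_surj x.
rewrite -[colim_in _ y]/(prol_in i y) [salg_sigma _ _]prol_sigmaE.
by rewrite !prol_extend_homE prol_ext_shift.
Qed.

Definition prol_extend : shom prol_salg R :=
  @SHom _ _ prol_salg R prol_extend_hom prol_extend_sigma.

Lemma prol_extendE : khom_comp prol_extend prol_emb = f.
Proof.
apply: semihom_ext => x.
refine (etrans (@prol_extend_homE 0 (tinl (alg_in A) (sigma_pow 0) x)) _).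
exact: (bc_extl 0).
Qed.
End Extend.

(** prol_salg represents the functor R |-> Hom_k(A, R) on k-sigma-algebras. *)
Lemma prol_represents (R : salgebra sigma) :
  bijective (fun u : shom prol_salg R => khom_comp u prol_emb).
Proof.
exists (@prol_extend R) => [u|f]; last exact: prol_extendE.
by apply: prol_emb_ext; rewrite prol_extendE.
Qed.

End Coordinates.

Section SGroupOf.
Variable G : alggroup k.

Let to_points (R : salgebra sigma) (u : shom (prol_salg (coord G)) R) :
  khom (coord G) R := khom_comp u (prol_emb (coord G)).

Lemma to_points_inj R : injective (@to_points R).
Proof. exact (bij_inj (@prol_represents (coord G) R)). Qed.

Lemma to_points_onto R f : exists u, @to_points R u = f.
Proof. by exists (prol_extend f); exact: prol_extendE. Qed.

Definition sgroup_of_points (R : salgebra sigma) :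
    group_on (shom (prol_salg (coord G)) R) :=
  subgroup_on (gU := points G R) (@to_points_inj R) (to_points_onto _)
    (fun x => to_points_onto _) (fun x y => to_points_onto _).

Lemma sgroup_of_pointsM R (x y : shom (prol_salg (coord G)) R) :
  khom_comp (gmul (sgroup_of_points R) x y) (prol_emb (coord G))
  = gmul (points G R) (khom_comp x (prol_emb (coord G)))
      (khom_comp y (prol_emb (coord G))).
Proof.
exact: (subgroup_onM (gU := points G R) (@to_points_inj R) (to_points_onto _)
  (fun x => to_points_onto _) (fun x y => to_points_onto _)).
Qed.

Definition sgroup_of : sgroup sigma.
Proof.
apply: (@SGroup _ _ (prol_salg (coord G)) _ sgroup_of_points).
  have [s gs] := coord_fg G.
  exists [seq prol_emb (coord G) b | b <- s] => S subS sS.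
  apply: (prol_generated gs) => // x [j [b [bs ->]]].
  by apply: sS; exists j, (prol_emb (coord G) b); split=> //; exact: map_f.
move=> R S h x y; apply: prol_emb_ext.
have assoc (u : shom (prol_salg (coord G)) R) :
    khom_comp (shom_comp h u) (prol_emb (coord G))
    = khom_comp h (khom_comp u (prol_emb (coord G))) by exact: semihom_ext.
by rewrite assoc !sgroup_of_pointsM points_functorial !assoc.
Defined.
End SGroupOf.

End Prolongation.

Section SubSGroup.
Variables (k : fieldType) (sigma : {rmorphism k -> k}) (G : sgroup sigma).
Variable (H : sclosed_subgroup G).

Definition sub_alg : algebra k :=
  @Algebra k (ideal_quot (sideal_ideal H))
    (ideal_pi (sideal_ideal H) \o alg_in (scoord G)).

Lemma sub_sigma_proof x : H x ->
  (ideal_pi (sideal_ideal H) \o salg_sigma (scoord G)) x = 0.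
Proof. by move=> Hx; apply/ideal_pi_eq0/sideal_sigma. Qed.

Lemma sub_sigma_in c :
  ideal_lift (sideal_ideal H) sub_sigma_proof (alg_in sub_alg c) = alg_in sub_alg (sigma c).
Proof.
rewrite [LHS]ideal_liftE.
exact (congr1 (ideal_pi (sideal_ideal H)) (semihom_in (salg_sigma (scoord G)) c)).
Qed.

Definition sub_salg : salgebra sigma :=
  @SAlgebra _ _ sub_alg
    (@SemiHom _ _ sub_alg sub_alg (ideal_lift (sideal_ideal H) sub_sigma_proof) sub_sigma_in).

Definition sub_pi_hom : khom (scoord G) sub_alg :=
  @SemiHom _ _ (scoord G) sub_alg (ideal_pi (sideal_ideal H)) (fun=> erefl).

Lemma sub_pi_sigma x :
  sub_pi_hom (salg_sigma (scoord G) x) = salg_sigma sub_salg (sub_pi_hom x).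
Proof. by rewrite [RHS]ideal_liftE. Qed.

Definition sub_pi : shom (scoord G) sub_salg :=
  @SHom _ _ (scoord G) sub_salg sub_pi_hom sub_pi_sigma.

Lemma sub_pi_surj y : exists x, sub_pi x = y.
Proof. exact: ideal_pi_surj. Qed.

Lemma sub_pi_eq0 x : sub_pi x = 0 <-> H x.
Proof. exact: ideal_pi_eq0. Qed.
End SubSGroup.

Section Factor.
Variables (k : fieldType) (sigma : {rmorphism k -> k}) (A B R : salgebra sigma).
Variables (p : shom A B) (surj_p : forall y, exists x, p x = y).
Variables (u : shom A R) (pu : forall a, p a = 0 -> u a = 0).

Lemma sfactor : exists v : shom B R, shom_comp v p = u.
Proof.
pose sec y := sval (cid (surj_p y)).
have secK y : p (sec y) = y by exact: svalP (cid (surj_p y)).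
have uE x y : p x = p y -> u x = u y.
  move=> /eqP; rewrite -subr_eq0 -rmorphB => /eqP /pu /eqP.
  by rewrite rmorphB subr_eq0 => /eqP.
pose v : B -> R := u \o sec.
have vp x : v (p x) = u x by apply: uE; rewrite secK.
have vB : zmod_morphism v.
  move=> x y; rewrite -[x]secK -[y]secK -rmorphB !vp; exact: rmorphB.
have vM : monoid_morphism v.
  split; first by rewrite -(rmorph1 p) vp rmorph1.
  by move=> x y; rewrite -[x]secK -[y]secK -rmorphM !vp; exact: rmorphM.
pose z := GRing.isZmodMorphism.Build _ _ v vB.
pose m := GRing.isMonoidMorphism.Build _ _ v vM.
pose vr : {rmorphism B -> R} := HB.pack v z m.
have vin c : vr (alg_in B c) = alg_in R c.
  by rewrite -(semihom_in p) [LHS]vp semihom_in.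
have vs x : vr (salg_sigma B x) = salg_sigma R (vr x).
  by rewrite -[x]secK -shom_sigma [LHS]vp [vr _]vp shom_sigma.
exists (@SHom _ _ B R (@SemiHom _ _ B R vr vin) vs).
by apply: shom_ext => x; exact: vp.
Qed.

Lemma surj_shom_ext (v w : shom B R) : shom_comp v p = shom_comp w p -> v = w.
Proof.
move=> vw; apply: shom_ext => y; have [x <-] := surj_p y.
exact (congr1 (fun f : shom A R => f x) vw).
Qed.
End Factor.

Section SubSGroup2.
Variables (k : fieldType) (sigma : {rmorphism k -> k}) (G : sgroup sigma).
Variable (H : sclosed_subgroup G).
Let pi := sub_pi H.

Lemma sub_pi_vanishes R (x : shom (sub_salg H) R) :
  vanishes_on H (shom_comp x pi).
Proof. by move=> a /sub_pi_eq0 /= ->; rewrite rmorph0. Qed.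

Lemma sub_factor R (u : shom (scoord G) R) :
  vanishes_on H u -> exists v, shom_comp v pi = u.
Proof.
by move=> Hu; apply: sfactor => [|a /sub_pi_eq0]; [exact: sub_pi_surj | exact: Hu].
Qed.

Let to_amb (R : salgebra sigma) (x : shom (sub_salg H) R) : shom (scoord G) R :=
  shom_comp x pi.

Lemma to_amb_inj R : injective (@to_amb R).
Proof. by move=> x y; apply: surj_shom_ext; exact: sub_pi_surj. Qed.
Lemma to_amb1 R : exists t, @to_amb R t = gone (spoints G R).
Proof. by apply: sub_factor; exact: sclosed1. Qed.
Lemma to_ambV R x : exists t, @to_amb R t = ginv (spoints G R) (to_amb x).
Proof. by apply: sub_factor; apply: sclosedV; exact: sub_pi_vanishes. Qed.
Lemma to_ambM R x y :
  exists t, @to_amb R t = gmul (spoints G R) (to_amb x) (to_amb y).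
Proof. by apply: sub_factor; apply: sclosedM; exact: sub_pi_vanishes. Qed.

Definition sub_points (R : salgebra sigma) : group_on (shom (sub_salg H) R) :=
  subgroup_on (@to_amb_inj R) (to_amb1 R) (@to_ambV R) (@to_ambM R).

Lemma sub_pointsM R (x y : shom (sub_salg H) R) :
  shom_comp (gmul (sub_points R) x y) pi
  = gmul (spoints G R) (shom_comp x pi) (shom_comp y pi).
Proof.
exact: (subgroup_onM (@to_amb_inj R) (to_amb1 R) (@to_ambV R) (@to_ambM R)).
Qed.

(** H as a sigma-algebraic group, with k{H} = k{G} / I(H) *)
Definition sub_sgroup : sgroup sigma.
Proof.
apply: (@SGroup _ _ (sub_salg H) _ sub_points).
  have [s gs] := scoord_fg G; exists [seq pi b | b <- s] => S [Sin SD SM] sS y.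
  have [x <-] := sub_pi_surj y; move: x.
  apply: gs => [|x [j [b [bs ->]]]].
    split=> [c|x y'|x y']; first by rewrite semihom_in.
      by rewrite rmorphD; exact: SD.
    by rewrite rmorphM; exact: SM.
  apply: sS; exists j, (pi b); split; first exact: map_f.
  by elim: j => [|j IH] //; rewrite !iterS shom_sigma; congr (salg_sigma _ _).
move=> R S h x y; apply: (surj_shom_ext (@sub_pi_surj _ _ _ H)).
have assoc (u : shom (sub_salg H) R) :
    shom_comp (shom_comp h u) pi = shom_comp h (shom_comp u pi).
  exact: shom_ext.
by rewrite -/pi assoc !sub_pointsM spoints_functorial !assoc.
Defined.
End SubSGroup2.

Section Image.
Variables (k : fieldType) (sigma : {rmorphism k -> k}) (G G' : sgroup sigma).
Variable f : sclosed_embedding G G'.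

Lemma semb_vanishes R (x : shom (scoord G) R) :
  vanishes_on (fun a => f a = 0) (shom_comp x f).
Proof. by move=> a /= ->; rewrite rmorph0. Qed.

Lemma semb_factor R (u : shom (scoord G') R) :
  vanishes_on (fun a => f a = 0) u -> exists v, u = shom_comp v f.
Proof. by move=> /(sfactor (semb_surj f)) [v <-]; exists v. Qed.

Lemma semb1 R : shom_comp (gone (spoints G R)) f = gone (spoints G' R).
Proof. by apply: group_on_mulI; rewrite -(semb_morphism f) gmul1. Qed.

Lemma semb_mulV R (x : shom (scoord G) R) :
  shom_comp (ginv (spoints G R) x) f = ginv (spoints G' R) (shom_comp x f).
Proof. by apply: group_on_invE; rewrite -(semb_morphism f) gmulV semb1. Qed.

(** The sigma-closed subgroup of G' with which G is identified by f *)
Definition simage : sclosed_subgroup G'.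
Proof.
apply: (@SClosed _ _ G' (fun a => f a = 0)).
- split=> [|x y fx fy|a x fx]; first exact: rmorph0.
    by rewrite rmorphD fx fy addr0.
  by rewrite rmorphM fx mulr0.
- by move=> x fx; rewrite shom_sigma fx rmorph0.
- by move=> R; rewrite -semb1; exact: semb_vanishes.
- move=> R x /semb_factor [v ->]; rewrite -semb_mulV; exact: semb_vanishes.
- move=> R x y /semb_factor [v ->] /semb_factor [w ->].
  by rewrite -(semb_morphism f); exact: semb_vanishes.
Defined.
End Image.

Section Closure.
Variables (k : fieldType) (sigma : {rmorphism k -> k}) (G : alggroup k).
Variable (H : sclosed_subgroup (sgroup_of sigma G)).

(** The intersection of the ideal of H with the coordinate ring of the i-th
    prolongation of G *)
Definition closure_ideal (i : nat) (x : prol sigma (coord G) i) : Prop :=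
  H (prol_in sigma (coord G) i x).

Lemma closure_is_ideal i : is_ideal (@closure_ideal i).
Proof.
have [I0 ID IM] := sideal_ideal H; rewrite /closure_ideal.
split=> [|x y Ix Iy|a x Ix]; first by rewrite rmorph0.
  by rewrite rmorphD; exact: ID.
by rewrite rmorphM; exact: IM.
Qed.

Definition closure_coord (i : nat) : comPzRingType :=
  ideal_quot (closure_is_ideal i).

Definition dim_closure_eventually (d e : nat) : Prop :=
  exists N : nat, forall i : nat, (N <= i)%N ->
    krull_dim (closure_coord i) (d * i.+1 + e).
End Closure.

(* Main.v *)
From HB Require Import structures.
From mathcomp Require Import all_boot all_algebra ring zify.
From mathcomp Require Import boolp classical_sets.
Require Import Defs.

(** Write S for k{G} and S_i for its subalgebra generated by the functions
    sigma^j(a) with j < i and a a coordinate function on the ambient group; the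
    coordinate ring of G[i] is S_(i+1).  A point is a ring morphism x from S to
    a field L, and the transcendence degree of the values of x on generators of
    S_i is at most the dimension D_i of S_i, with equality for some x.  That the
    Krull dimension of a finitely generated algebra is such a maximum
    ([krull_dim_max_trdeg]) follows in one direction because transcendence
    degree drops strictly along a strict specialization, and in the other from
    Zariski's lemma, which yields specializations where it drops by one only.

    Morphisms of k-algebras from S to R are the same as sigma-morphisms from S
    to the ring of sequences in R, on which sigma is the shift.  So the group
    law of G on sigma-algebras induces one on the points of S in an arbitrary
    k-algebra R.  Such a point is determined by its components x_j, the points
    of the ambient group over R, viewed as a k-algebra through sigma^j, given by
    a |-> x(sigma^j(a)), and the group law is that of the ambient group in each
    component.

    Let n_i be the largest transcendence degree of the i-th component of a point
    z with z_j = 1 for all j < i (the dimension of the kernel of the projection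
    from G[i] to G[i-1]).  Then D_(i+1) = D_i + n_i.  For >=, multiply a generic
    point x on S_i by such a z that is independent of it, both placed in a free
    compositum of their fields: y = x z agrees with x on S_i, while z = x^-1 y
    shows that y is as transcendental over x as z is.  For <=, take a point x
    that is generic on S_(i+1) and a copy y of x over the field generated by the
    values on S_i, independent of x over that field: then z = x^-1 y is trivial
    below i, and y = x z shows that z is at least as transcendental as x is over
    its values on S_i.

    If z is trivial below i+1, then z o sigma is trivial below i, and its i-th
    component is the (i+1)-st one of z, over the smaller base field sigma(k).
    So n_(i+1) <= n_i, the n_i are eventually equal to some d, and
    D_i = d i + e for large i, where e >= 0 because D_i is the sum of the n_j
    with j < i.

    A second embedding of G gives another exhaustion of the same S by
    subalgebras S'_i.  As S_1 is contained in some S'_(1+c), S_i is contained in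
    S'_(i+c), and conversely; comparing the two linear functions gives d = d',
    and e = e' when d = 0. *)

Set Implicit Arguments.
Unset Strict Implicit.
Unset Printing Implicit Defensive.

Import GRing.Theory.
Local Open Scope ring_scope.

(** * Primes and residue fields *)

Section ZornAbove.
Local Open Scope classical_set_scope.

(** Zorn's lemma for predicates; only nonempty chains need an upper bound. *)
Lemma zorn_above (T : Type) (P : (T -> Prop) -> Prop) (A0 : T -> Prop) :
  P A0 ->
  (forall F : (T -> Prop) -> Prop, (exists X, F X) -> (forall X, F X -> P X) ->
     (forall X Y, F X -> F Y -> (forall x, X x -> Y x) \/ (forall x, Y x -> X x)) ->
     P (fun x => exists2 X, F X & X x)) ->
  exists A, [/\ P A, forall x, A0 x -> A x &
    forall B, P B -> (forall x, A x -> B x) -> forall x, B x -> A x].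
Proof.
move=> PA0 chainP.
pose Q (X : set T) := X = set0 \/ (P X /\ A0 `<=` X).
have [|A [QA maxA]] := @Zorn_bigcup T Q.
  move=> F FQ totF.
  pose F' (X : T -> Prop) := F X /\ P X /\ A0 `<=` X.
  have [[X0 F'X0]|noX] := pselect (exists X, F' X); last first.
    left; rewrite -subset0 => x [X FX Xx].
    by case: (FQ _ FX) => [X0|QX]; [rewrite X0 in Xx | case: noX; exists X].
  right; have -> : \bigcup_(X in F) X = (fun x => exists2 X, F' X & X x).
    apply/seteqP; split=> x [X FX Xx]; last by exists X => //; case: FX.
    by case: (FQ _ FX) => [X00|QX]; [rewrite X00 in Xx | exists X].
  split; last by move=> x A0x; exists X0 => //; case: F'X0 => _ [_]; apply.
  apply: chainP; first by exists X0.
    by move=> X [_ []].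
  by move=> X Y [FX _] [FY _]; exact: totF.
have [PA A0A] : P A /\ A0 `<=` A.
  case: QA => [A00|//]; have [[x A0x]|no] := pselect (exists x, A0 x).
    case: (maxA A0); last by right; split.
    by rewrite A00; split=> // /(_ x A0x).
  have -> : A = A0 by rewrite A00; apply/seteqP; split=> // x A0x; case: no; exists x.
  by split.
exists A; split=> // B PB AB; apply: contrapT => nBA.
by apply: (maxA B); [split | right; split=> // x /A0A /AB].
Qed.

End ZornAbove.

(** An ideal maximal among those containing I and disjoint from the
    multiplicative set T is prime. *)
Lemma exists_prime_avoiding (A : comPzRingType) (I T : A -> Prop) :
  is_ideal I -> T 1 -> (forall x y, T x -> T y -> T (x * y)) ->
  (forall x, I x -> ~ T x) ->
  exists P, [/\ is_prime_ideal P, forall x, I x -> P x & forall x, P x -> ~ T x].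
Proof.
move=> idI T1 TM IT.
pose Q (J : A -> Prop) := is_ideal J /\ forall x, J x -> ~ T x.
have [||P [[idP PT] IP maxP]] := @zorn_above A Q I.
- by split.
- move=> F [X0 FX0] FQ totF; split=> [|x [X FX Xx]]; last by case: (FQ _ FX) => _; apply.
  split=> [|x y [X FX Xx] [Y FY Yy]|a x [X FX Xx]].
  + by exists X0 => //; case: (FQ _ FX0) => /ideal0.
  + have [idX _] := FQ _ FX; have [idY _] := FQ _ FY.
    case: (totF _ _ FX FY) => [/(_ _ Xx) Yx|/(_ _ Yy) Xy].
      by exists Y => //; exact: idealD.
    by exists X => //; exact: idealD.
  + by exists X => //; case: (FQ _ FX) => idX _; exact: idealM.
exists P; split=> //; split=> // [P1|x y Pxy]; first exact: PT P1 T1.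
have add z : ~ P z -> exists p a, P p /\ T (p + a * z).
  move=> nPz; apply: contrapT => no.
  pose J w := exists p a, P p /\ w = p + a * z.
  have : Q J.
    split=> [|w [p [a [Pp ->]]] Tw]; last by case: no; exists p, a.
    split=> [|u v [p [a [Pp ->]]] [q [b [Pq ->]]]|c u [p [a [Pp ->]]]].
    - by exists 0, 0; rewrite mul0r addr0; split=> //; exact: ideal0.
    - exists (p + q), (a + b); split; first exact: idealD.
      by rewrite mulrDl addrACA.
    - exists (c * p), (c * a); split; first exact: idealM.
      by rewrite mulrDr mulrA.
  move=> /maxP JP; apply: nPz; apply: JP => [w Pw|].
    by exists w, 0; rewrite mul0r addr0.
  by exists 0, 1; rewrite mul1r add0r; split=> //; exact: ideal0.
have [Px|/add [p [a [Pp Tx]]]] := pselect (P x); first by left.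
have [Py|/add [q [b [Pq Ty]]]] := pselect (P y); first by right.
case: (PT ((p + a * x) * (q + b * y))); last exact: TM.
rewrite mulrDl; apply: idealD => //; first by rewrite mulrC; exact: idealM.
rewrite mulrDr; apply: idealD => //; first exact: idealM.
by rewrite mulrACA; apply: idealM.
Qed.

Lemma comPzRing_field (R : comPzRingType) :
  (1 : R) <> 0 -> (forall x : R, x <> 0 -> exists y, y * x = 1) ->
  exists (F : fieldType) (u : {rmorphism R -> F}),
    injective u /\ forall y, exists x, u x = y.
Proof.
move=> n10 hinv.
have nz : (1 : R) != 0 by apply/eqP.
pose m := GRing.PzSemiRing_isNonZero.Build R nz.
pose R' : comNzRingType := HB.pack (R : Type) R m.
pose inv (x : R') := if pselect (exists y : R', y * x = 1) is left h
  then sval (cid h) else 0.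
have invP (x : R') : x != 0 -> inv x * x = 1.
  move=> /eqP /hinv hx; rewrite /inv; case: pselect => [h|/(_ hx)//].
  exact: svalP (cid h).
have inv0 : inv 0 = 0.
  rewrite /inv; case: pselect => // h; exfalso; apply: n10.
  by case: h => y; rewrite mulr0 => /esym.
pose F : fieldType := HB.pack (R' : Type) R' (GRing.ComNzRing_isField.Build R' invP inv0).
exists F, (idfun : {rmorphism R -> F}); split=> [x y //|y]; by exists y.
Qed.

Section ResidueField.
Variables (A : comPzRingType) (P : A -> Prop) (primeP : is_prime_ideal P).

Definition frac_pair : Type := {p : A * A | ~ P p.2}.
HB.instance Definition _ := gen_eqMixin frac_pair.
HB.instance Definition _ := gen_choiceMixin frac_pair.

Let num (p : frac_pair) := (sval p).1.
Let den (p : frac_pair) := (sval p).2.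
Let den_nP p : ~ P (den p). Proof. exact: (svalP p). Qed.
Let nPM x y : ~ P x -> ~ P y -> ~ P (x * y).
Proof. by move=> nx ny /(prime_mul primeP) []. Qed.
Let mkfrac (a s : A) (h : ~ P s) : frac_pair := exist _ (a, s) h.
Let idP := prime_ideal primeP.

Let feq (p q : frac_pair) := P (num p * den q - num q * den p).

Let feq_eq p q : num p * den q = num q * den p -> feq p q.
Proof. by rewrite /feq => ->; rewrite subrr; exact: ideal0. Qed.

Definition residue_congr : ring_congr frac_pair.
Proof.
apply: (@RingCongr frac_pair feq (mkfrac 0 (prime_proper primeP))
  (fun p => mkfrac (- num p) (@den_nP p))
  (fun p q => mkfrac (num p * den q + num q * den p) (nPM (den_nP (p:=p)) (den_nP (p:=q))))
  (mkfrac 1 (prime_proper primeP))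
  (fun p q => mkfrac (num p * num q) (nPM (den_nP (p:=p)) (den_nP (p:=q))))).

- by move=> p; exact: feq_eq.
- by move=> p q /(idealN idP); rewrite opprB.
- move=> p q r pq qr.
  have : P (den q * (num p * den r - num r * den p)).
    have -> : den q * (num p * den r - num r * den p)
       = den r * (num p * den q - num q * den p)
         + den p * (num q * den r - num r * den q) by ring.
    by apply: idealD => //; exact: idealM.
  by case/(prime_mul primeP) => // /(@den_nP q).
- move=> [[a s] /= hs] [[b t] /= ht] /(idealN idP); rewrite /feq /num /den /=.
  by congr P; ring.
- move=> [[a s] /= hs] [[a' s'] /= hs'] [[b t] /= ht] [[b' t'] /= ht'].
  rewrite /feq /num /den /= => hp hq.
  have := idealD idP (idealM idP (t * t') hp) (idealM idP (s * s') hq).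
  by congr P; ring.
- move=> [[a s] /= hs] [[a' s'] /= hs'] [[b t] /= ht] [[b' t'] /= ht'].
  rewrite /feq /num /den /= => hp hq.
  have := idealD idP (idealM idP (b * t') hp) (idealM idP (a' * s) hq).
  by congr P; ring.
- by move=> p q r; apply: feq_eq; rewrite /= /num /den /=; ring.
- by move=> p q; apply: feq_eq; rewrite /= /num /den /=; ring.
- by move=> p; apply: feq_eq; rewrite /= /num /den /=; ring.
- by move=> p; apply: feq_eq; rewrite /= /num /den /=; ring.
- by move=> p q r; apply: feq_eq; rewrite /= /num /den /=; ring.
- by move=> p q; apply: feq_eq; rewrite /= /num /den /=; ring.
- by move=> p; apply: feq_eq; rewrite /= /num /den /=; ring.
- by move=> p q r; apply: feq_eq; rewrite /= /num /den /=; ring.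
Defined.

Let Rfrac : comPzRingType := ring_quot residue_congr.
Let pf (p : frac_pair) : Rfrac := @rq_pi _ residue_congr p.
Let emb (a : A) : Rfrac := pf (mkfrac a (prime_proper primeP)).

Let embB : zmod_morphism emb.
Proof.
have hD : {morph emb : x y / x + y}.
  move=> x y; rewrite -[RHS](@rq_piDE _ residue_congr); apply/rq_piP.
  by apply: feq_eq; rewrite /= /num /den /=; ring.
by move=> x y; have := hD (x - y) y; rewrite subrK => ->; rewrite addrK.
Qed.
Let embM : monoid_morphism emb.
Proof.
split=> // x y; rewrite -[RHS](@rq_piME _ residue_congr); apply/rq_piP.
by apply: feq_eq; rewrite /= /num /den /=; ring.
Qed.

(** The field is built in one step as the ring of fractions a/s with s outside
    P, where a/s = b/t when a t - b s lies in P; this is the fraction field of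
    A/P. *)
Lemma exists_residue_field : exists (L : fieldType) (h : {rmorphism A -> L}),
  (forall a, h a = 0 <-> P a) /\ (forall y, exists a s, ~ P s /\ y = h a / h s).
Proof.
pose z := GRing.isZmodMorphism.Build _ _ emb embB.
pose m := GRing.isMonoidMorphism.Build _ _ emb embM.
pose e : {rmorphism A -> Rfrac} := HB.pack emb z m.
have e0 a : e a = 0 <-> P a.
  rewrite -(rmorph0 e); split=> [/rq_piP|Pa].
    by rewrite /= /feq /num /den /= mul0r subr0 mulr1.
  by apply/rq_piP; rewrite /= /feq /num /den /= mul0r subr0 mulr1.
have pfE p : pf p * e (den p) = e (num p).
  rewrite -[LHS](@rq_piME _ residue_congr); apply/rq_piP.
  by apply: feq_eq; rewrite /= /num /den /=; ring.
have [||L [u [uI uS]]] := @comPzRing_field Rfrac.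
- by rewrite -(rmorph1 e) => /e0; exact: prime_proper.
- elim/rq_ind => p p0.
  have nPp : ~ P (num p).
    move=> Pp; apply: p0; rewrite -/(pf p) -[RHS](rmorph0 e); apply/rq_piP.
    by rewrite /= /feq /num /den /= mulr1 mul0r subr0.
  exists (pf (mkfrac (den p) nPp)).
  rewrite -[LHS](@rq_piME _ residue_congr); apply/rq_piP.
  by apply: feq_eq; rewrite /= /num /den /=; ring.
pose h : {rmorphism A -> L} := u \o e.
have h0 a : h a = 0 <-> P a.
  split=> [|/e0 ea0]; last by rewrite -(rmorph0 u) -ea0.
  by rewrite -[0](rmorph0 u) => /uI /e0.
exists L, h; split=> // y; have [x <-] := uS y; elim/rq_ind: x => p.
exists (num p), (den p); split; first exact: den_nP.
have hd : h (den p) != 0 by apply/eqP => /h0; exact: den_nP.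
apply: (mulIf hd); rewrite divfK //.
by rewrite [h (den p)]/(u (e _)) -rmorphM pfE.
Qed.
End ResidueField.

(** * Algebraic dependence and transcendence degree *)

(** Coefficients that are fractions of values ev a with a in a multiplicative
    set U can be cleared simultaneously.  This applies to values of polynomials
    at an element ([algebraic_exchange]) and to values of functions at a point
    ([point_algebraicP]). *)
Lemma common_denominator (R : comPzRingType) (L : fieldType) (ev : {rmorphism R -> L})
    (U : R -> Prop) (p : {poly L}) :
  U 0 -> U 1 -> (forall a b, U a -> U b -> U (a * b)) ->
  (forall i, exists a b, [/\ U a, U b, ev b != 0 & p`_i = ev a / ev b]) ->
  exists d (g : nat -> R), [/\ U d, ev d != 0, forall i, U (g i) &
    forall i, ev d * p`_i = ev (g i)].
Proof.
move=> U0 U1 UM pU.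
have [d [Ud d0 dp]] : exists d, [/\ U d, ev d != 0 &
    forall i, (i < size p)%N -> exists2 a, U a & ev d * p`_i = ev a].
  elim: (size p) => [|n [d [Ud d0 dp]]]; first by exists 1; rewrite rmorph1 oner_eq0.
  have [a [b [Ua Ub b0 pn]]] := pU n.
  exists (d * b); split; [exact: UM|by rewrite rmorphM mulf_neq0|] => i.
  rewrite ltnS leq_eqVlt => /orP[/eqP->|/dp [c Uc dc]].
    by exists (d * a); [exact: UM|rewrite pn !rmorphM; field].
  by exists (c * b); [exact: UM|rewrite !rmorphM -dc; ring].
have gP i : exists a, U a /\ ev d * p`_i = ev a.
  have [/dp [a]|ip] := ltnP i (size p); first by exists a.
  by exists 0; rewrite nth_default // mulr0 rmorph0.
have [g gE] := choice gP.
by exists d, g; split=> // i; case: (gE i).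
Qed.

Section Generated.
Variables (k : fieldType) (S : comPzRingType) (f : {rmorphism k -> S}) (X : seq S).

Inductive subalg : S -> Prop :=
| subalg_const c : subalg (f c)
| subalg_gen x : x \in X -> subalg x
| subalg_add x y : subalg x -> subalg y -> subalg (x + y)
| subalg_mul x y : subalg x -> subalg y -> subalg (x * y).

Lemma subalg0 : subalg 0.
Proof. by rewrite -(rmorph0 f); exact: subalg_const. Qed.
Lemma subalg1 : subalg 1.
Proof. by rewrite -(rmorph1 f); exact: subalg_const. Qed.
End Generated.

Lemma subalg_trans (k : fieldType) (S : comPzRingType) (f : {rmorphism k -> S})
    (X Y : seq S) u :
  (forall x, x \in X -> subalg f Y x) -> subalg f X u -> subalg f Y u.
Proof.
by move=> XY; elim=> [c|//|x y _ + _|x y _ + _];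
  [exact: subalg_const|exact: subalg_add|exact: subalg_mul].
Qed.

Lemma subalg_mono (k : fieldType) (S : comPzRingType) (f : {rmorphism k -> S})
    (X Y : seq S) u : {subset X <= Y} -> subalg f X u -> subalg f Y u.
Proof. by move=> XY; apply: subalg_trans => x /XY; exact: subalg_gen. Qed.

Section Subfield.
Variables (k L : fieldType) (f : {rmorphism k -> L}) (X : seq L).

Inductive subfield : L -> Prop :=
| subfield_const c : subfield (f c)
| subfield_gen x : x \in X -> subfield x
| subfield_add x y : subfield x -> subfield y -> subfield (x + y)
| subfield_mul x y : subfield x -> subfield y -> subfield (x * y)
| subfield_inv x : subfield x -> subfield x^-1.

Definition subfield_pred : {pred L} := fun u => `[< subfield u >].

Fact subfield_divring_closed : divring_closed subfield_pred.
Proof.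
split; first by apply/asboolP; rewrite -(rmorph1 f); exact: subfield_const.
- move=> x y /asboolP sx /asboolP sy; apply/asboolP; apply: subfield_add => //.
  rewrite -mulN1r -(rmorph1 f) -rmorphN.
  by apply: subfield_mul => //; exact: subfield_const.
- move=> x y /asboolP sx /asboolP sy; apply/asboolP; apply: subfield_mul => //.
  exact: subfield_inv.
Qed.
HB.instance Definition _ :=
  GRing.isDivringClosed.Build L subfield_pred subfield_divring_closed.

Record subfield_type := SubfieldElt
  { subfield_val :> L; subfield_valP : subfield_val \in subfield_pred }.
HB.instance Definition _ := [isSub for subfield_val].
HB.instance Definition _ := [Choice of subfield_type by <:].
HB.instance Definition _ := [SubChoice_isSubIntegralDomain of subfield_type by <:].
HB.instance Definition _ := [SubIntegralDomain_isSubField of subfield_type by <:].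

Definition algebraic (y : L) : Prop :=
  exists p : {poly L}, [/\ p != 0, forall i, subfield p`_i & root p y].

Lemma algebraicP y : algebraic y <-> algebraicOver (\val : subfield_type -> L) y.
Proof.
split=> [[p [p0 sp py]]|[p p0 py]].
  have sE i : exists u : subfield_type, val u = p`_i.
    by have /asboolP pi := sp i; exists (SubfieldElt pi).
  have [g gE] := choice sE.
  pose q := \poly_(i < size p) g i.
  have qp : map_poly \val q = p.
    apply/polyP => i; rewrite coef_map coef_poly.
    by case: ltnP => ip; [exact: gE | rewrite raddf0 nth_default].
  exists q; last by rewrite qp.
  by apply: contraNneq p0 => q0; rewrite -qp q0 rmorph0.
exists (map_poly \val p); split=> //; first by rewrite map_poly_eq0.
by move=> i; rewrite coef_map; exact/asboolP/subfield_valP.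
Qed.

Lemma algebraic_subfield y : subfield y -> algebraic y.
Proof.
move=> /asboolP sy; apply/algebraicP.
exact: (@algebraic_id _ _ _ (SubfieldElt sy)).
Qed.
Lemma algebraicD x y : algebraic x -> algebraic y -> algebraic (x + y).
Proof. by move=> /algebraicP ax /algebraicP ay; apply/algebraicP/algebraic_add. Qed.
Lemma algebraicM x y : algebraic x -> algebraic y -> algebraic (x * y).
Proof. by move=> /algebraicP ax /algebraicP ay; apply/algebraicP/algebraic_mul. Qed.
Lemma algebraicV x : algebraic x -> algebraic x^-1.
Proof. by move=> /algebraicP ax; apply/algebraicP/algebraic_inv. Qed.

(** Transitivity of algebraic dependence. *)
Lemma algebraic_root (p : {poly L}) y :
  p != 0 -> (forall i, algebraic p`_i) -> root p y -> algebraic y.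
Proof.
move=> p0 ap py; apply/algebraicP/integral_algebraic.
apply: (integral_root p0 py) => _ /(nthP 0)[i _ <-].
by apply/integral_algebraic/algebraicP.
Qed.

Lemma subfieldX x n : subfield x -> subfield (x ^+ n).
Proof.
move=> sx; elim: n => [|n IH]; last by rewrite exprS; exact: subfield_mul.
by rewrite expr0 -(rmorph1 f); exact: subfield_const.
Qed.
Lemma subfield0 : subfield 0.
Proof. by rewrite -(rmorph0 f); exact: subfield_const. Qed.
Lemma subfield_sum (I : Type) (r : seq I) (P : pred I) (g : I -> L) :
  (forall i, P i -> subfield (g i)) -> subfield (\sum_(i <- r | P i) g i).
Proof. by move=> sg; elim/big_ind: _ => //; [exact: subfield0|exact: subfield_add]. Qed.

Lemma subfield_frac u : subfield u ->
  exists a b, [/\ subalg f X a, subalg f X b, b != 0 & u = a / b].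
Proof.
elim=> [c|x Xx|x y _ [a [b [sa sb b0 ->]]] _ [c [d [sc sd d0 ->]]]
  |x y _ [a [b [sa sb b0 ->]]] _ [c [d [sc sd d0 ->]]]|x _ [a [b [sa sb b0 ->]]]].
- by exists (f c), 1; rewrite divr1 oner_neq0; split=> //; [exact: subalg_const|exact: subalg1].
- by exists x, 1; rewrite divr1 oner_neq0; split=> //; [exact: subalg_gen|exact: subalg1].
- exists (a * d + c * b), (b * d); rewrite mulf_neq0 //; split=> //; last by field; rewrite d0.
    by apply: subalg_add; exact: subalg_mul.
  exact: subalg_mul.
- exists (a * c), (b * d); rewrite mulf_neq0 //; split=> //; last by field; rewrite d0.
    exact: subalg_mul.
  exact: subalg_mul.
have [->|a0] := eqVneq a 0; last by exists b, a; rewrite invf_div.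
by exists 0, 1; rewrite mul0r invr0 mul0r oner_neq0; split=> //; [exact: subalg0|exact: subalg1].
Qed.
End Subfield.

(** The base fields may differ, which later compares transcendence degrees over
    k, over an extension of k and over sigma(k). *)
Lemma algebraic_trans (k k' L : fieldType) (f : {rmorphism k -> L})
    (g : {rmorphism k' -> L}) (X Y : seq L) (z : L) :
  (forall c, algebraic g Y (f c)) -> (forall x, x \in X -> algebraic g Y x) ->
  algebraic f X z -> algebraic g Y z.
Proof.
move=> fY XY [p [p0 sp pz]]; apply: algebraic_root p0 _ pz => i.
elim: (sp i) => [//|//|||] *; [exact: algebraicD|exact: algebraicM|exact: algebraicV].
Qed.

Section AlgebraicClosure.
Variables (k L : fieldType) (f : {rmorphism k -> L}).
Implicit Types (X Y : seq L).

Lemma algebraic_const X c : algebraic f X (f c).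
Proof. exact/algebraic_subfield/subfield_const. Qed.
Lemma algebraic_gen X x : x \in X -> algebraic f X x.
Proof. by move=> Xx; exact/algebraic_subfield/subfield_gen. Qed.
Lemma algebraic_sub X Y z : (forall x, x \in X -> algebraic f Y x) ->
  algebraic f X z -> algebraic f Y z.
Proof. by apply: algebraic_trans => c; exact: algebraic_const. Qed.
Lemma algebraic_mono X Y z : {subset X <= Y} -> algebraic f X z -> algebraic f Y z.
Proof. by move=> XY; apply: algebraic_sub => x /XY; exact: algebraic_gen. Qed.
Lemma algebraic_subalg X z : subalg f X z -> algebraic f X z.
Proof.
elim=> [c|x|x y _ ax _ ay|x y _ ax _ ay].
- exact: algebraic_const.
- exact: algebraic_gen.
- exact: algebraicD.
- exact: algebraicM.
Qed.

Lemma subfield_mono X Y u : {subset X <= Y} -> subfield f X u -> subfield f Y u.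
Proof.
move=> XY; elim=> [c|x /XY|x y _ sx _ sy|x y _ sx _ sy|x _ sx].
- exact: subfield_const.
- exact: subfield_gen.
- exact: subfield_add.
- exact: subfield_mul.
- exact: subfield_inv.
Qed.

Lemma subfield_cons_frac X z u : subfield f (z :: X) u ->
  exists a b : {poly L}, [/\ forall i, subfield f X a`_i, forall i, subfield f X b`_i,
    b.[z] != 0 & u = a.[z] / b.[z]].
Proof.
pose U (a : {poly L}) := forall i, subfield f X a`_i.
have UC c : subfield f X c -> U c%:P.
  by move=> sc i; rewrite coefC; case: eqP => // _; exact: subfield0.
have UD a b : U a -> U b -> U (a + b).
  by move=> Ua Ub i; rewrite coefD; exact: subfield_add.
have UM a b : U a -> U b -> U (a * b).
  move=> Ua Ub i; rewrite coefM; apply: subfield_sum => j _; exact: subfield_mul.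
have s1 : subfield f X 1 by rewrite -(rmorph1 f); exact: subfield_const.
elim=> [c|x|x y _ [a [b [sa sb b0 ->]]] _ [c [d [sc sd d0 ->]]]
  |x y _ [a [b [sa sb b0 ->]]] _ [c [d [sc sd d0 ->]]]|x _ [a [b [sa sb b0 ->]]]].
- exists (f c)%:P, 1%:P; rewrite !hornerC divr1 oner_neq0; split=> //; last exact: UC.
  by apply: UC; exact: subfield_const.
- rewrite inE => /orP[/eqP->|Xx].
    exists 'X, 1%:P; rewrite hornerC hornerX divr1 oner_neq0; split=> //; last exact: UC.
    by move=> i; rewrite coefX; case: eqP => // _; exact: subfield0.
  exists x%:P, 1%:P; rewrite !hornerC divr1 oner_neq0; split=> //; last exact: UC.
  by apply: UC; exact: subfield_gen.
- exists (a * d + c * b), (b * d); rewrite hornerD !hornerM mulf_neq0 //.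
  split=> //; last by field; rewrite d0.
    by apply: UD; exact: UM.
  exact: UM.
- exists (a * c), (b * d); rewrite !hornerM mulf_neq0 //; split=> //; last by field; rewrite d0.
    exact: UM.
  exact: UM.
have [->|a0] := eqVneq a.[z] 0; last by exists b, a; rewrite invf_div.
exists 0, 1%:P; rewrite mul0r invr0 horner0 mul0r hornerC oner_neq0; split=> //; last exact: UC.
by apply: UC; exact: subfield0.
Qed.

(** A relation of y over k(X)(z) is, after clearing denominators, a relation in
    y and z over k(X); read as a polynomial in z, it is not zero, since its
    coefficients are polynomials in y over k(X) and y is transcendental. *)
Lemma algebraic_exchange X y z :
  algebraic f (z :: X) y -> ~ algebraic f X y -> algebraic f (y :: X) z.
Proof.
move=> [p [p0 sp py]] nXy.
pose U (a : {poly L}) := forall i, subfield f X a`_i.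
have UM a b : U a -> U b -> U (a * b).
  move=> Ua Ub i; rewrite coefM; apply: subfield_sum => j _; exact: subfield_mul.
have s1 : subfield f X 1 by rewrite -(rmorph1 f); exact: subfield_const.
have U1 : U 1 by move=> i; rewrite coef1; case: eqP => // _; exact: subfield0.
have U0 : U 0 by move=> i; rewrite coef0; exact: subfield0.
have [|d [g [Ud d0 Ug gE]]] := @common_denominator _ _ (horner_eval z) U p U0 U1 UM.
  by move=> i; have [a [b [sa sb b0 ->]]] := subfield_cons_frac (sp i); exists a, b.
rewrite /= /horner_eval in d0 gE.
pose r : {poly L} := \sum_(i < size p) y ^+ i *: g i.
have rE j : r`_j = \sum_(i < size p) (g i)`_j * y ^+ i.
  by rewrite coef_sum; apply: eq_bigr => i _; rewrite coefZ mulrC.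
exists r; split.
- pose i := (size p).-1.
  have ip : (i < size p)%N by rewrite prednK // size_poly_gt0.
  have [j gij] : exists j, (g i)`_j != 0.
    apply: contrapT => no.
    have gi0 : g i = 0.
      by apply/polyP => j; rewrite coef0; apply/eqP/contraT => gij; case: no; exists j.
    have := gE i; rewrite gi0 horner0 => /eqP.
    by rewrite mulf_eq0 (negbTE d0) -/(lead_coef p) lead_coef_eq0 (negbTE p0).
  apply/eqP => r0; apply: nXy; exists (\poly_(l < size p) (g l)`_j); split.
  + by apply/eqP => /polyP /(_ i); rewrite coef_poly coef0 ip; apply/eqP.
  + by move=> l; rewrite coef_poly; case: ifP => // _; [exact: Ug|exact: subfield0].
  + by rewrite /root horner_poly -rE r0 coef0.
- move=> j; rewrite rE; apply: subfield_sum => i _; apply: subfield_mul.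
    by apply: subfield_mono (Ug i j) => x Xx; rewrite inE Xx orbT.
  by apply/subfieldX/subfield_gen/mem_head.
rewrite /root horner_sum.
under eq_bigr do rewrite hornerZ -gE mulrCA [_ * p`__]mulrC.
by rewrite -mulr_sumr -horner_coef (eqP py) mulr0.
Qed.

(** The transcendence degree over k of the subfield generated by a list: the
    number of entries that are transcendental over the entries after them. *)
Fixpoint trdeg (w : seq L) : nat :=
  if w is y :: w' then ~~ `[< algebraic f w' y >] + trdeg w' else 0.

Lemma trdeg_size w : (trdeg w <= size w)%N.
Proof. by elim: w => //= y w IH; rewrite -add1n leq_add // leq_b1. Qed.

Lemma trdeg_catr X Y : (trdeg Y <= trdeg (X ++ Y))%N.
Proof. by elim: X => //= x X IH; rewrite (leq_trans IH) // leq_addl. Qed.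

Lemma trdeg_cat_algebraic X Y :
  (forall x, x \in X -> algebraic f Y x) -> trdeg (X ++ Y) = trdeg Y.
Proof.
elim: X => //= x X IH XY; rewrite IH => [|y Xy]; last by apply: XY; rewrite inE Xy orbT.
rewrite asboolT //; apply: algebraic_mono (XY x (mem_head _ _)) => y Yy.
by rewrite mem_cat Yy orbT.
Qed.

Lemma trdeg_swap x y X : trdeg (x :: y :: X) = trdeg (y :: x :: X).
Proof.
rewrite /= !addnA; congr (_ + _)%N.
have up u v : algebraic f X u -> algebraic f (v :: X) u.
  by apply: algebraic_mono => t Xt; rewrite inE Xt orbT.
have [Xx|nXx] := pselect (algebraic f X x); have [Xy|nXy] := pselect (algebraic f X y).
- by rewrite !asboolT //; exact: up.
- rewrite (asboolT (up _ y Xx)) (asboolF nXy) (asboolT Xx) asboolF //.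
  apply: contra_not nXy; apply: algebraic_sub => t; rewrite inE => /orP[/eqP->//|].
  exact: algebraic_gen.
- rewrite (asboolT (up _ x Xy)) (asboolF nXx) (asboolT Xy) asboolF //.
  apply: contra_not nXx; apply: algebraic_sub => t; rewrite inE => /orP[/eqP->//|].
  exact: algebraic_gen.
rewrite (asboolF nXx) (asboolF nXy); congr (nat_of_bool (~~ _) + _)%N.
by apply/asboolP/asboolP => h; exact: algebraic_exchange.
Qed.

(** With [trdeg_swap], the reason why the order of the entries is
    irrelevant. *)
Lemma trdeg_middle y X Y : trdeg (X ++ y :: Y) = trdeg (y :: X ++ Y).
Proof.
elim: X => // x X IH; rewrite !cat_cons trdeg_swap.
rewrite -[RHS]/(~~ `[< algebraic f (y :: X ++ Y) x >] + trdeg (y :: X ++ Y))%N -IH /=.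
congr (nat_of_bool (~~ _) + _)%N.
by apply/asboolP/asboolP; apply: algebraic_mono => t;
  rewrite !(mem_cat, inE) orbCA.
Qed.

Lemma trdeg_catC X Y : trdeg (X ++ Y) = trdeg (Y ++ X).
Proof.
elim: Y => [|y Y IH]; first by rewrite cats0.
rewrite trdeg_middle /= IH; congr (nat_of_bool (~~ _) + _)%N.
by apply/asboolP/asboolP; apply: algebraic_mono => t; rewrite !mem_cat orbC.
Qed.

Lemma trdeg_le X Y : (forall x, x \in X -> algebraic f Y x) -> (trdeg X <= trdeg Y)%N.
Proof. by move=> XY; rewrite -(trdeg_cat_algebraic XY) trdeg_catC trdeg_catr. Qed.

(** The list w takes its values in L through x, so that the basis consists of
    functions and can be evaluated at other points. *)
Lemma exists_basis (T : eqType) (x : T -> L) (w : seq T) :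
  exists b : seq T, [/\ {subset b <= w}, trdeg (map x b) = size b,
    size b = trdeg (map x w) & forall a, a \in w -> algebraic f (map x b) (x a)].
Proof.
elim: w => [|a w [b [bw ib sb wb]]]; first by exists [::].
have aE : algebraic f (map x w) (x a) <-> algebraic f (map x b) (x a).
  split; first by apply: algebraic_sub => _ /mapP[c /wb bc ->].
  by apply: algebraic_mono => _ /mapP[c bc ->]; apply/map_f/bw.
have [ba|nba] := pselect (algebraic f (map x b) (x a)).
  exists b; split=> //.
  - by move=> c /bw wc; rewrite inE wc orbT.
  - by rewrite /= asboolT //; exact/aE.
  - by move=> c; rewrite inE => /orP[/eqP->//|/wb].
exists (a :: b); split.
- by move=> c; rewrite !inE => /orP[->//|/bw ->]; rewrite orbT.
- by rewrite /= asboolF // ib.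
- by rewrite /= sb asboolF // => /aE.
- move=> c; rewrite inE => /orP[/eqP->|/wb]; first exact/algebraic_gen/mem_head.
  by apply: algebraic_mono => t bt; rewrite inE bt orbT.
Qed.

Lemma trdeg_sublist (T : eqType) (x : T -> L) (w : seq T) n :
  (n <= trdeg (map x w))%N ->
  exists b : seq T, [/\ {subset b <= w}, trdeg (map x b) = size b & size b = n].
Proof.
have [b [bw ib <- _]] := exists_basis x w.
elim: b bw ib => [|a b IH] bw ib nb.
  by exists [::]; split=> //; move: nb; rewrite leqn0 => /eqP.
have [->|] := eqVneq n (size b).+1; first by exists (a :: b).
move=> nn; apply: IH; last by rewrite -ltnS ltn_neqAle nn.
  by move=> c bc; apply: bw; rewrite inE bc orbT.
apply/eqP; rewrite -(size_map x) eqn_leq trdeg_size /= -(leq_add2l 1) add1n.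
by rewrite size_map -[(size b).+1]ib /= leq_add2r leq_b1.
Qed.
End AlgebraicClosure.

(** Relative transcendence degrees can only drop when the base grows. *)
Lemma trdeg_relative (k k' L : fieldType) (f : {rmorphism k -> L})
    (g : {rmorphism k' -> L}) (q q' w : seq L) :
  (forall Y z, algebraic f (Y ++ q) z -> algebraic g (Y ++ q') z) ->
  (trdeg g (w ++ q') + trdeg f q <= trdeg f (w ++ q) + trdeg g q')%N.
Proof.
move=> fg; elim: w => [|y w IH]; first by rewrite addnC.
rewrite /= -!addnA leq_add //; have [fy|nfy] := pselect (algebraic f (w ++ q) y).
  by rewrite !asboolT //; exact: fg.
by rewrite (asboolF nfy) leq_b1.
Qed.

(** * Points in fields and their specializations *)

(** Evaluation of a list of coefficients, the constant one first; this makes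
    sense over the zero ring, too. *)
Section HornerList.
Variables (R : comPzRingType) (y : R).
Fixpoint horner_list (s : seq R) : R :=
  if s is c :: s' then horner_list s' * y + c else 0.
End HornerList.

Lemma horner_list_rmorph (R S : comPzRingType) (h : {rmorphism R -> S}) y s :
  h (horner_list y s) = horner_list (h y) (map h s).
Proof.
by elim: s => [|c s IH] /=; rewrite ?rmorph0 // rmorphD rmorphM IH.
Qed.

Lemma horner_listE (L : fieldType) (y : L) s : horner_list y s = (Poly s).[y].
Proof. by elim: s => [|c s /= ->]; rewrite ?horner0 // horner_cons. Qed.

Lemma subalg_cons_horner (k : fieldType) (R : comPzRingType) (f : {rmorphism k -> R})
    (b : seq R) y a :
  subalg f (y :: b) a ->
  exists2 s, (forall c, c \in s -> subalg f b c) & a = horner_list y s.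
Proof.
pose H a := exists2 s, (forall c, c \in s -> subalg f b c) & a = horner_list y s.
have H1 c : subalg f b c -> H c.
  move=> sc; exists [:: c]; last by rewrite /= mul0r add0r.
  by move=> c'; rewrite inE => /eqP->.
have HS c v : subalg f b c -> H v -> H (v * y + c).
  move=> sc [s sb ->]; exists (c :: s) => // c'; rewrite inE => /orP[/eqP->//|]; exact: sb.
have HD u v : H u -> H v -> H (u + v).
  move=> [s sb ->]; elim: s sb v => [|c s IH] sb v; first by rewrite add0r.
  case=> [[|d r]] rb -> /=.
    by rewrite addr0; exists (c :: s).
  have -> : horner_list y s * y + c + (horner_list y r * y + d)
     = (horner_list y s + horner_list y r) * y + (c + d) by ring.
  apply: HS.
    by apply: subalg_add; [apply: sb | apply: rb]; exact: mem_head.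
  apply: IH; first by move=> e es; apply: sb; rewrite inE es orbT.
  by exists r => // e er; apply: rb; rewrite inE er orbT.
have HZ c v : subalg f b c -> H v -> H (c * v).
  move=> sc [s sb ->]; elim: s sb => [|d s IH] sb /=.
    by rewrite mulr0; apply: H1; exact: subalg0.
  rewrite mulrDr mulrA; apply: HS.
    by apply: subalg_mul => //; apply: sb; exact: mem_head.
  by apply: IH => e es; apply: sb; rewrite inE es orbT.
elim=> [c|x|u v _ Hu _ Hv|u v _ [s sb ->] _ Hv].
- exact/H1/subalg_const.
- rewrite inE => /orP[/eqP->|xb]; last exact/H1/subalg_gen.
  have := HS 0 1 (subalg0 f b) (H1 _ (subalg1 f b)).
  by rewrite mul1r addr0.
- exact: HD.
elim: s sb => [|d s IH] sb /=; first by rewrite mul0r; apply: H1; exact: subalg0.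
rewrite mulrDl; apply: HD; last by apply: HZ => //; apply: sb; exact: mem_head.
have := HS 0 _ (subalg0 f b) (IH _); rewrite addr0 mulrAC; apply.
by move=> e es; apply: sb; rewrite inE es orbT.
Qed.

Section Points.
Variables (k : fieldType) (A : algebra k).

Definition point_base (L : fieldType) (x : {rmorphism A -> L}) : {rmorphism k -> L} :=
  x \o alg_in A.

Definition point_trdeg (L : fieldType) (x : {rmorphism A -> L}) (w : seq A) : nat :=
  trdeg (point_base x) (map x w).

Section OnePoint.
Variables (L : fieldType) (x : {rmorphism A -> L}).

Lemma point_subalg (b : seq A) a :
  subalg (alg_in A) b a -> subalg (point_base x) (map x b) (x a).
Proof.
elim=> [c|y yb|u v _ su _ sv|u v _ su _ sv].
- exact: (subalg_const (point_base x)).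
- exact/subalg_gen/map_f.
- by rewrite rmorphD; exact: subalg_add.
- by rewrite rmorphM; exact: subalg_mul.
Qed.

Lemma subalg_point (b : seq A) u :
  subalg (point_base x) (map x b) u -> exists2 a, subalg (alg_in A) b a & u = x a.
Proof.
elim=> [c|_ /mapP[a ab ->]|_ _ _ [a sa ->] _ [c sc ->]|_ _ _ [a sa ->] _ [c sc ->]].
- by exists (alg_in A c) => //; exact: subalg_const.
- by exists a => //; exact: subalg_gen.
- by exists (a + c); [exact: subalg_add|rewrite rmorphD].
- by exists (a * c); [exact: subalg_mul|rewrite rmorphM].
Qed.

(** Algebraic dependence over the values of functions can be written with
    functions as coefficients, which can then be evaluated elsewhere. *)
Lemma point_algebraicP (b : seq A) (y : L) :
  algebraic (point_base x) (map x b) y <->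
  exists s : seq A, [/\ forall c, c \in s -> subalg (alg_in A) b c,
    exists2 c, c \in s & x c != 0 & horner_list y (map x s) = 0].
Proof.
split=> [[p [p0 sp py]]|[s [sb [c cs c0] s0]]].
  have [|d [g [_ d0 sg gE]]] :=
      @common_denominator A L x (subalg (alg_in A) b) p (subalg0 _ _) (subalg1 _ _)
        (@subalg_mul _ _ _ _).
    move=> i; have [_ [_ [/subalg_point[a sa ->] /subalg_point[c sc ->] c0 ->]]] :=
      subfield_frac (sp i).
    by exists a, c.
  exists (mkseq g (size p)); split.
  - by move=> c /mapP[i _ ->].
  - exists (g (size p).-1).
      by apply: map_f; rewrite mem_iota /= add0n prednK ?size_poly_gt0.
    by rewrite -gE mulf_neq0 // -/(lead_coef p) lead_coef_eq0.
  rewrite horner_listE.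
  have -> : Poly (map x (mkseq g (size p))) = x d *: p.
    apply/polyP => i; rewrite coef_Poly coefZ gE -map_comp.
    have [ip|ip] := ltnP i (size p); first by rewrite nth_mkseq.
    by rewrite nth_default ?size_mkseq // -gE nth_default // mulr0.
  by rewrite hornerZ (eqP py) mulr0.
exists (Poly (map x s)); split.
- apply/eqP => /polyP P0; have /(nthP 0)[i si ci] := cs.
  by move: c0; rewrite -ci -(nth_map _ 0) // -coef_Poly P0 coef0 eqxx.
- move=> i; rewrite coef_Poly; have [si|si] := ltnP i (size s); last first.
    by rewrite nth_default ?size_map //; exact: subfield0.
  rewrite (nth_map 0) //; have := point_subalg (sb _ (mem_nth 0 si)).
  elim=> [e|z zb|u v _ su _ sv|u v _ su _ sv].
  + exact: subfield_const.
  + exact: subfield_gen.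
  + exact: subfield_add.
  + exact: subfield_mul.
- by rewrite /root -horner_listE s0.
Qed.

Lemma point_trdeg_cons y b : point_trdeg x (y :: b) = size (y :: b) ->
  point_trdeg x b = size b /\ ~ algebraic (point_base x) (map x b) (x y).
Proof.
rewrite /point_trdeg /=; have [ay|nay] := pselect (algebraic (point_base x) (map x b) (x y)).
  rewrite asboolT //= add0n => ib; have := trdeg_size (point_base x) (map x b).
  by rewrite ib size_map ltnn.
by rewrite asboolF // add1n => -[].
Qed.

Lemma point_trdeg_le (b w : seq A) : {subset b <= w} ->
  (point_trdeg x b <= point_trdeg x w)%N.
Proof.
by move=> bw; apply: trdeg_le => _ /mapP[a ab ->]; apply/algebraic_gen/map_f/bw.
Qed.

Lemma point_trdeg_subalg (b w : seq A) :
  (forall a, a \in b -> subalg (alg_in A) w a) ->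
  (point_trdeg x b <= point_trdeg x w)%N.
Proof.
move=> bw; apply: trdeg_le => _ /mapP[a /bw ab ->].
exact/algebraic_subalg/point_subalg.
Qed.

Lemma point_basis (w : seq A) : exists b : seq A,
  [/\ {subset b <= w}, point_trdeg x b = size b & size b = point_trdeg x w].
Proof. by have [b [bw ib sb _]] := exists_basis (point_base x) x w; exists b. Qed.
End OnePoint.

(** A polynomial expression in b that vanishes at x', where b is independent, has
    zero coefficients, so it vanishes at every point. *)
Lemma independent_faithful (L L' : fieldType) (x : {rmorphism A -> L})
    (x' : {rmorphism A -> L'}) (b : seq A) a :
  point_trdeg x' b = size b -> subalg (alg_in A) b a -> x' a = 0 -> x a = 0.
Proof.
elim: b a => [|y b IH] a.
  move=> _ sa; have [c ->] : exists c, a = alg_in A c.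
    elim: sa => [c|//|u v _ [c ->] _ [d ->]|u v _ [c ->] _ [d ->]].
    - by exists c.
    - by exists (c + d); rewrite rmorphD.
    - by exists (c * d); rewrite rmorphM.
  have [->|c0 /eqP] := eqVneq c 0; first by rewrite !rmorph0.
  by rewrite -[x' _]/(point_base x' c) fmorph_eq0 (negbTE c0).
case/point_trdeg_cons => ib nay /subalg_cons_horner[s sb ->].
rewrite horner_list_rmorph => s0; rewrite horner_list_rmorph.
have xs0 c : c \in s -> x c = 0.
  move=> cs; apply: (IH _ ib); first exact: sb.
  by apply: contrapT => /eqP c0; apply: nay; apply/point_algebraicP;
    exists s; split=> //; exists c.
elim: s xs0 {sb s0} => //= c s IHs xs0; rewrite (xs0 _ (mem_head _ _)) addr0 IHs ?mul0r //.
by move=> e es; apply: xs0; rewrite inE es orbT.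
Qed.

(** By [independent_faithful] applied to the rest of the list, a relation
    at x does not become trivial at x'. *)
Lemma independent_specialization (L L' : fieldType) (x : {rmorphism A -> L})
    (x' : {rmorphism A -> L'}) (b : seq A) :
  (forall a, subalg (alg_in A) b a -> x a = 0 -> x' a = 0) ->
  point_trdeg x' b = size b -> point_trdeg x b = size b.
Proof.
elim: b => // y b IH xx' /point_trdeg_cons[ib nay].
have up a : subalg (alg_in A) b a -> subalg (alg_in A) (y :: b) a.
  by apply: subalg_mono => c bc; rewrite inE bc orbT.
rewrite /point_trdeg /= -/(point_trdeg x b) IH //; last by move=> a /up; exact: xx'.
rewrite asboolF // => /point_algebraicP[s [sb [c cs /eqP c0]]].
rewrite -horner_list_rmorph => /xx'; rewrite horner_list_rmorph => s0.
apply: c0; apply: (independent_faithful x ib); first exact: sb.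
apply: contrapT => /eqP c0; apply: nay; apply/point_algebraicP.
exists s; split=> //; first by exists c.
apply: s0; elim: s sb {cs c0} => [|d s IHs] sb /=; first exact: subalg0.
apply: subalg_add; last by apply/up/sb/mem_head.
apply: subalg_mul; last exact/subalg_gen/mem_head.
by apply: IHs => e es; apply: sb; rewrite inE es orbT.
Qed.

Section Specialization.
Variables (L L' : fieldType) (x : {rmorphism A -> L}) (x' : {rmorphism A -> L'}).
Hypothesis xx' : forall a, x a = 0 -> x' a = 0.

Lemma point_trdeg_specialization w : (point_trdeg x' w <= point_trdeg x w)%N.
Proof.
have [b [bw ib <-]] := point_basis x' w.
by rewrite -(independent_specialization (fun a _ => @xx' a) ib); exact: point_trdeg_le.
Qed.

(** Take b independent at x'.  In a relation of a0 over b at x, divide by a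
    power of a0, which is not zero at x; at x' this leaves the constant
    coefficient, which then vanishes, contradicting [independent_faithful]. *)
Lemma point_trdeg_specialization_lt w a0 : x' a0 = 0 -> x a0 != 0 ->
  (point_trdeg x' w < point_trdeg x (a0 :: w))%N.
Proof.
move=> x'0 x0; have [b [bw ib <-]] := point_basis x' w.
apply: (@leq_trans (point_trdeg x (a0 :: b))); last first.
  by apply: point_trdeg_le => c; rewrite !inE => /orP[->//|/bw ->]; rewrite orbT.
rewrite /point_trdeg /= -/(point_trdeg x b)
  (independent_specialization (fun a _ => @xx' a) ib) asboolF //.
move=> /point_algebraicP[s [sb [c cs /eqP c0]]] s0; apply: c0.
elim: s sb cs s0 => //= d s IH sb cs s0.
have d0 : x d = 0.
  apply: (independent_faithful x ib); first by apply: sb; exact: mem_head.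
  have : x' (horner_list a0 s * a0 + d) = 0.
    by apply: xx'; rewrite rmorphD rmorphM horner_list_rmorph.
  by rewrite rmorphD rmorphM x'0 mulr0 add0r.
move: cs; rewrite inE => /orP[/eqP->//|cs]; apply: IH => //.
  by move=> e es; apply: sb; rewrite inE es orbT.
by apply/eqP; move: s0 => /eqP; rewrite d0 addr0 mulf_eq0 (negbTE x0) orbF.
Qed.
End Specialization.

Lemma point_trdeg_ext (L M : fieldType) (x : {rmorphism A -> L}) (u : {rmorphism L -> M}) w :
  point_trdeg (u \o x) w = point_trdeg x w.
Proof.
apply/eqP; rewrite eqn_leq; apply/andP; split; apply: point_trdeg_specialization => a /=.
  by move=> ->; rewrite rmorph0.
by move/eqP; rewrite fmorph_eq0 => /eqP.
Qed.

Definition max_trdeg (w : seq A) (m : nat) : Prop :=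
  (exists (L : fieldType) (x : {rmorphism A -> L}), point_trdeg x w = m) /\
  (forall (L : fieldType) (x : {rmorphism A -> L}), (point_trdeg x w <= m)%N).

Lemma max_trdeg_uniq w m n : max_trdeg w m -> max_trdeg w n -> m = n.
Proof.
move=> [[L [x <-]] lem] [[L' [x' <-]] len].
by apply/eqP; rewrite eqn_leq len lem.
Qed.

Lemma max_trdeg_exists w (L : fieldType) (x : {rmorphism A -> L}) : exists m, max_trdeg w m.
Proof.
pose Q n := `[< exists (L : fieldType) (x : {rmorphism A -> L}), point_trdeg x w = n >].
have exQ : exists n, Q n by exists (point_trdeg x w); apply/asboolP; exists L, x.
have ubQ n : Q n -> (n <= size w)%N.
  by move=> /asboolP[M [y <-]]; rewrite -(size_map y) trdeg_size.
case: (ex_maxnP exQ ubQ) => m /asboolP Qm le_m; exists m; split=> // M y.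
by apply: le_m; apply/asboolP; exists M, y.
Qed.
End Points.

(** The image in S of the complement of ker x is a multiplicative set without 0,
    so some prime of S is disjoint from it. *)
Lemma exists_point_above (A S : comPzRingType) (L : fieldType) (j : {rmorphism A -> S})
    (x : {rmorphism A -> L}) : injective j ->
  exists (M : fieldType) (y : {rmorphism S -> M}), forall a, y (j a) = 0 -> x a = 0.
Proof.
move=> ij; have [||||P [primeP _ PT]] :=
  @exists_prime_avoiding S (eq^~ 0) (fun b => exists2 a, b = j a & x a != 0).
- split=> [//|u v -> ->|u v ->]; [exact: addr0|exact: mulr0].
- by exists 1; rewrite rmorph1 // oner_neq0.
- by move=> _ _ [a -> a0] [b -> b0]; exists (a * b); rewrite rmorphM // mulf_neq0.
- move=> _ -> [a]; rewrite -(rmorph0 j) => /ij <-.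
  by rewrite rmorph0 eqxx.
have [M [y [y0 _]]] := exists_residue_field primeP; exists M, y => a /y0 Pa.
by apply/eqP/contraT => xa; case: (PT _ Pa); exists a.
Qed.

(** * Krull dimension as a maximal transcendence degree *)

(** The usual trick: l^(n-1) q(y) is a monic expression in l y, where l is the
    leading coefficient of q and n its degree. *)
Lemma integral_lead (R : comNzRingType) (L : fieldType) (ev : {rmorphism R -> L})
    (q : {poly R}) y :
  root (map_poly ev q) y -> ev (lead_coef q) != 0 ->
  integralOver ev (ev (lead_coef q) * y).
Proof.
move=> qy l0; set l := lead_coef q in l0 *.
have [n sq] : exists n, size q = n.+1.
  exists (size q).-1; rewrite prednK // lt0n; apply: contraNneq l0 => sq.
  by rewrite /l lead_coefE sq nth_default ?sq // rmorph0.
have ln : l = q`_n by rewrite /l lead_coefE sq.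
case: n => [|n] in sq ln *.
  move: qy; rewrite (size1_polyC (eq_leq sq)) map_polyC /= rootC -ln => l00.
  by rewrite l00 in l0.
pose r := \poly_(i < n.+2) (if i == n.+1 then 1 else q`_i * l ^+ (n - i)).
exists r.
  rewrite monicE lead_coefE size_poly_eq /= ?eqxx ?oner_neq0 //.
  by rewrite coef_poly ltnSn eqxx.
have sq' : size (map_poly ev q) = n.+2.
  by rewrite size_map_poly_id0 // -/l.
rewrite /root horner_coef size_map_poly_id0; last first.
  by rewrite lead_coefE size_poly_eq /= ?eqxx ?oner_neq0 // coef_poly ltnSn eqxx rmorph1 oner_neq0.
rewrite size_poly_eq ?eqxx ?oner_neq0 //.
have : \sum_(i < n.+2) ev q`_i * y ^+ i = 0.
  move: qy => /eqP; rewrite horner_coef sq'; apply: etrans.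
  by apply: eq_bigr => i _; rewrite coef_map.
rewrite big_ord_recr /= -ln => e; apply/eqP.
transitivity (ev l ^+ n * 0); last by rewrite mulr0.
rewrite -[X in _ = _ * X]e big_ord_recr /= mulrDr mulr_sumr; congr (_ + _).
  apply: eq_bigr => i _; rewrite coef_map coef_poly ltnS (ltnW (ltn_ord i)) ltn_eqF //=.
  rewrite rmorphM rmorphXn exprMn.
  have ni : (i <= n)%N by rewrite -ltnS.
  have -> : ev l ^+ n = ev l ^+ (n - i) * ev l ^+ i by rewrite -exprD subnK.
  by ring.
by rewrite coef_map coef_poly ltnSn eqxx /= rmorph1 mul1r exprMn exprS; ring.
Qed.

(** The rational root argument, for the polynomial ring as base ring. *)
Lemma integral_fraction_dvdp (k L : fieldType) (ev : {rmorphism {poly k} -> L}) (a b : {poly k}) :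
  injective ev -> b != 0 -> integralOver ev (ev a / ev b) -> exists n, b %| a ^+ n.
Proof.
move=> ev_inj b0 [p mon_p rp].
have eb0 : ev b != 0 by rewrite -(rmorph0 ev) (inj_eq ev_inj).
have [n sp] : exists n, size p = n.+1.
  by exists (size p).-1; rewrite prednK // size_poly_gt0 monic_neq0.
have pn : p`_n = 1 by move: mon_p; rewrite monicE lead_coefE sp => /eqP.
exists n; have : \sum_(i < n.+1) p`_i * a ^+ i * b ^+ (n - i) = 0.
  apply: ev_inj; rewrite rmorph0 rmorph_sum /=.
  transitivity (ev b ^+ n * 0); last by rewrite mulr0.
  rewrite -[X in _ = _ * X](eqP rp) horner_coef size_map_poly_id0
    ?(monicP mon_p) ?rmorph1 ?oner_neq0 // sp.
  rewrite mulr_sumr; apply: eq_bigr => i _; rewrite coef_map !rmorphM !rmorphXn.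
  have ni : (i <= n)%N by rewrite -ltnS.
  have -> : ev b ^+ n = ev b ^+ (n - i) * ev b ^+ i by rewrite -exprD subnK.
  rewrite exprMn exprVn.
  by field; rewrite expf_neq0.
rewrite big_ord_recr /= pn mul1r subnn expr0 mulr1 => /eqP; rewrite addrC addr_eq0 => /eqP ->.
rewrite dvdpNr; elim/big_ind: _ => [|u v|i _]; [exact: dvdp0|exact: dvdp_add|].
by rewrite -(subnSK (ltn_ord i)) exprS mulrCA dvdp_mulIl.
Qed.

(** Zariski's lemma.  For a list t :: s, the entries of s are algebraic over k(t)
    by induction.  If t were transcendental, then G y would be integral over k[t]
    for one nonzero G in k[t] and all y in s; so 1 / (1 + t G), multiplied by a power of G,
    would be integral over k[t], and 1 + t G would divide a power of G. *)
Lemma zariski (k L : fieldType) (f : {rmorphism k -> L}) (s : seq L) :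
  (forall u, subalg f s u -> subalg f s u^-1) ->
  forall y, y \in s -> algebraic f [::] y.
Proof.
elim: s k f => [//|t s IH] k f inv_s.
pose v : {rmorphism subfield_type f [:: t] -> L} := \val.
have subf u : subfield f [:: t] u -> subalg f (t :: s) u.
  elim=> [c|x|x y _ sx _ sy|x y _ sx _ sy|x _ sx].
  - exact: subalg_const.
  - by rewrite inE => /eqP->; apply/subalg_gen/mem_head.
  - exact: subalg_add.
  - exact: subalg_mul.
  - exact: inv_s.
have vsub u : subalg v s u -> subalg f (t :: s) u.
  elim=> [c|x xs|x y _ sx _ sy|x y _ sx _ sy].
  - exact/subf/asboolP/subfield_valP.
  - by apply: subalg_gen; rewrite inE xs orbT.
  - exact: subalg_add.
  - exact: subalg_mul.
have subv u : subalg f (t :: s) u -> subalg v s u.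
  have vc w : subfield f [:: t] w -> subalg v s w.
    by move=> /asboolP sw; exact: (subalg_const v s (SubfieldElt sw)).
  elim=> [c|x|x y _ sx _ sy|x y _ sx _ sy].
  - exact/vc/subfield_const.
  - rewrite inE => /orP[/eqP->|xs]; last exact: subalg_gen.
    by apply/vc/subfield_gen/mem_head.
  - exact: subalg_add.
  - exact: subalg_mul.
have st y : y \in s -> algebraic f [:: t] y.
  move=> ys; have := IH _ v (fun u su => subv _ (inv_s _ (vsub _ su))) _ ys.
  apply: algebraic_trans => // c; apply: algebraic_subfield.
  exact/asboolP/subfield_valP.
suff at_ : algebraic f [::] t.
  move=> y; rewrite inE => /orP[/eqP->//|/st]; apply: algebraic_sub => x.
  by rewrite inE => /eqP->.
apply: contrapT => nat_.
pose ev : {rmorphism {poly k} -> L} := horner_eval t \o map_poly f.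
have evE p : ev p = (map_poly f p).[t] by [].
have ev_inj : injective ev.
  apply: raddf_inj => p pt; apply: contrapT => /eqP p0; apply: nat_.
  exists (map_poly f p); split; first by rewrite map_poly_eq0.
    by move=> i; rewrite coef_map; exact: subfield_const.
  exact/eqP.
have evS a : subalg f [:: t] a -> exists p, a = ev p.
  elim=> [c|x|_ _ _ [p ->] _ [q ->]|_ _ _ [p ->] _ [q ->]].
  - by exists c%:P; rewrite evE map_polyC hornerC.
  - by rewrite inE => /eqP->; exists 'X; rewrite evE map_polyX hornerX.
  - by exists (p + q); rewrite rmorphD.
  - by exists (p * q); rewrite rmorphM.
(* G is the product of the leading coefficients of equations over k[t] for the
   entries of s. *)
have [G G0 Gs] : exists2 G, G != 0 & forall y, y \in s -> integralOver ev (ev G * y).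
  elim: s st {IH inv_s subf vsub subv} => [|y s IHs] st; first by exists 1; rewrite ?oner_neq0.
  have [G G0 Gs] : exists2 G, G != 0 & forall y, y \in s -> integralOver ev (ev G * y).
    by apply: IHs => z zs; apply: st; rewrite inE zs orbT.
  have [p [p0 sp py]] := st y (mem_head _ _).
  have [//|//|//||d [g [_ d0 _ gE]]] := @common_denominator {poly k} L ev (fun=> True) p.
    move=> i; have [_ [_ [/evS[a ->] /evS[b ->] b0 ->]]] := subfield_frac (sp i).
    by exists a, b.
  pose q := \poly_(i < size p) g i.
  have mq : map_poly ev q = ev d *: p.
    apply/polyP => i; rewrite coef_map coefZ coef_poly; case: ltnP => ip; first by rewrite gE.
    by rewrite raddf0 [p`_i]nth_default // mulr0.
  have q0 : q != 0.
    apply: contraNneq p0 => q0; move: mq; rewrite q0 rmorph0 => /esym/eqP.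
    by rewrite scaler_eq0 (negbTE d0).
  have l0 : ev (lead_coef q) != 0.
    by rewrite -(rmorph0 ev) (inj_eq ev_inj) lead_coef_eq0.
  have iy : integralOver ev (ev (lead_coef q) * y).
    by apply: integral_lead => //; rewrite mq rootZ.
  exists (G * lead_coef q); first by rewrite mulf_neq0 // lead_coef_eq0.
  move=> z; rewrite inE rmorphM => /orP[/eqP->|/Gs iz].
    by rewrite -mulrA; apply: integral_mul => //; exact: integral_id.
  by rewrite mulrAC; apply: integral_mul => //; exact: integral_id.
have intG u : subalg f (t :: s) u -> exists N, integralOver ev (ev G ^+ N * u).
  have up N M w : integralOver ev (ev G ^+ N * w) -> integralOver ev (ev G ^+ (M + N) * w).
    move=> iw; rewrite exprD -mulrA; apply: integral_mul => //.
    by rewrite -rmorphXn; exact: integral_id.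
  elim=> [c|x|x y _ [N iN] _ [M iM]|x y _ [N iN] _ [M iM]].
  - exists 0%N; rewrite mul1r; have -> : f c = ev c%:P by rewrite evE map_polyC hornerC.
    exact: integral_id.
  - rewrite inE => /orP[/eqP->|/Gs]; last by exists 1%N.
    exists 0%N; rewrite mul1r; have -> : t = ev 'X by rewrite evE map_polyX hornerX.
    exact: integral_id.
  - exists (M + N)%N; rewrite mulrDr; apply: integral_add; first exact: up.
    by rewrite addnC; exact: up.
  - exists (N + M)%N; rewrite exprD mulrACA; exact: integral_mul.
(* b(t) = 1 + t G is invertible in k[t, s], although b is prime to G. *)
pose b : {poly k} := G * 'X + 1.
have sb : (1 < size b)%N.
  rewrite /b size_polyDl size_mulX // ?size_poly1 ltnS ?size_poly_gt0 //.
have b0 : b != 0 by rewrite -size_poly_gt0 (ltn_trans _ sb).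
have [|N] := intG (ev b)^-1.
  apply: inv_s; elim/poly_ind: b {sb b0} => [|p c IHp].
    by rewrite rmorph0; exact: subalg0.
  rewrite rmorphD rmorphM; apply: subalg_add; first apply: subalg_mul => //.
    by rewrite evE map_polyX hornerX; apply/subalg_gen/mem_head.
  by rewrite evE map_polyC hornerC; exact: subalg_const.
rewrite -rmorphXn => /(integral_fraction_dvdp ev_inj b0)[n]; rewrite -exprM => bG.
have cGb : coprimep b (G ^+ (N * n)).
  apply: coprimep_expr; apply/Bezout_eq1_coprimepP; exists (1, - 'X) => /=.
  by rewrite /b; ring.
by have := coprimep_dvdl bG cGb; rewrite coprimepp eqn_leq leqNgt sb.
Qed.

Section KrullDimension.
Variables (k : fieldType) (B : algebra k) (s : seq B).
Hypothesis gen_s : forall b, subalg (alg_in B) s b.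

(** Choose c0, c independent at x.  If every function b with x b <> 0 divided,
    at x, a nonzero element of k[c], then k(c)[s] would be a field and Zariski's
    lemma would make c0 algebraic over k(c).  So for some b the ideal generated
    by b and ker x avoids the nonzero elements of k[c], and a prime that
    contains this ideal and avoids them gives the required point. *)
Lemma exists_proper_specialization (L : fieldType) (x : {rmorphism B -> L}) n :
  (n < point_trdeg x s)%N ->
  exists (M : fieldType) (y : {rmorphism B -> M}),
    [/\ forall b, x b = 0 -> y b = 0, exists2 b, y b = 0 & x b != 0 & (n <= point_trdeg y s)%N].
Proof.
move=> /trdeg_sublist[[|c0 c] [cs ic] // [sc]].
have [ic' nac] := point_trdeg_cons ic.
pose f1 : {rmorphism subfield_type (point_base x) (map x c) -> L} := \val.
pose T a := subalg (alg_in B) c a /\ x a != 0.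
have T1 : T 1 by split; [exact: subalg1|rewrite rmorph1 oner_neq0].
have TM a b : T a -> T b -> T (a * b).
  by move=> [sa a0] [sb b0]; split; [exact: subalg_mul|rewrite rmorphM mulf_neq0].
have [b b0 bT] : exists2 b, x b != 0 & forall b' p, x p = 0 -> ~ T (b * b' + p).
  apply: contrapT => no; apply: nac.
  have inv b : x b != 0 -> exists b' t, T t /\ x (b * b') = x t.
    move=> b0; apply: contrapT => nb; apply: no; exists b => // b' p p0 Tt.
    by apply: nb; exists b', (b * b' + p); rewrite [x (_ + p)]rmorphD p0 addr0.
  have sub1 b : subalg f1 (map x s) (x b).
    elim: (gen_s b) => [e|a sa|a a' _ ha _ ha'|a a' _ ha _ ha'].
    - have se : subfield (point_base x) (map x c) (x (alg_in B e)).
        exact: (subfield_const (point_base x)).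
      exact: (subalg_const f1 _ (SubfieldElt (introT (asboolP _) se))).
    - exact/subalg_gen/map_f.
    - by rewrite rmorphD; exact: subalg_add.
    - by rewrite rmorphM; exact: subalg_mul.
  have sub1V t : T t -> subalg f1 (map x s) (x t)^-1.
    move=> [st t0]; have se : subfield (point_base x) (map x c) (x t)^-1.
      apply: subfield_inv; elim: (point_subalg x st) => *;
        [exact: subfield_const|exact: subfield_gen|exact: subfield_add|exact: subfield_mul].
    exact: (subalg_const f1 _ (SubfieldElt (introT (asboolP _) se))).
  have frac u : subalg f1 (map x s) u -> exists b t, T t /\ u = x b / x t.
    elim=> [e|_ /mapP[a sa ->]|_ _ _ [a [t [Tt ->]]] _ [a' [t' [Tt' ->]]]
      |_ _ _ [a [t [Tt ->]]] _ [a' [t' [Tt' ->]]]].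
    - have /asboolP/subfield_frac[u1 [u2 [s1 s2 t0 eE]]] := subfield_valP e.
      have [a sa aE] := subalg_point s1; have [t st tE] := subalg_point s2; exists a, t; split.
        by split; rewrite // -tE.
      by rewrite -aE -tE -eE.
    - by exists a, 1; rewrite rmorph1 divr1.
    - exists (a * t' + a' * t), (t * t'); split; first exact: TM.
      case: Tt Tt' => _ t0 [_ t'0]; rewrite rmorphD !rmorphM.
      by field; rewrite t0 t'0.
    - exists (a * a'), (t * t'); split; first exact: TM.
      case: Tt Tt' => _ t0 [_ t'0]; rewrite !rmorphM.
      by field; rewrite t0 t'0.
  have := @zariski _ _ f1 (map x s) _ (x c0) (map_f x (cs _ (mem_head _ _))).
  case=> [u /frac[b [t [Tt ->]]]|p [p0 sp px]].
    have [->|b0] := eqVneq (x b) 0; first by rewrite mul0r invr0; exact: subalg0.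
    have [b' [t' [Tt' bb']]] := inv _ b0.
    have -> : (x b / x t)^-1 = x t * x b' / x t'.
      case: Tt Tt' => _ t0 [_ t'0]; rewrite -bb' rmorphM.
      have b'0 : x b' != 0.
        by apply: contraNneq t'0 => b'0; rewrite -bb' rmorphM b'0 mulr0.
      by field; rewrite t0 b0 b'0 ?t'0.
    by rewrite -rmorphM; apply: subalg_mul; [exact: sub1|exact: sub1V].
  apply: (@algebraic_root _ _ _ _ p) => // i; apply: algebraic_subfield.
  elim: (sp i) => [e|//|u v _ su _ sv|u v _ su _ sv|u _ su].
  - exact/asboolP/subfield_valP.
  - exact: subfield_add.
  - exact: subfield_mul.
  - exact: subfield_inv.
have [|||a IaT|P [primeP IP PT]] := @exists_prime_avoiding B
    (fun a => exists b' p, x p = 0 /\ a = b * b' + p) T.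
- split=> [|u v [b1 [p [p0 ->]]] [b2 [q [q0 ->]]]|a u [b1 [p [p0 ->]]]].
  + by exists 0, 0; rewrite rmorph0 mulr0 addr0.
  + by exists (b1 + b2), (p + q); rewrite rmorphD p0 q0 addr0; split=> //; ring.
  + by exists (a * b1), (a * p); rewrite rmorphM p0 mulr0; split=> //; ring.
- by [].
- by [].
- by case: IaT => b' [p [p0 ->]]; exact: bT.
have [M [y [y0 _]]] := exists_residue_field primeP.
exists M, y; split=> [a a0|//|].
- by apply/y0/IP; exists 0, a; rewrite mulr0 add0r.
- by exists b => //; apply/y0/IP; exists 1, 0; rewrite rmorph0 mulr1 addr0.
apply: leq_trans (point_trdeg_le y (b := c) _); last first.
  by move=> a ca; apply: cs; rewrite inE ca orbT.
rewrite -sc (independent_specialization _ ic') // => a sa ya.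
by apply: contrapT => /eqP xa; case: (PT a _); [exact/y0|split].
Qed.

(** Iterating [exists_proper_specialization] n times from x. *)
Lemma has_chain_above (L : fieldType) (x : {rmorphism B -> L}) n :
  (n <= point_trdeg x s)%N ->
  exists P : nat -> B -> Prop, [/\ forall b, P 0 b <-> x b = 0,
    forall i, (i <= n)%N -> is_prime_ideal (P i) &
    forall i, (i < n)%N ->
      (forall b, P i b -> P i.+1 b) /\ exists2 b, P i.+1 b & ~ P i b].
Proof.
have primex (M : fieldType) (y : {rmorphism B -> M}) : is_prime_ideal (fun b => y b = 0).
  split=> [|/eqP|a b /eqP]; first split=> [|a b a0 b0|a b b0].
  - exact: rmorph0.
  - by rewrite rmorphD a0 b0 addr0.
  - by rewrite rmorphM b0 mulr0.
  - by rewrite rmorph1 oner_eq0.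
  - by rewrite rmorphM mulf_eq0 => /orP[]/eqP; [left|right].
elim: n L x => [|n IH] L x nx.
  by exists (fun _ b => x b = 0); split=> // i _; exact: primex.
have [M [y [xy [b yb xb] /IH [P [P0 primeP chainP]]]]] := exists_proper_specialization nx.
exists (fun i => if i is i'.+1 then P i' else fun b => x b = 0); split=> //.
  by case=> [|i] ni; [exact: primex|exact: primeP].
case=> [|i] ni; last exact: chainP.
by split=> [a /xy /P0//|]; exists b; [exact/P0|exact/eqP].
Qed.

Lemma point_of_chain n : has_prime_chain B n ->
  exists (L : fieldType) (x : {rmorphism B -> L}), (n <= point_trdeg x s)%N.
Proof.
case=> P [primeP chainP].
suff [L [x [_ nx]]] : exists (L : fieldType) (x : {rmorphism B -> L}),
    (forall b, x b = 0 <-> P 0 b) /\ (n <= point_trdeg x s)%N by exists L, x.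
elim: n P primeP chainP => [|n IH] P primeP chainP;
    have [L [x [x0 _]]] := exists_residue_field (primeP 0 isT).
  by exists L, x.
have [||M [y [y0 ny]]] := IH (fun i => P i.+1).
- by move=> i; exact: (primeP i.+1).
- by move=> i; exact: (chainP i.+1).
exists L, x; split=> //; have [P01 [b P1b nP0b]] := chainP 0%N isT.
have xy a : x a = 0 -> y a = 0 by move=> /x0 /P01 /y0.
have yb : y b = 0 by exact/y0.
have xb : x b != 0 by apply/eqP => /x0.
apply: leq_ltn_trans ny _; apply: leq_trans (point_trdeg_specialization_lt xy _ yb xb) _.
by apply: point_trdeg_subalg => a _; exact: gen_s.
Qed.

Lemma krull_dim_max_trdeg m : krull_dim B m <-> max_trdeg s m.
Proof.
have chain (L : fieldType) (x : {rmorphism B -> L}) n :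
    (n <= point_trdeg x s)%N -> has_prime_chain B n.
  by move=> /has_chain_above[P [_ primeP chainP]]; exists P.
split=> [[/point_of_chain[L [x mx]] max_m]|[[L [x xm]] max_m]].
  have le_m (M : fieldType) (y : {rmorphism B -> M}) : (point_trdeg y s <= m)%N.
    exact/max_m/(chain _ y).
  by split=> //; exists L, x; apply/eqP; rewrite eqn_leq le_m.
split; first by apply: (chain _ x); rewrite xm.
by move=> n /point_of_chain[M [y ny]]; exact: leq_trans ny (max_m _ _).
Qed.
End KrullDimension.

(** * Free composita of fields *)

(** The projection of L onto its line F along a complementary F-subspace W, which
    is a maximal subspace that does not contain 1. *)
Lemma exists_retraction (F L : fieldType) (g : {rmorphism F -> L}) :
  exists r : L -> F, [/\ r 1 = 1, forall d e, r (d + e) = r d + r e &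
    forall c d, r (g c * d) = c * r d].
Proof.
pose Q (W : L -> Prop) := [/\ W 0, forall d e, W d -> W e -> W (d + e),
  forall c d, W d -> W (g c * d) & ~ W 1].
have [||W [[W0 WD WZ W1] _ maxW]] := @zorn_above L Q (eq^~ 0).
- split=> [//|d e -> ->|c d ->|/eqP]; [exact: addr0|exact: mulr0|].
  by rewrite oner_eq0.
- move=> C [X0 CX0] CQ totC; split=> [|d e [X CX Xd] [Y CY Ye]|c d [X CX Xd]|[X CX X1]].
  + by exists X0 => //; case: (CQ _ CX0).
  + have [_ DX _ _] := CQ _ CX; have [_ DY _ _] := CQ _ CY.
    case: (totC _ _ CX CY) => [/(_ _ Xd) Yd|/(_ _ Ye) Xe].
      by exists Y => //; exact: DY.
    by exists X => //; exact: DX.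
  + by exists X => //; case: (CQ _ CX) => _ _ ZX _; exact: ZX.
  + by case: (CQ _ CX) => _ _ _; apply.
have WB d e : W d -> W e -> W (d - e).
  by move=> Wd We; rewrite -mulN1r -(rmorph1 g) -rmorphN; apply/WD/WZ.
have dec d : exists c, W (d - g c).
  have [Wd|nWd] := pselect (W d); first by exists 0; rewrite rmorph0 subr0.
  have [a [w [Ww w1]]] : exists a w, W w /\ w + g a * d = 1.
    apply: contrapT => no; apply: nWd.
    apply: (maxW (fun e => exists a w, W w /\ e = w + g a * d)); last first.
    - by exists 1, 0; rewrite rmorph1 mul1r add0r.
    - by move=> w Ww; exists 0, w; rewrite rmorph0 mul0r addr0.
    split=> [|_ _ [a [w [Ww ->]]] [b [v [Wv ->]]]|c _ [a [w [Ww ->]]]|[a [w [Ww w1]]]].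
    - by exists 0, 0; rewrite rmorph0 mul0r addr0.
    - exists (a + b), (w + v); rewrite rmorphD mulrDl addrACA; split=> //; exact: WD.
    - by exists (c * a), (g c * w); rewrite rmorphM mulrDr mulrA; split=> //; exact: WZ.
    - by apply: no; exists a, w.
  have a0 : a != 0.
    by apply/eqP => a0; apply: W1; rewrite -w1 a0 rmorph0 mul0r addr0.
  exists a^-1; have -> : d - g a^-1 = g (- a^-1) * w.
    have ga : g a != 0 by rewrite fmorph_eq0.
    have -> : w = 1 - g a * d by rewrite -w1 addrK.
    by rewrite rmorphN fmorphV; field.
  exact: WZ.
have uniq d c c' : W (d - g c) -> W (d - g c') -> c = c'.
  move=> Wc Wc'; apply/eqP; rewrite -subr_eq0; apply: contrapT => /negP cc'; apply: W1.
  have -> : 1 = g (c - c')^-1 * ((d - g c') - (d - g c)).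
    have -> : (d - g c') - (d - g c) = g (c - c') by rewrite rmorphB; ring.
    by rewrite -rmorphM mulVf // rmorph1.
  exact/WZ/WB.
have [r rP] := choice dec; exists r; split.
- by apply: (uniq 1) => //; rewrite rmorph1 subrr.
- move=> d e; apply: (uniq (d + e)) => //.
  by rewrite rmorphD opprD addrACA; exact: WD.
- move=> c d; apply: (uniq (g c * d)) => //.
  by rewrite rmorphM -mulrBr; exact: WZ.
Qed.

(** A residue field of the tensor product of L1 and L2 over F, which is not zero:
    a (x) d |-> a r(d) is balanced for a retraction r of L2 onto F. *)
Lemma exists_amalgam (F L1 L2 : fieldType) (g1 : {rmorphism F -> L1})
    (g2 : {rmorphism F -> L2}) :
  exists (M : fieldType) (u : {rmorphism L1 -> M}) (v : {rmorphism L2 -> M}),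
    forall c, u (g1 c) = v (g2 c).
Proof.
have [r [r1 rD rZ]] := exists_retraction g2.
have n10 : (1 : tensor g1 g2) <> 0.
  have bal : balanced g1 g2 (fun (a : L1) d => a * g1 (r d)).
    split=> [x y z|x y z|x c y]; first by rewrite mulrDl.
      by rewrite rD rmorphD mulrDr.
    by rewrite rZ rmorphM mulrA.
  move=> /rq_piP /(_ _ _ bal); rewrite /tsum big_nil big_seq1 r1 rmorph1 mulr1 => /eqP.
  by rewrite oner_eq0.
have [||||P [primeP _ _]] := @exists_prime_avoiding (tensor g1 g2) (eq^~ 0) (eq^~ 1).
- split=> [//|x y -> ->|a x ->]; [exact: addr0|exact: mulr0].
- by [].
- by move=> x y -> ->; rewrite mulr1.
- by move=> x -> /esym.
have [M [h _]] := exists_residue_field primeP.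
exists M, (h \o tinl g1 g2), (h \o tinr g1 g2) => c /=.
by rewrite tinlr.
Qed.

Lemma fraction_field_lift (A : comPzRingType) (K L : fieldType) (h : {rmorphism A -> K})
    (p : {rmorphism A -> L}) :
  (forall y, exists a s, h s <> 0 /\ y = h a / h s) ->
  (forall a, p a = 0 <-> h a = 0) ->
  exists q : {rmorphism K -> L}, forall a, q (h a) = p a.
Proof.
move=> hfrac ph.
have pz a b : h a = h b -> p a = p b.
  move=> /eqP; rewrite -subr_eq0 -rmorphB => /eqP/ph/eqP.
  by rewrite rmorphB subr_eq0 => /eqP.
have nz s : h s <> 0 -> (h s != 0) && (p s != 0).
  by move=> s0; apply/andP; split; apply/eqP => // /ph.
pose q y := let a := cid (hfrac y) in p (sval a) / p (sval (cid (svalP a))).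
have qE a s : h s <> 0 -> q (h a / h s) = p a / p s.
  move=> /nz/andP[s0 ps0]; rewrite /q; case: cid => b /= hb.
  case: cid => t /= [/nz/andP[t0 pt0] e].
  have /pz : h (a * t) = h (b * s).
    by rewrite !rmorphM -[h a](divfK s0) e; field.
  rewrite !rmorphM => e'; apply/eqP; rewrite eqr_div // -e'.
  by rewrite mulrC.
have qh a : q (h a) = p a.
  have := qE a 1; rewrite !rmorph1 !divr1; apply; exact/eqP/oner_neq0.
have qB : zmod_morphism q.
  move=> x y; have [a [s [s0 ->]]] := hfrac x; have [b [t [t0 ->]]] := hfrac y.
  have [/andP[hs0 ps0] /andP[ht0 pt0]] := (nz _ s0, nz _ t0).
  have -> : h a / h s - h b / h t = h (a * t - b * s) / h (s * t).
    by rewrite rmorphB !rmorphM; field; rewrite ?hs0 ?ht0.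
  rewrite !qE //; last by rewrite rmorphM; apply/eqP; rewrite mulf_neq0.
  by rewrite rmorphB !rmorphM; field; rewrite ?ps0 ?pt0.
have qM : monoid_morphism q.
  split=> [|x y]; first by rewrite -(rmorph1 h) qh rmorph1.
  have [a [s [s0 ->]]] := hfrac x; have [b [t [t0 ->]]] := hfrac y.
  have [/andP[hs0 ps0] /andP[ht0 pt0]] := (nz _ s0, nz _ t0).
  have -> : h a / h s * (h b / h t) = h (a * b) / h (s * t).
    by rewrite !rmorphM; field; rewrite ?hs0 ?ht0.
  rewrite !qE //; last by rewrite rmorphM; apply/eqP; rewrite mulf_neq0.
  by rewrite !rmorphM; field; rewrite ?ps0 ?pt0.
pose z := GRing.isZmodMorphism.Build _ _ q qB.
pose m := GRing.isMonoidMorphism.Build _ _ q qM.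
by exists (HB.pack q z m : {rmorphism K -> L}).
Qed.

Lemma exists_rational_function_field (F : fieldType) :
  exists (K : fieldType) (h : {rmorphism {poly F} -> K}), injective h /\
    forall y, exists a s, h s <> 0 /\ y = h a / h s.
Proof.
have prime0 : is_prime_ideal (fun p : {poly F} => p = 0).
  split=> [|/eqP|p q /eqP]; first split=> [//|p q -> ->|p q ->].
  - exact: addr0.
  - exact: mulr0.
  - by rewrite oner_eq0.
  - by rewrite mulf_eq0 => /orP[]/eqP; [left|right].
have [K [h [h0 hfrac]]] := exists_residue_field prime0; exists K, h; split.
  by apply: raddf_inj => p /h0.
by move=> y; have [a [s [s0 ->]]] := hfrac y; exists a, s; split=> // /h0.
Qed.

(** The entries of w are placed one at a time.  An entry y that is
    transcendental over F is sent to a new variable over L1, after which F(y)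
    replaces F and L1(y) replaces L1. *)
Lemma exists_free_compositum (F L1 L2 : fieldType) (g1 : {rmorphism F -> L1})
    (g2 : {rmorphism F -> L2}) (w : seq L2) :
  exists (M : fieldType) (u : {rmorphism L1 -> M}) (v : {rmorphism L2 -> M}),
    (forall c, u (g1 c) = v (g2 c)) /\ (trdeg g2 w <= trdeg u (map v w))%N.
Proof.
elim/last_ind: w F L1 g1 g2 => [|w y IH] F L1 g1 g2.
  by have [M [u [v uv]]] := exists_amalgam g1 g2; exists M, u, v.
have [ay|nay] := pselect (algebraic g2 [::] y).
  have [M [u [v [uv wv]]]] := IH _ _ g1 g2; exists M, u, v; split=> //.
  rewrite -cats1 trdeg_catC trdeg_cat_algebraic; last first.
    by move=> x; rewrite inE => /eqP->; apply: algebraic_mono ay.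
  apply: leq_trans wv _; apply: trdeg_le => _ /mapP[x xw ->].
  by apply/algebraic_gen/map_f; rewrite mem_cat xw.
have [K [h [h_inj hfrac]]] := exists_rational_function_field F.
have [K1 [h1 [h1_inj h1frac]]] := exists_rational_function_field L1.
pose ev : {rmorphism {poly F} -> L2} := horner_eval y \o map_poly g2.
have evE p : ev p = (map_poly g2 p).[y] by [].
have [p|q2 q2E] := @fraction_field_lift _ K L2 h ev hfrac.
  split=> [p0|]; last by rewrite -(rmorph0 h) => /h_inj->; rewrite rmorph0.
  apply: contrapT => hp; apply: nay; exists (map_poly g2 p); split.
  - by rewrite map_poly_eq0; apply/eqP => pp; apply: hp; rewrite pp rmorph0.
  - by move=> i; rewrite coef_map; exact: subfield_const.
  - exact/eqP.
have [p|q1 q1E] := @fraction_field_lift _ K K1 h (h1 \o map_poly g1) hfrac.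
  split; last by rewrite -(rmorph0 h) => /h_inj->; rewrite !rmorph0.
  rewrite -[X in _ = X -> _](rmorph0 h1) => /h1_inj /eqP.
  by rewrite map_poly_eq0 => /eqP->; rewrite rmorph0.
have [M [u' [v [uv wv]]]] := IH _ _ q1 q2.
pose u : {rmorphism L1 -> M} := u' \o (h1 \o polyC).
have uE c : u c = u' (h1 c%:P) by [].
have vyE : v y = u' (h1 'X).
  by rewrite -[y](hornerX y) -(map_polyX g2) -evE -q2E -uv q1E /= map_polyX.
exists M, u, v; split.
  move=> c; rewrite uE -(map_polyC g1) -[h1 _]/((h1 \o map_poly g1) _) -q1E uv q2E evE.
  by rewrite map_polyC hornerC.
have nvy : ~ algebraic u [::] (v y).
  case=> p [p0 sp py].
  have coef i : exists c, u c = p`_i.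
    elim: (sp i) => [c|//|_ _ _ [c <-] _ [d <-]|_ _ _ [c <-] _ [d <-]|_ _ [c <-]].
    - by exists c.
    - by exists (c + d); rewrite rmorphD.
    - by exists (c * d); rewrite rmorphM.
    - by exists c^-1; rewrite fmorphV.
  have [e eE] := choice coef.
  pose q := \poly_(i < size p) e i.
  have qp : map_poly u q = p.
    apply/polyP => i; rewrite coef_map coef_poly.
    by case: ltnP => ip; [exact: eE | rewrite raddf0 nth_default].
  have : u' (h1 q) = 0.
    move: py; rewrite -qp vyE => /eqP.
    rewrite (map_poly_comp (u' \o h1) polyC) -[u' (h1 'X)]/((u' \o h1) 'X) horner_map /=.
    by rewrite -[(map_poly _ q).[_]]/(q \Po 'X) comp_polyXr.
  rewrite -(rmorph0 u') -(rmorph0 h1) => /fmorph_inj /h1_inj q0.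
  by case/eqP: p0; rewrite -qp q0 rmorph0.
rewrite -cats1 map_cat /=.
have wy : (trdeg g2 (w ++ [:: y]) <= trdeg q2 w + 1)%N.
  have := @trdeg_relative _ _ _ q2 g2 [::] [:: y] w; rewrite cats0 addn0 => le_w.
  apply: leq_trans (le_w _) _; last by rewrite leq_add2l trdeg_size.
  move=> Y z; rewrite cats0; apply: algebraic_trans => [c|x xY]; last first.
    by apply: algebraic_gen; rewrite mem_cat xY.
  have [a [s [s0 ->]]] := hfrac c; rewrite rmorphM fmorphV !q2E.
  have sev p : subfield g2 (Y ++ [:: y]) (ev p).
    rewrite evE horner_coef; apply: subfield_sum => i _; apply: subfield_mul.
      by rewrite coef_map; exact: subfield_const.
    by apply/subfieldX/subfield_gen; rewrite mem_cat mem_head orbT.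
  by apply: algebraic_subfield; apply: subfield_mul => //; exact: subfield_inv.
apply: leq_trans wy _.
have := @trdeg_relative _ _ _ u u' [:: v y] [::] (map v w).
rewrite cats0 addn0 /= (asboolF nvy) /= addn0 => le_w.
apply: leq_trans (le_w _); first by rewrite leq_add2r.
move=> Y z; rewrite cats0; apply: algebraic_trans => [c|x].
  by rewrite uE; exact: algebraic_const.
rewrite mem_cat inE => /orP[xY|/eqP->]; first exact: algebraic_gen.
by rewrite vyE; exact: algebraic_const.
Qed.

(** * Zariski closures as subalgebras of k{G} *)

Lemma shom_iter (k : fieldType) (sigma : {rmorphism k -> k}) (R S : salgebra sigma)
    (f : shom R S) j x :
  f (iter j (salg_sigma R) x) = iter j (salg_sigma S) (f x).
Proof. by elim: j => [//|j IH]; rewrite !iterS shom_sigma IH. Qed.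

Lemma semihom_subalg (k : fieldType) (tau : k -> k) (R S : algebra k)
    (f : semihom tau R S) (X : seq R) x :
  subalg (alg_in R) X x -> subalg (alg_in S) (map f X) (f x).
Proof.
elim=> [c|y Xy|y z _ sy _ sz|y z _ sy _ sz].
- by rewrite semihom_in; exact: subalg_const.
- exact/subalg_gen/map_f.
- by rewrite rmorphD; exact: subalg_add.
- by rewrite rmorphM; exact: subalg_mul.
Qed.

Section Levels.
Variables (k : fieldType) (sigma : {rmorphism k -> k}) (A : algebra k) (s : seq A).
Hypothesis gen_s : generates (fun a : A => a \in s).
Variables (S : salgebra sigma) (phi : shom (prol_salg sigma A) S).

Definition coord_iter (j : nat) (a : A) : S :=
  iter j (salg_sigma S) (phi (prol_emb sigma A a)).

Definition level (j : nat) : seq S := [seq coord_iter j a | a <- s].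

Fixpoint levels (i : nat) : seq S :=
  if i is i'.+1 then level i' ++ levels i' else [::].

Lemma levels_mono i j : (i <= j)%N -> {subset levels i <= levels j}.
Proof.
move/subnKC <-; elim: (j - i)%N => [|n IH] b bi; first by rewrite addn0.
by rewrite addnS /= mem_cat IH ?orbT.
Qed.

Lemma mem_levels i b : b \in levels i -> exists j a, [/\ (j < i)%N, a \in s & b = coord_iter j a].
Proof.
elim: i => // i IH; rewrite /= mem_cat => /orP[/mapP[a sa ->]|/IH [j [a [ji sa ->]]]].
  by exists i, a.
by exists j, a; rewrite ltnW.
Qed.

Lemma salg_sigma_in (R : salgebra sigma) j c :
  iter j (salg_sigma R) (alg_in R c) = alg_in R (sigma_pow sigma j c).
Proof.
elim: j => [//|j IH]; rewrite iterS IH; exact: (semihom_in (salg_sigma R)).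
Qed.

Lemma coord_iter_in j c : coord_iter j (alg_in A c) = alg_in S (sigma_pow sigma j c).
Proof.
rewrite /coord_iter (semihom_in (prol_emb sigma A)) (semihom_in phi).
exact: salg_sigma_in.
Qed.

Lemma coord_iterD j a b : coord_iter j (a + b) = coord_iter j a + coord_iter j b.
Proof.
by rewrite /coord_iter !rmorphD; elim: j => //= j ->; rewrite rmorphD.
Qed.
Lemma coord_iterM j a b : coord_iter j (a * b) = coord_iter j a * coord_iter j b.
Proof.
by rewrite /coord_iter !rmorphM; elim: j => //= j ->; rewrite rmorphM.
Qed.

Lemma level_subalg j a : subalg (alg_in S) (level j) (coord_iter j a).
Proof.
apply: (gen_s (S := fun a => subalg (alg_in S) (level j) (coord_iter j a))).
  split=> [c|x y|x y].
  - by rewrite coord_iter_in; exact: subalg_const.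
  - by rewrite coord_iterD; exact: subalg_add.
  - by rewrite coord_iterM; exact: subalg_mul.
by move=> b bs; apply/subalg_gen/map_f.
Qed.

Lemma sigma_levels i b : subalg (alg_in S) (levels i) b ->
  subalg (alg_in S) (levels i.+1) (salg_sigma S b).
Proof.
elim=> [c|x /mem_levels[j [a [ji sa ->]]]|x y _ sx _ sy|x y _ sx _ sy].
- by rewrite (semihom_in (salg_sigma S)); exact: subalg_const.
- apply: (subalg_mono (levels_mono (ltn_ord (Ordinal (ji : (j.+1 < i.+1)%N))))).
  rewrite -iterS; apply: subalg_gen => /=; rewrite mem_cat.
  by apply/orP; left; exact: (map_f (coord_iter j.+1)).
- by rewrite rmorphD; exact: subalg_add.
- by rewrite rmorphM; exact: subalg_mul.
Qed.

Lemma levels_exhaust b : (exists x, phi x = b) -> exists i, subalg (alg_in S) (levels i) b.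
Proof.
case=> x <-; move: x.
have up i j c : subalg (alg_in S) (levels i) c -> subalg (alg_in S) (levels (maxn i j)) c.
  by apply/subalg_mono/levels_mono/leq_maxl.
apply: (prol_generated gen_s) => [|x [j [a [sa ->]]]].
  split=> [c|x y [i ix] [j jy]|x y [i ix] [j jy]].
  - by exists 0; rewrite (semihom_in phi); exact: subalg_const.
  - exists (maxn i j); rewrite rmorphD; apply: subalg_add; first exact: up.
    by rewrite maxnC; exact: up.
  - exists (maxn i j); rewrite rmorphM; apply: subalg_mul; first exact: up.
    by rewrite maxnC; exact: up.
exists j.+1; apply: subalg_gen; rewrite mem_cat.
have -> : phi (iter j (salg_sigma (prol_salg sigma A)) (prol_emb sigma A a)) = coord_iter j a.
  exact: shom_iter.
by rewrite map_f.
Qed.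

(** Ordered so that [prol_gens_levels] is an equality of lists. *)
Fixpoint prol_gens (i : nat) : seq (prol sigma A i) :=
  if i is i'.+1 then
    [seq prol_last sigma A i' (@bc_pure k sigma A i'.+1 a 1) | a <- s]
      ++ map (prol_incl sigma A i') (prol_gens i')
  else [seq @bc_pure k sigma A 0 a 1 | a <- s].

Lemma base_change_subalg j (R : algebra k) (X : seq R) (h : khom (base_change sigma A j) R) y :
  (forall a, a \in s -> subalg (alg_in R) X (h (@bc_pure k sigma A j a 1))) ->
  subalg (alg_in R) X (h y).
Proof.
move=> sX; elim/tensor_ind: y => [|x y sx sy|a c].
- by rewrite rmorph0; exact: subalg0.
- by rewrite rmorphD; exact: subalg_add.
rewrite -/(@bc_pure k sigma A j a c) bc_pureE rmorphM semihom_in.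
apply: subalg_mul; last exact: subalg_const.
apply: (gen_s (S := fun a => subalg (alg_in R) X (h (@bc_pure k sigma A j a 1)))) => //.
have tl b : @bc_pure k sigma A j b 1 = tinl (alg_in A) (sigma_pow sigma j) b by [].
split=> [c'|x y|x y].
- by rewrite tl tinlr (semihom_in h); exact: subalg_const.
- by rewrite !tl !rmorphD; exact: subalg_add.
- by rewrite !tl !rmorphM; exact: subalg_mul.
Qed.

Definition prol_incl_hom i : khom (prol sigma A i) (prol sigma A i.+1) :=
  @SemiHom _ _ (prol sigma A i) (prol sigma A i.+1) (prol_incl sigma A i) (fun=> erefl).
Definition prol_last_hom i : khom (base_change sigma A i.+1) (prol sigma A i.+1) :=
  @SemiHom _ _ (base_change sigma A i.+1) (prol sigma A i.+1) (prol_last sigma A i)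
    (prol_last_in sigma A i).

Lemma prol_gens_subalg i x : subalg (alg_in (prol sigma A i)) (prol_gens i) x.
Proof.
elim: i x => [|i IH] x.
  pose h : khom (base_change sigma A 0) (prol sigma A 0) :=
    @SemiHom _ _ (base_change sigma A 0) (prol sigma A 0) idfun (fun=> erefl).
  rewrite -[x]/(h x); apply: base_change_subalg => a sa.
  by apply/subalg_gen/map_f.
elim/tensor_ind: x => [|x y sx sy|x y]; [exact: subalg0|exact: subalg_add|].
rewrite tpureE; apply: subalg_mul.
  rewrite -[tinl _ _ x]/(prol_incl_hom i x).
  apply: subalg_mono (semihom_subalg (prol_incl_hom i) (IH x)) => b bi.
  by rewrite mem_cat bi orbT.
rewrite -[tinr _ _ y]/(prol_last_hom i y); apply: base_change_subalg => a sa.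
apply: subalg_gen; rewrite mem_cat; apply/orP; left.
exact: (map_f (fun a => prol_last sigma A i (@bc_pure k sigma A i.+1 a 1))).
Qed.

Lemma prol_gens_levels i :
  map (fun x => phi (prol_in sigma A i x)) (prol_gens i) = levels i.+1.
Proof.
elim: i => [|i IH].
  rewrite /= cats0 -map_comp; apply: eq_map => a /=.
  by rewrite -prol_emb_iter0 rmorph1 mulr1.
rewrite /= map_cat -!map_comp; congr (_ ++ _).
  apply: eq_map => a /=; rewrite -prol_emb_iter1.
  exact: (shom_iter phi i.+1).
by rewrite -[RHS]/(levels i.+1) -IH; apply: eq_map => x /=; rewrite prol_in_incl.
Qed.
End Levels.

(** Although a point of B need not extend to S, it is a specialization of the
    restriction of a point of S. *)
Lemma max_trdeg_sub (k : fieldType) (B S : algebra k) (j : khom B S) (w : seq B) m :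
  injective j -> max_trdeg w m <-> max_trdeg (map j w) m.
Proof.
move=> j_inj.
have restr (L : fieldType) (y : {rmorphism S -> L}) :
    point_trdeg y (map j w) = point_trdeg (y \o j) w.
  rewrite /point_trdeg -map_comp; congr trdeg; apply: rmorphism_ext => c.
  by rewrite /= semihom_in.
have above (L : fieldType) (x : {rmorphism B -> L}) :
    exists (M : fieldType) (y : {rmorphism S -> M}),
      (point_trdeg x w <= point_trdeg y (map j w))%N.
  have [M [y yx]] := exists_point_above x j_inj; exists M, y.
  by rewrite restr; apply: point_trdeg_specialization.
split=> -[[L [x <-]] max_x]; split.
- have [M [y xy]] := above _ x; exists M, y.
  by apply/eqP; rewrite eqn_leq xy restr max_x.
- by move=> M y; rewrite restr.
- by exists L, (x \o j); rewrite -restr.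
- by move=> M y; have [N [z yz]] := above _ y; exact: leq_trans (max_x _ z).
Qed.

(** The coordinate ring of the closure is the image of k[GG[i]] in S, so its
    dimension is computed by points of S. *)
Lemma krull_dim_closure (k : fieldType) (sigma : {rmorphism k -> k}) (GG : alggroup k)
    (s : seq (coord GG)) (S : salgebra sigma) (phi : shom (prol_salg sigma (coord GG)) S)
    (H : sclosed_subgroup (sgroup_of sigma GG)) i m :
  generates (fun a : coord GG => a \in s) -> (forall x, H x <-> phi x = 0) ->
  krull_dim (closure_coord H i) m <-> max_trdeg (levels s phi i.+1) m.
Proof.
move=> gen_s Hphi.
pose idJ := closure_is_ideal H i.
pose B : algebra k := @Algebra k (closure_coord H i)
  (ideal_pi idJ \o alg_in (prol sigma (coord GG) i)).
pose q : khom (prol sigma (coord GG) i) B :=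
  @SemiHom _ _ (prol sigma (coord GG) i) B (ideal_pi idJ) (fun=> erefl).
pose phi_i : {rmorphism prol sigma (coord GG) i -> S} := phi \o prol_in sigma (coord GG) i.
have phi0 x : closure_ideal (i:=i) H x -> phi_i x = 0 by move/Hphi.
pose j0 := ideal_lift idJ phi0.
have j0E x : j0 (q x) = phi (prol_in sigma (coord GG) i x).
  exact: (ideal_liftE idJ phi0).
have j0_in c : j0 (alg_in B c) = alg_in S c.
  rewrite [LHS](j0E (alg_in _ c)) prol_in_in; exact: (semihom_in phi).
pose j : khom B S := @SemiHom _ _ B S j0 j0_in.
have j_inj : injective j.
  apply: raddf_inj => y; have [x <-] := ideal_pi_surj y => j0x.
  by apply/ideal_pi_eq0/Hphi; rewrite -j0E.
have gen_B b : subalg (alg_in B) (map q (prol_gens sigma s i)) b.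
  have [x <-] := ideal_pi_surj b.
  exact: (semihom_subalg q (prol_gens_subalg gen_s x)).
rewrite (krull_dim_max_trdeg gen_B) (max_trdeg_sub _ _ j_inj) -prol_gens_levels -map_comp.
by rewrite (eq_map (g := fun x => phi (prol_in sigma (coord GG) i x)) j0E).
Qed.

(** * The group law on points with values in algebras without sigma *)

Section Sequences.
Variable R : comPzRingType.

Definition sequences : Type := nat -> R.
HB.instance Definition _ := gen_eqMixin sequences.
HB.instance Definition _ := gen_choiceMixin sequences.

Let sadd (u v : sequences) : sequences := fun j => u j + v j.
Let sopp (u : sequences) : sequences := fun j => - u j.
Let smul (u v : sequences) : sequences := fun j => u j * v j.
Let szero : sequences := fun=> 0.
Let sone : sequences := fun=> 1.

Fact sequences_addA : associative sadd.
Proof. by move=> u v w; apply/funext => j; exact: addrA. Qed.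
Fact sequences_addC : commutative sadd.
Proof. by move=> u v; apply/funext => j; exact: addrC. Qed.
Fact sequences_add0 : left_id szero sadd.
Proof. by move=> u; apply/funext => j; exact: add0r. Qed.
Fact sequences_addN : left_inverse szero sopp sadd.
Proof. by move=> u; apply/funext => j; exact: addNr. Qed.
Fact sequences_mulA : associative smul.
Proof. by move=> u v w; apply/funext => j; exact: mulrA. Qed.
Fact sequences_mulC : commutative smul.
Proof. by move=> u v; apply/funext => j; exact: mulrC. Qed.
Fact sequences_mul1 : left_id sone smul.
Proof. by move=> u; apply/funext => j; exact: mul1r. Qed.
Fact sequences_mulDl : left_distributive smul sadd.
Proof. by move=> u v w; apply/funext => j; exact: mulrDl. Qed.

HB.instance Definition _ := GRing.isZmodule.Build sequences
  sequences_addA sequences_addC sequences_add0 sequences_addN.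
HB.instance Definition _ := GRing.Zmodule_isComPzRing.Build sequences
  sequences_mulA sequences_mulC sequences_mul1 sequences_mulDl.

Definition seq_entry (j : nat) (u : sequences) : R := u j.
Fact seq_entry_is_zmod_morphism j : zmod_morphism (seq_entry j). Proof. by []. Qed.
Fact seq_entry_is_monoid_morphism j : monoid_morphism (seq_entry j). Proof. by []. Qed.
HB.instance Definition _ j :=
  GRing.isZmodMorphism.Build _ _ (seq_entry j) (@seq_entry_is_zmod_morphism j).
HB.instance Definition _ j :=
  GRing.isMonoidMorphism.Build _ _ (seq_entry j) (@seq_entry_is_monoid_morphism j).

Definition seq_shift (u : sequences) : sequences := fun j => u j.+1.
Fact seq_shift_is_zmod_morphism : zmod_morphism seq_shift. Proof. by []. Qed.
Fact seq_shift_is_monoid_morphism : monoid_morphism seq_shift. Proof. by []. Qed.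
HB.instance Definition _ :=
  GRing.isZmodMorphism.Build _ _ seq_shift seq_shift_is_zmod_morphism.
HB.instance Definition _ :=
  GRing.isMonoidMorphism.Build _ _ seq_shift seq_shift_is_monoid_morphism.

Section SeqOf.
Variables (T : comPzRingType) (f : nat -> {rmorphism T -> R}).
Definition seq_of (x : T) : sequences := fun j => f j x.
Fact seq_of_is_zmod_morphism : zmod_morphism seq_of.
Proof. by move=> x y; apply/funext => j; exact: rmorphB. Qed.
Fact seq_of_is_monoid_morphism : monoid_morphism seq_of.
Proof.
by split=> [|x y]; apply/funext => j; [exact: rmorph1|exact: rmorphM].
Qed.
HB.instance Definition _ :=
  GRing.isZmodMorphism.Build _ _ seq_of seq_of_is_zmod_morphism.
HB.instance Definition _ :=
  GRing.isMonoidMorphism.Build _ _ seq_of seq_of_is_monoid_morphism.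
End SeqOf.
End Sequences.

Section Cofree.
Variables (k : fieldType) (sigma : {rmorphism k -> k}).

Lemma sigma_powSr j c : sigma_pow sigma j.+1 c = sigma_pow sigma j (sigma c).
Proof. by elim: j => [//|j /= ->]. Qed.

(** R as a k-algebra through sigma^j. *)
Definition twist (R : algebra k) (j : nat) : algebra k :=
  @Algebra k R (alg_in R \o sigma_pow sigma j).

(** On k-algebras, this is the right adjoint of the functor that forgets sigma;
    the entry j of a sequence is read in [twist R j]. *)
Definition cofree_alg (R : algebra k) : algebra k :=
  @Algebra k (sequences R) (seq_of (fun j => alg_in (twist R j))).

Fact cofree_sigma_in (R : algebra k) c :
  @seq_shift R (alg_in (cofree_alg R) c) = alg_in (cofree_alg R) (sigma c).
Proof. by apply/funext => j; congr (alg_in R _); exact: sigma_powSr. Qed.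

Definition cofree (R : algebra k) : salgebra sigma :=
  @SAlgebra _ _ (cofree_alg R) (@SemiHom _ _ (cofree_alg R) (cofree_alg R)
    (@seq_shift R) (@cofree_sigma_in R)).

Definition cofree_entry (R : algebra k) (j : nat) : khom (cofree R) (twist R j) :=
  @SemiHom _ _ (cofree R) (twist R j) (@seq_entry R j) (fun=> erefl).

Lemma cofree_sigma_iter (R : algebra k) j (u : cofree R) i :
  iter j (salg_sigma (cofree R)) u i = u (j + i)%N.
Proof.
elim: j i => [//|j IH] i; rewrite iterS -[LHS]/(iter j (salg_sigma (cofree R)) u i.+1) IH.
by rewrite addnS.
Qed.

Section Transpose.
Variables (S : salgebra sigma) (R : algebra k) (x : khom S R).

Fixpoint salg_iter (j : nat) : {rmorphism S -> S} :=
  if j is j'.+1 then salg_sigma S \o salg_iter j' else idfun.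

Lemma salg_iterE j b : salg_iter j b = iter j (salg_sigma S) b.
Proof. by elim: j => //= j ->. Qed.

Definition transpose_fun : {rmorphism S -> sequences R} :=
  seq_of (fun j => x \o salg_iter j).

Lemma transpose_funE b j : transpose_fun b j = x (iter j (salg_sigma S) b).
Proof. exact (congr1 (fun c => x c) (salg_iterE j b)). Qed.

Fact transpose_in c : transpose_fun (alg_in S c) = alg_in (cofree R) c.
Proof.
by apply/funext => j; rewrite transpose_funE salg_sigma_in semihom_in.
Qed.

Fact transpose_sigma b :
  transpose_fun (salg_sigma S b) = salg_sigma (cofree R) (transpose_fun b).
Proof.
apply/funext => j; rewrite -[RHS]/(transpose_fun b j.+1) !transpose_funE.
by rewrite iterSr.
Qed.

Definition transpose : shom S (cofree R) :=
  @SHom _ _ S (cofree R) (@SemiHom _ _ S (cofree R) transpose_fun transpose_in)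
    transpose_sigma.

Lemma transposeE b j : transpose b j = x (iter j (salg_sigma S) b).
Proof. exact: transpose_funE. Qed.
End Transpose.
End Cofree.

Section GroupOn.
Variables (T : Type) (g : group_on T).

Lemma group_on_mulrV z : gmul g z (ginv g z) = gone g.
Proof.
rewrite -[LHS](gmul1 g) -[X in gmul g X _](gmulV g (ginv g z)) -gmulA.
by rewrite [X in gmul g _ X]gmulA gmulV gmul1 gmulV.
Qed.
Lemma group_on_mulr1 z : gmul g z (gone g) = z.
Proof. by rewrite -(gmulV g z) gmulA group_on_mulrV gmul1. Qed.
Lemma group_on_mulKV x y : gmul g x (gmul g (ginv g x) y) = y.
Proof. by rewrite gmulA group_on_mulrV gmul1. Qed.
Lemma group_on_mulVK x y : gmul g (ginv g x) (gmul g x y) = y.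
Proof. by rewrite gmulA gmulV gmul1. Qed.
End GroupOn.

Section AlgebraicGroup.
Variables (k : fieldType) (GG : alggroup k).

Lemma points_one (R R' : algebra k) (h : khom R R') :
  khom_comp h (gone (points GG R)) = gone (points GG R').
Proof. by apply: group_on_mulI; rewrite -points_functorial gmul1. Qed.

Lemma points_inv (R R' : algebra k) (h : khom R R') (x : khom (coord GG) R) :
  khom_comp h (ginv (points GG R) x) = ginv (points GG R') (khom_comp h x).
Proof. by apply: group_on_invE; rewrite -points_functorial gmulV points_one. Qed.

(** The values of x y are sums of products of values of x and of y, because x y
    is induced by the product of the two universal points, which has values in
    the tensor product of the coordinate ring with itself. *)
Lemma points_mul_ind (R : algebra k) (x y : khom (coord GG) R) (U : R -> Prop) :
  U 0 -> (forall u v, U u -> U v -> U (u + v)) -> (forall a b, U (x a * y b)) ->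
  forall a, U (gmul (points GG R) x y a).
Proof.
move=> U0 UD Uxy a; pose A := coord GG.
have xy c : x (alg_in A c) = y (alg_in A c) by rewrite !semihom_in.
have hin c : tensor_lift xy (alg_in (alg_tensor A A) c) = alg_in R c.
  by rewrite [LHS]tensor_liftl semihom_in.
pose h : khom (alg_tensor A A) R := @SemiHom _ _ (alg_tensor A A) R (tensor_lift xy) hin.
pose i1 : khom A (alg_tensor A A) :=
  @SemiHom _ _ A (alg_tensor A A) (tinl (alg_in A) (alg_in A)) (fun=> erefl).
pose i2 : khom A (alg_tensor A A) :=
  @SemiHom _ _ A (alg_tensor A A) (tinr (alg_in A) (alg_in A))
    (fun c => esym (tinlr (alg_in A) (alg_in A) c)).
have xE : x = khom_comp h i1 by apply: semihom_ext => b; rewrite [RHS]tensor_liftl.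
have yE : y = khom_comp h i2 by apply: semihom_ext => b; rewrite [RHS]tensor_liftr.
rewrite [in gmul _ x y]xE [in gmul _ _ y]yE -points_functorial.
suff Uh (t : alg_tensor A A) : U (h t) by exact: Uh.
elim/tensor_ind: t => [|u v Uu Uv|b c].
- by rewrite rmorph0.
- by rewrite rmorphD; exact: UD.
- by rewrite [h _]tensor_lift_pure.
Qed.

Lemma points_inv_image (R : algebra k) (x : khom (coord GG) R) a :
  exists b, ginv (points GG R) x a = x b.
Proof.
pose A := coord GG.
pose id_A : khom A A := @SemiHom _ _ A A idfun (fun=> erefl).
exists (ginv (points GG A) id_A a).
have {1}-> : x = khom_comp x id_A by exact: semihom_ext.
by rewrite -points_inv.
Qed.
End AlgebraicGroup.

Section GroupOfPoints.
Variables (k : fieldType) (sigma : {rmorphism k -> k}) (GG : alggroup k).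
Variable G : sclosed_subgroup (sgroup_of sigma GG).

Let A := coord GG.
Let S : salgebra sigma := sub_salg G.
Let phi : shom (prol_salg sigma A) S := sub_pi G.

(** The point x_j: a |-> x (sigma^j a) of the ambient group. *)
Definition component (R : algebra k) (j : nat) (x : khom S R) : khom A (twist sigma R j) :=
  khom_comp (cofree_entry sigma R j)
    (khom_comp (shom_comp (transpose x) phi) (prol_emb sigma A)).

Lemma componentE R j (x : khom S R) a : component j x a = x (coord_iter phi j a).
Proof. exact: (transposeE x). Qed.

Definition untranspose (R : algebra k) (X : shom S (cofree sigma R)) : khom S R :=
  khom_comp (@SemiHom _ _ (cofree sigma R) R (@seq_entry R 0) (fun=> erefl)) X.

Lemma untransposeK R (X : shom S (cofree sigma R)) : transpose (untranspose X) = X.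
Proof.
apply: shom_ext => b; apply/funext => j; rewrite transposeE.
rewrite -[LHS]/(X (iter j (salg_sigma S) b) 0%N) (shom_iter X).
by rewrite cofree_sigma_iter addn0.
Qed.

Lemma component_mul R (X Y : shom S (cofree sigma R)) j :
  component j (untranspose (gmul (sub_points G (cofree sigma R)) X Y)) =
  gmul (points GG (twist sigma R j)) (component j (untranspose X)) (component j (untranspose Y)).
Proof.
rewrite /component !untransposeK -points_functorial; congr (khom_comp _ _).
refine (etrans (congr1 (fun u : shom (prol_salg sigma A) _ =>
  khom_comp u (prol_emb sigma A)) (sub_pointsM X Y)) _).
exact: sgroup_of_pointsM.
Qed.

Lemma component_one R j :
  component j (untranspose (gone (sub_points G (cofree sigma R)))) =
  gone (points GG (twist sigma R j)).
Proof. by apply: group_on_mulI; rewrite -component_mul gmul1. Qed.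

Lemma component_inv R (X : shom S (cofree sigma R)) j :
  component j (untranspose (ginv (sub_points G (cofree sigma R)) X)) =
  ginv (points GG (twist sigma R j)) (component j (untranspose X)).
Proof. by apply: group_on_invE; rewrite -component_mul gmulV component_one. Qed.

Lemma transposeK R (x : khom S R) : untranspose (transpose x) = x.
Proof. by apply: semihom_ext => b; exact: (transposeE x b 0). Qed.

Lemma exists_product R (x y : khom S R) : exists z : khom S R, forall j,
  component j z = gmul (points GG (twist sigma R j)) (component j x) (component j y).
Proof.
exists (untranspose (gmul (sub_points G (cofree sigma R)) (transpose x) (transpose y))).
by move=> j; rewrite component_mul !transposeK.
Qed.

Lemma exists_quotient R (x y : khom S R) : exists z : khom S R, forall j,
  component j y = gmul (points GG (twist sigma R j)) (component j x) (component j z).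
Proof.
exists (untranspose (gmul (sub_points G (cofree sigma R))
  (ginv (sub_points G (cofree sigma R)) (transpose x)) (transpose y))) => j.
by rewrite component_mul component_inv !transposeK group_on_mulKV.
Qed.

(** The kernel of the projection from G to G[i-1]. *)
Definition trivial_below (R : algebra k) (i : nat) (z : khom S R) : Prop :=
  forall j, (j < i)%N -> component j z = gone (points GG (twist sigma R j)).

(** Used for extensions of the base field, with j = j', and for the composition
    of a point with sigma, with j' = j + 1. *)
Lemma trivial_below_map (R R' : algebra k) (h : {rmorphism R -> R'}) j j'
    (z : khom S R) (z' : khom S R') :
  (forall c, h (alg_in R (sigma_pow sigma j' c)) = alg_in R' (sigma_pow sigma j c)) ->
  (forall a, z' (coord_iter phi j a) = h (z (coord_iter phi j' a))) ->
  component j' z = gone (points GG (twist sigma R j')) ->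
  component j z' = gone (points GG (twist sigma R' j)).
Proof.
move=> h_in hz z1.
pose H : khom (twist sigma R j') (twist sigma R' j) :=
  @SemiHom _ _ (twist sigma R j') (twist sigma R' j) h h_in.
rewrite -(points_one GG H) -z1; apply: semihom_ext => a.
by rewrite componentE hz -componentE.
Qed.

Section Algebraic.
Variables (s : seq A) (gen_s : generates (fun a : A => a \in s)).
Variables (M : fieldType) (f : {rmorphism k -> M}).
Let R := @Algebra k M f.
Variables (x y z : khom S R) (i : nat).
Hypothesis zxy : component i z =
  gmul (points GG (twist sigma R i)) (component i x) (component i y).

Let alg_level (t : khom S R) X a :
  (forall b, b \in level s phi i -> t b \in X) -> algebraic f X (component i t a).
Proof.
move=> tX; rewrite componentE.
have := semihom_subalg t (level_subalg gen_s phi i a) => /algebraic_subalg.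
by apply: algebraic_mono => _ /mapP[b bi ->]; exact: tX.
Qed.

Lemma algebraic_product b : b \in level s phi i ->
  algebraic f (map x (level s phi i) ++ map y (level s phi i)) (z b).
Proof.
move=> /mapP[a _ ->]; rewrite -componentE zxy; set X := _ ++ _.
apply: (@points_mul_ind _ _ (twist sigma R i) _ _ (algebraic f X)) => [|u v|b' c].
- by rewrite -(rmorph0 f); exact: algebraic_const.
- exact: algebraicD.
- by apply: algebraicM; apply: alg_level => d di; rewrite mem_cat map_f ?orbT.
Qed.

Lemma algebraic_quotient b : b \in level s phi i ->
  algebraic f (map x (level s phi i) ++ map z (level s phi i)) (y b).
Proof.
move=> /mapP[a _ ->]; rewrite -componentE.
rewrite -(group_on_mulVK (points GG _) (component i x) (component i y)) -zxy.
set X := _ ++ _; apply: (@points_mul_ind _ _ (twist sigma R i) _ _ (algebraic f X)) => [|u v|b' c].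
- by rewrite -(rmorph0 f); exact: algebraic_const.
- exact: algebraicD.
- have [d ->] := points_inv_image (component i x) b'.
  by apply: algebraicM; apply: alg_level => e ei; rewrite mem_cat map_f ?orbT.
Qed.
End Algebraic.
End GroupOfPoints.

(** * Growth of the dimensions *)

Section Growth.
Variables (k : fieldType) (sigma : {rmorphism k -> k}) (GG : alggroup k).
Variable G : sclosed_subgroup (sgroup_of sigma GG).
Let A := coord GG.
Let S : salgebra sigma := sub_salg G.
Let phi : shom (prol_salg sigma A) S := sub_pi G.
Variables (s : seq A) (gen_s : generates (fun a : A => a \in s)).
Let w := level s phi.
Let lev := levels s phi.

(** n is the dimension of the kernel of the projection from G[i] to G[i-1]. *)
Definition fiber_trdeg_spec (i n : nat) : Prop :=
  (exists (L : fieldType) (f : {rmorphism k -> L}) (z : khom S (Algebra f)),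
     trivial_below i z /\ trdeg f (map z (w i)) = n) /\
  (forall (L : fieldType) (f : {rmorphism k -> L}) (z : khom S (Algebra f)),
     trivial_below i z -> (trdeg f (map z (w i)) <= n)%N).

Lemma exists_trivial_point :
  exists (L : fieldType) (f : {rmorphism k -> L}) (z : khom S (Algebra f)),
    forall i, trivial_below i z.
Proof.
exists k, idfun.
exists (untranspose (gone (sub_points G (cofree sigma (@Algebra k k idfun))))).
by move=> i j _; exact: component_one.
Qed.

Lemma fiber_trdeg_exists i : exists n, fiber_trdeg_spec i n.
Proof.
pose Q n := `[< exists (L : fieldType) (f : {rmorphism k -> L}) (z : khom S (Algebra f)),
     trivial_below i z /\ trdeg f (map z (w i)) = n >].
have exQ : exists n, Q n.
  have [L [f [z tz]]] := exists_trivial_point.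
  by exists (trdeg f (map z (w i))); apply/asboolP; exists L, f, z; split.
have ubQ n : Q n -> (n <= size (w i))%N.
  by move=> /asboolP[M [f [y [_ <-]]]]; rewrite -(size_map y) trdeg_size.
case: (ex_maxnP exQ ubQ) => m /asboolP Qm le_m; exists m; split=> // M f y ty.
by apply: le_m; apply/asboolP; exists M, f, y.
Qed.

Lemma levels_trdeg_exists i : exists m, max_trdeg (lev i) m.
Proof.
have [L [f [z _]]] := exists_trivial_point.
exact: (@max_trdeg_exists _ _ (lev i) L z).
Qed.

Lemma khom_point (L : fieldType) (f : {rmorphism k -> L}) (z : khom S (Algebra f)) v :
  @point_trdeg k S L z v = trdeg f (map z v).
Proof. by congr trdeg; apply: rmorphism_ext => c; exact: (semihom_in z). Qed.

(** A generic point x of S_i, moved by an independent point z of the kernel,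
    stays generic on S_i and gains the transcendence degree of z. *)
Lemma trdeg_step_ge i m0 m1 n : max_trdeg (lev i) m0 -> max_trdeg (lev i.+1) m1 ->
  fiber_trdeg_spec i n -> (m0 + n <= m1)%N.
Proof.
move=> [[L1 [x <-]] _] [_ le_m1] [[L2 [f2 [z0 [tz0 <-]]]] _].
pose f1 := point_base x.
have [M [u [v [uv zw]]]] := exists_free_compositum f1 f2 (map z0 (w i)).
pose fM : {rmorphism k -> M} := u \o f1.
pose X : khom S (Algebra fM) := @SemiHom _ _ S (Algebra fM) (u \o x) (fun=> erefl).
have Zin c : (v \o z0) (alg_in S c) = fM c.
  by rewrite -[LHS]/(v (z0 _)) (semihom_in z0) -[LHS]/(v (f2 c)) -uv.
pose Z : khom S (Algebra fM) := @SemiHom _ _ S (Algebra fM) (v \o z0) Zin.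
have tZ : trivial_below i Z.
  move=> j ji.
  apply: (@trivial_below_map _ _ _ G (Algebra f2) (Algebra fM) v j j z0 Z) (tz0 j ji) => // c.
  by rewrite -[LHS]/(v (f2 _)) -uv.
have [y yE] := exists_product X Z.
have yX b : b \in lev i -> y b = X b.
  move=> /mem_levels[j [a [ji _ ->]]].
  by rewrite -!componentE yE tZ // group_on_mulr1.
have := le_m1 M y; rewrite khom_point; apply: leq_trans.
have lev_y : map y (lev i) = map X (lev i) by apply/eq_in_map => b /yX.
rewrite /lev /= map_cat -/(lev i) -/(w i) lev_y.
have := @trdeg_relative _ _ _ fM u (map X (lev i)) [::] (map y (w i)).
rewrite cats0 addn0 => le_y; apply: leq_trans (le_y _); last first.
  move=> Y t; rewrite cats0; apply: algebraic_trans => [c|b]; first exact: algebraic_const.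
  rewrite mem_cat => /orP[bY|/mapP[a _ ->]]; first exact: algebraic_gen.
  exact: (algebraic_const u _ (x a)).
rewrite addnC leq_add //; last first.
  by rewrite -khom_point -[point_trdeg x _](point_trdeg_ext x u).
apply: leq_trans zw _; apply: trdeg_le => _ /mapP[_ /mapP[b bw ->] ->].
have := algebraic_quotient gen_s (yE i) bw.
apply: algebraic_trans => [c|t]; first exact: (algebraic_const u _ (f1 c)).
rewrite mem_cat => /orP[/mapP[a _ ->]|]; last exact: algebraic_gen.
exact: (algebraic_const u _ (x a)).
Qed.

(** Two independent copies of a generic point of S_(i+1) that agree on S_i differ
    by a point of the kernel. *)
Lemma trdeg_step_le i m0 m1 n : max_trdeg (lev i) m0 -> max_trdeg (lev i.+1) m1 ->
  fiber_trdeg_spec i n -> (m1 <= m0 + n)%N.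
Proof.
move=> [_ le_m0] [[L [x <-]] _] [_ le_n].
pose f := point_base x; pose q := map x (lev i).
pose g : {rmorphism subfield_type f q -> L} := \val.
have [M [u [v [uv xw]]]] := exists_free_compositum g g (map x (w i)).
have uvE c : subfield f q c -> u c = v c.
  by move=> /asboolP sc; exact: (uv (SubfieldElt sc)).
pose fM : {rmorphism k -> M} := u \o f.
pose X : khom S (Algebra fM) := @SemiHom _ _ S (Algebra fM) (u \o x) (fun=> erefl).
have Yin c : (v \o x) (alg_in S c) = fM c.
  by rewrite /fM /= uvE //; exact: (subfield_const f).
pose Y : khom S (Algebra fM) := @SemiHom _ _ S (Algebra fM) (v \o x) Yin.
have XY j : (j < i)%N -> component j X = component j Y.
  move=> ji; apply: semihom_ext => a; rewrite !componentE.
  apply: uvE; have sa : subalg (alg_in S) (lev i) (coord_iter phi j a).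
    apply: subalg_mono (level_subalg gen_s phi j a) => b bj.
    by apply: (levels_mono ji); rewrite mem_cat bj.
  elim: (point_subalg x sa) => *; [exact: subfield_const|exact: subfield_gen|
    exact: subfield_add|exact: subfield_mul].
have [z zE] := exists_quotient X Y.
have tz : trivial_below i z.
  move=> j ji; rewrite -(group_on_mulVK (points GG (twist sigma (Algebra fM) j))
    (component j X) (component j z)) -zE -XY //.
  exact: gmulV.
have := @trdeg_relative _ _ _ g f [::] q (map x (w i)).
rewrite cats0 addn0 => le_x.
rewrite /point_trdeg /lev /= map_cat -/(lev i) -/(w i) -/q -/f.
apply: leq_trans (le_x _) _.
  move=> W t; rewrite cats0; apply: algebraic_trans => [c|b bW]; last first.
    by apply: algebraic_gen; rewrite mem_cat bW.
  apply: algebraic_subfield; have /asboolP := subfield_valP c.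
  by apply: subfield_mono => b bq; rewrite mem_cat bq orbT.
rewrite addnC leq_add //; first exact: (le_m0 L x).
apply: leq_trans xw _; apply: leq_trans (le_n M fM z tz).
apply: (@leq_trans (trdeg u (map z (w i)))).
  apply: trdeg_le => _ /mapP[_ /mapP[b bw ->] ->].
  have := algebraic_product gen_s (zE i) bw.
  apply: algebraic_trans => [c|t]; first exact: (algebraic_const u _ (f c)).
  rewrite mem_cat => /orP[/mapP[a _ ->]|]; last exact: algebraic_gen.
  exact: (algebraic_const u _ (x a)).
have := @trdeg_relative _ _ _ fM u [::] [::] (map z (w i)); rewrite !cats0 !addn0; apply.
move=> W t; rewrite !cats0; apply: algebraic_trans => [c|b]; last exact: algebraic_gen.
exact: (algebraic_const u _ (f c)).
Qed.

(** Compose with sigma; the base field shrinks to sigma(k), which can only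
    increase transcendence degrees. *)
Lemma fiber_trdeg_noninc i n n' :
  fiber_trdeg_spec i n -> fiber_trdeg_spec i.+1 n' -> (n' <= n)%N.
Proof.
move=> [_ le_n] [[L [f [z [tz <-]]]] _].
pose f' : {rmorphism k -> L} := f \o sigma.
have zin c : (z \o salg_sigma S) (alg_in S c) = f' c.
  by rewrite -[LHS]/(z (salg_sigma S _)) (semihom_in (salg_sigma S)) (semihom_in z).
pose z' : khom S (Algebra f') := @SemiHom _ _ S (Algebra f') (z \o salg_sigma S) zin.
have tz' : trivial_below i z'.
  move=> j ji.
  exact: (@trivial_below_map _ _ _ G (Algebra f) (Algebra f') idfun j j.+1 z z') (tz j.+1 ji).
apply: leq_trans (le_n _ _ _ tz').
have -> : map z' (w i) = map z (w i.+1) by rewrite /w /level -!map_comp.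
have := @trdeg_relative _ _ _ f' f [::] [::] (map z (w i.+1)); rewrite !cats0 !addn0; apply.
move=> W t; rewrite !cats0; apply: algebraic_trans => [c|b]; last exact: algebraic_gen.
exact: (algebraic_const f _ (sigma c)).
Qed.

Lemma levels_trdeg_linear : exists d e N, forall i, (N <= i)%N ->
  max_trdeg (lev i) (d * i + e).
Proof.
have [D DE] := choice levels_trdeg_exists.
have [n nE] := choice fiber_trdeg_exists.
have D0 : D 0%N = 0%N.
  by apply: max_trdeg_uniq (DE 0%N) _; have [[L [x <-]] _] := DE 0%N; split; [exists L, x|].
have DS i : D i.+1 = (D i + n i)%N.
  by apply/eqP; rewrite eqn_leq (trdeg_step_le (DE i) (DE _) (nE i))
    (trdeg_step_ge (DE i) (DE _) (nE i)).
have nS i : (n i.+1 <= n i)%N := fiber_trdeg_noninc (nE i) (nE i.+1).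
have n_noninc i j : (i <= j)%N -> (n j <= n i)%N.
  by move/subnKC <-; elim: (j - i)%N => [|m IH]; rewrite ?addn0 // addnS (leq_trans (nS _)).
have [N Nmin] : exists N, forall i, (n N <= n i)%N.
  pose Q m := `[< exists i, n i = m >].
  have exQ : exists m, Q m by exists (n 0%N); apply/asboolP; exists 0%N.
  case: (ex_minnP exQ) => _ /asboolP[N <-] le_N; exists N => i.
  by apply: le_N; apply/asboolP; exists i.
have DN m : (n N * m <= D m)%N.
  elim: m => [|m IH]; first by rewrite muln0.
  by rewrite mulnS DS addnC leq_add.
exists (n N), (D N - n N * N)%N, N => i Ni.
have -> : (n N * i + (D N - n N * N) = D i)%N; last exact: DE.
rewrite -(subnKC Ni); elim: (i - N)%N => [|m IH]; first by rewrite addn0 subnKC.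
rewrite addnS DS -IH mulnS.
have -> : n (N + m)%N = n N by apply/eqP; rewrite eqn_leq Nmin n_noninc ?leq_addr.
by lia.
Qed.
End Growth.

(** If the generators s lie in S'_c, then sigma^j(s) lies in S'_(j+c). *)
Lemma levels_compare (k : fieldType) (sigma : {rmorphism k -> k}) (A A' : algebra k)
    (s : seq A) (s' : seq A') (S : salgebra sigma) (phi : shom (prol_salg sigma A) S)
    (phi' : shom (prol_salg sigma A') S) :
  generates (fun a : A' => a \in s') -> (forall y, exists x, phi' x = y) ->
  exists c, forall i m m', max_trdeg (levels s phi i) m ->
    max_trdeg (levels s' phi' (i + c)) m' -> (m <= m')%N.
Proof.
move=> gen_s' phi'_surj.
have [c cE] : exists c, forall a, a \in s ->
    subalg (alg_in S) (levels s' phi' c) (coord_iter phi 0 a).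
  elim: s => [|a r [c IH]]; first by exists 0%N.
  have [c' ac'] := levels_exhaust gen_s' (phi'_surj (coord_iter phi 0 a)).
  exists (maxn c c') => b; rewrite inE => /orP[/eqP->|/IH].
    exact: subalg_mono (@levels_mono _ _ _ s' _ phi' _ _ (leq_maxr c c')) ac'.
  exact: subalg_mono (@levels_mono _ _ _ s' _ phi' _ _ (leq_maxl c c')).
have up j a : a \in s -> subalg (alg_in S) (levels s' phi' (j + c)) (coord_iter phi j a).
  move=> /cE sa; elim: j => [//|j IH]; rewrite addSn.
  exact: (sigma_levels (S := S) IH).
exists c => i m m' [[L [x <-]] _] [_ le_m'].
apply: leq_trans (le_m' _ x); apply: point_trdeg_subalg => _ /mem_levels[j [a [ji sa ->]]].
by apply: subalg_mono (up j a sa); apply: levels_mono; rewrite leq_add2r ltnW.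
Qed.

Local Close Scope ring_scope.

Theorem theorem3p7 (k : fieldType) (sigma : {rmorphism k -> k})
    (GG : alggroup k) (G : sclosed_subgroup (sgroup_of sigma GG)) :
  exists d e : nat,
    dim_closure_eventually G d e /\
    (forall (GG' : alggroup k)
            (f : sclosed_embedding (sub_sgroup G) (sgroup_of sigma GG'))
            (d' e' : nat),
       dim_closure_eventually (simage f) d' e' ->
       d = d' /\ (d = 0 -> e = e')).
Proof.
have [s gen_s] := coord_fg GG.
have [d [e [N DE]]] := levels_trdeg_linear G gen_s.
exists d, e; split.
  exists N => i Ni; apply/(krull_dim_closure i _ gen_s).
    by move=> x; exact (iff_sym (sub_pi_eq0 G x)).
  by apply: DE; exact: leqW.
move=> GG' f d' e' [N' DE'].
have [s' gen_s'] := coord_fg GG'.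
pose phi' : shom (prol_salg sigma (coord GG')) (sub_salg G) := f.
have {}DE' i : (N' <= i)%N -> max_trdeg (levels s' phi' i.+1) (d' * i.+1 + e').
  by move=> /DE' /(krull_dim_closure _ _ gen_s'); apply.
have [c cE] := levels_compare s (sub_pi G) gen_s' (semb_surj f).
have [c' cE'] := levels_compare s' phi' gen_s (@sub_pi_surj _ _ _ G).
have le1 i : (N + N' <= i)%N -> (d * i.+1 + e <= d' * (i.+1 + c) + e')%N.
  move=> Ni; apply: (cE i.+1); first by apply: DE; lia.
  by rewrite addSn; apply: DE'; lia.
have le2 i : (N + N' <= i)%N -> (d' * i.+1 + e' <= d * (i.+1 + c') + e)%N.
  move=> Ni; apply: (cE' i.+1); first by apply: DE'; lia.
  by apply: DE; lia.
have dd' : d = d'.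
  apply/eqP; rewrite eqn_leq; apply/andP; split; rewrite leqNgt; apply/negP => lt_d.
    (* At this index the larger slope outweighs all constant terms. *)
    have := le1 (N + N' + d' * c + e')%N; nia.
  have := le2 (N + N' + d * c' + e)%N; nia.
split=> // d0; subst d'; have := le1 _ (leqnn _); have := le2 _ (leqnn _).
by rewrite d0 !mul0n !add0n => ee ee'; apply/eqP; rewrite eqn_leq ee ee'.
Qed.
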